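(* Let $d\ge2$ and let $\Omega=(-a_1,a_1)\times\cdots\times(-a_d,a_d)\subset\mathbb{R}^d$, $a_1,\dots,a_d>0$, be a cuboid. Let $\Omega^\star$ and $\Omega^\sharp$ be the cubes (of the form $(-a,a)^d$) such that $\operatorname{Vol}_{d-1}(\partial\Omega^\star)=\operatorname{Vol}_{d-1}(\partial\Omega)$ and $\operatorname{Vol}_d(\Omega^\sharp)=\operatorname{Vol}_d(\Omega)$. Then: (1) $\sigma_1(\Omega^\star)\ge\sigma_1(\Omega)$, with equality if and only if $\Omega^\star=\Omega$; (2) $\sigma_1(\Omega^\sharp)\ge\sigma_1(\Omega)$, with equality if and only if $\Omega^\sharp=\Omega$.
   Context: The Steklov eigenvalues of a bounded Lipschitz domain $\Omega\subset\mathbb{R}^d$ ($d\ge2$) are the real numbers $\sigma$ for which there is a nonzero harmonic function $u$ on $\Omega$ with $\partial_n u=\sigma u$ (a.e.) on $\partial\Omega$, where $\partial_n$ is the outward normal derivative. They form a discrete sequence $0=\sigma_0<\sigma_1\le\sigma_2\le\cdots\nearrow\infty$, repeated according to multiplicity; $\sigma_1(\Omega)$ is the first nonzero one. $\operatorname{Vol}_k$ is $k$-dimensional volume. *)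

(* Defs.v *)
From HB Require Import structures.
From mathcomp Require Import all_boot all_order all_algebra.
From mathcomp Require Import all_classical all_reals all_analysis.
Set Implicit Arguments.
Unset Strict Implicit.
Unset Printing Implicit Defensive.
Import Order.TTheory GRing.Theory Num.Theory.
Import numFieldNormedType.Exports.
Local Open Scope classical_set_scope.
Local Open Scope ring_scope.

(* ['rV[R]_n] carries the sigma-algebra generated by the coordinates, i.e. the
   Borel sigma-algebra of R^n. *)

Section measurable_rV.
Context {R : realType} {n : nat}.

Let coords (i : 'I_n) (x : 'rV[R]_n) : measurableTypeR R := x ord0 i.

Let rV_set0 : g_sigma_preimage coords set0.
Proof. exact: sigma_algebra0. Qed.

Let rV_setC A : g_sigma_preimage coords A -> g_sigma_preimage coords (~` A).
Proof. exact: sigma_algebraC. Qed.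

Let rV_bigcup (F : (set 'rV[R]_n)^nat) :
  (forall i, g_sigma_preimage coords (F i)) ->
  g_sigma_preimage coords (\bigcup_i (F i)).
Proof. exact: sigma_algebra_bigcup. Qed.

HB.instance Definition _ := @isMeasurable.Build default_measure_display
  'rV[R]_n (g_sigma_preimage coords) rV_set0 rV_setC rV_bigcup.

Lemma measurable_coord (i : 'I_n) :
  measurable_fun [set: 'rV[R]_n] (coords i).
Proof.
move=> _ Y mY; rewrite setTI; apply: sub_sigma_algebra => /=.
rewrite -bigcup_seq/=; exists i => /=; first by rewrite mem_index_enum.
by exists Y => //; rewrite setTI.
Qed.

Lemma measurable_fun_coordP d (T : measurableType d) (f : T -> 'rV[R]_n) :
  measurable_fun [set: T] f <->
  forall i, measurable_fun [set: T] (fun x => f x ord0 i : measurableTypeR R).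
Proof.
apply: (@iff_trans _ (g_sigma_preimage
    (fun i => coords i \o f) `<=` measurable)).
  rewrite g_sigma_preimage_comp; split=> [mf A [/= C preC <-]|prefS].
    exact: mf.
  by move=> _ A mA; apply: prefS; exists A.
split=> [fS i|mf].
- move=> _ A mA.
  apply: fS; apply: sub_sigma_algebra.
  rewrite -bigcup_seq/=; exists i => /=; first by rewrite mem_index_enum.
  by exists A.
- apply: smallest_sub; first exact: sigma_algebra_measurable.
  rewrite -bigcup_seq; apply: bigcup_sub => i _.
  by move=> A [B mB <-]; exact: mf.
Qed.

End measurable_rV.

(* [insert_coord i c y] is the point of R^d whose i-th coordinate is c and whose
   remaining coordinates are, in order, those of y : R^(d-1). *)
Definition insert_coord (R : realType) (d : nat) (i : 'I_d) (c : R)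
    (y : 'rV[R]_d.-1) : 'rV[R]_d :=
  \row_j (if unlift i j is Some k then y ord0 k else c).

Lemma measurable_insert_coord (R : realType) (d : nat) (i : 'I_d) :
  measurable_fun [set: measurableTypeR R * 'rV[R]_d.-1]
    (fun p => insert_coord i p.1 p.2).
Proof.
apply/measurable_fun_coordP => j.
under eq_fun do rewrite mxE.
case: (unlift i j) => [k|]; last exact: measurable_fst.
exact: (measurableT_comp (measurable_coord k) measurable_snd).
Qed.

Lemma measurable_insert_coordr (R : realType) (d : nat) (i : 'I_d) (c : R) :
  measurable_fun [set: 'rV[R]_d.-1] (insert_coord i c).
Proof.
apply/measurable_fun_coordP => j.
under eq_fun do rewrite mxE.
by case: (unlift i j) => [k|]; [exact: measurable_coord|exact: measurable_cst].
Qed.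

Section lebesgue_step.
Context {R : realType} {n : nat}.
Variable mu : {sigma_finite_measure set 'rV[R]_n -> \bar R}.

Let cons_coord (p : measurableTypeR R * 'rV[R]_n) : 'rV[R]_n.+1 :=
  insert_coord (ord0 : 'I_n.+1) p.1 p.2.

Definition lebesgue_rVS : set 'rV[R]_n.+1 -> \bar R :=
  pushforward (lebesgue_measure \x mu)%E cons_coord.

Let mcons_coord : measurable_fun setT cons_coord.
Proof. exact: (@measurable_insert_coord R n.+1 ord0). Qed.

Let lebesgue_rVS0 : lebesgue_rVS set0 = 0%E.
Proof. by rewrite /lebesgue_rVS /pushforward preimage_set0 measure0. Qed.

Let lebesgue_rVS_ge0 A : (0 <= lebesgue_rVS A)%E.
Proof. exact: measure_ge0. Qed.

Let lebesgue_rVS_sigma_additive : semi_sigma_additive lebesgue_rVS.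
Proof.
move=> F mF tF mUF; rewrite /lebesgue_rVS /pushforward preimage_bigcup.
apply: measure_semi_sigma_additive.
- by move=> k; rewrite -[X in measurable X]setTI; exact: mcons_coord.
- apply/trivIsetP => /= i j _ _ ij; rewrite -preimage_setI.
  by move/trivIsetP : tF => /(_ _ _ _ _ ij) ->//; rewrite preimage_set0.
- by rewrite -preimage_bigcup -[X in measurable X]setTI; exact: mcons_coord.
Qed.

HB.instance Definition _ := isMeasure.Build _ _ _ lebesgue_rVS
  lebesgue_rVS0 lebesgue_rVS_ge0 lebesgue_rVS_sigma_additive.

Let lebesgue_rVS_sigma_finite : sigma_finite setT lebesgue_rVS.
Proof.
have [F FT Fmoo] : sigma_finite setT (lebesgue_measure \x mu)%E.
  have /sigma_finiteP[F [TF ndF Foo]] := sigma_finiteT (@lebesgue_measure R).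
  have /sigma_finiteP[G [TG ndG Goo]] := sigma_finiteT mu.
  exists (fun k => F k `*` G k) => [|k].
    rewrite -setXTT TF TG predeqE => -[x y]; split.
      move=> [/= [k _ Fkx] [l _ Gly]]; exists (maxn k l) => //; split.
      - by move: x Fkx; exact/subsetPset/ndF/leq_maxl.
      - by move: y Gly; exact/subsetPset/ndG/leq_maxr.
    by move=> [k _ []/= ? ?]; split; exists k.
  have [mF Fkoo] := Foo k; have [mG Gkoo] := Goo k.
  split; first exact: measurableX.
  by rewrite product_measure1E// lte_mul_pinfty// ge0_fin_numE.
pose g (x : 'rV[R]_n.+1) : measurableTypeR R * 'rV[R]_n :=
  (x ord0 ord0, \row_j x ord0 (lift ord0 j)).
have mg : measurable_fun setT g.
  apply: measurable_fun_pair; first exact: measurable_coord.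
  apply/measurable_fun_coordP => j; under eq_fun do rewrite mxE.
  exact: measurable_coord.
have gK p : g (cons_coord p) = p.
  case: p => c y; rewrite /g /cons_coord /insert_coord /=; congr pair.
    by rewrite mxE unlift_none.
  by apply/rowP => j; rewrite !mxE liftK.
exists (fun k => g @^-1` F k) => [|k].
  by rewrite -preimage_bigcup -FT preimage_setT.
have [mFk Fkoo] := Fmoo k; split.
  by rewrite -[X in measurable X]setTI; exact: mg.
rewrite /lebesgue_rVS /pushforward -comp_preimage.
by rewrite (_ : g \o cons_coord = id)//; apply/funext => p /=; exact: gK.
Qed.

HB.instance Definition _ := Measure_isSigmaFinite.Build _ _ _ lebesgue_rVS
  lebesgue_rVS_sigma_finite.

End lebesgue_step.

Fixpoint lebesgue_rV (R : realType) (n : nat) :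
    {sigma_finite_measure set 'rV[R]_n -> \bar R} :=
  if n is n'.+1 then lebesgue_rVS (lebesgue_rV R n')
  else \d_(0 : 'rV[R]_0).

Definition cuboid (R : realType) (d : nat) (a : 'rV[R]_d) : set 'rV[R]_d :=
  [set x | forall i, - a ord0 i < x ord0 i < a ord0 i].

Lemma measurable_cuboid (R : realType) (d : nat) (a : 'rV[R]_d) :
  measurable (cuboid a).
Proof.
rewrite (_ : cuboid a = \bigcap_(i in [set: 'I_d])
    ((fun x : 'rV[R]_d => x ord0 i : measurableTypeR R) @^-1`
       `]- a ord0 i, a ord0 i[%classic)); last first.
  by apply/seteqP; split=> x /= ax i => [_|]; have := ax i; rewrite /= in_itv//=;
    exact.
apply: fin_bigcap_measurable => // i _; rewrite -[X in measurable X]setTI.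
exact: measurable_coord.
Qed.

(* The (d-1)-dimensional volume on the boundary of [cuboid a].  The face
   x_i = +a_i (s = false) or x_i = -a_i (s = true) is parametrized isometrically
   by the (d-1)-dimensional cuboid of its other coordinates, [col' i a] being [a]
   with its i-th entry deleted; faces overlap only in null sets. *)
Section surface_measure.
Context {R : realType} {d : nat}.
Variable a : 'rV[R]_d.

Let face (i : 'I_d) (s : bool) : 'rV[R]_d.-1 -> 'rV[R]_d :=
  insert_coord i ((-1) ^+ s * a ord0 i).

Definition surface_measure (A : set 'rV[R]_d) : \bar R :=
  (\sum_(i < d) \sum_(s : bool)
     lebesgue_rV R d.-1 (cuboid (col' i a) `&` face i s @^-1` A))%E.

Let mface i s (A : set 'rV[R]_d) : measurable A ->
  measurable (cuboid (col' i a) `&` face i s @^-1` A).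
Proof.
move=> mA; apply: measurableI; first exact: measurable_cuboid.
by rewrite -[X in measurable X]setTI; exact: measurable_insert_coordr.
Qed.

Let surface_measure0 : surface_measure set0 = 0%E.
Proof.
rewrite /surface_measure big1// => i _; rewrite big1// => s _.
by rewrite preimage_set0 setI0 measure0.
Qed.

Let surface_measure_ge0 A : (0 <= surface_measure A)%E.
Proof. by apply: sume_ge0 => i _; apply: sume_ge0 => s _; exact: measure_ge0. Qed.

Let surface_measure_sigma_additive : semi_sigma_additive surface_measure.
Proof.
move=> F mF tF mUF; rewrite [X in _ --> X](_ : _ =
    lim ((fun n => \sum_(0 <= k < n) surface_measure (F k)) @ \oo))%E.
  by apply: is_cvg_ereal_nneg_natsum => k _; exact: surface_measure_ge0.
rewrite nneseries_sum; last by move=> *; apply: sume_ge0 => *; exact: measure_ge0.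
apply: eq_bigr => i _.
rewrite nneseries_sum; last by move=> *; exact: measure_ge0.
apply: eq_bigr => s _.
rewrite preimage_bigcup setI_bigcupr; apply/esym/cvg_lim => //.
apply: measure_semi_sigma_additive.
- by move=> k; exact: mface.
- apply/trivIsetP => /= k l _ _ kl; rewrite setIACA -preimage_setI.
  by move/trivIsetP : tF => /(_ _ _ _ _ kl) ->//; rewrite preimage_set0 setI0.
- by rewrite -setI_bigcupr -preimage_bigcup; exact: mface.
Qed.

HB.instance Definition _ := isMeasure.Build _ _ _ surface_measure
  surface_measure0 surface_measure_ge0 surface_measure_sigma_additive.

End surface_measure.

Section steklov.
Context {R : realType} {d : nat}.
Implicit Types (D Om : set 'rV[R]_d) (f u t h : 'rV[R]_d -> R).
Implicit Types (mu S : {measure set 'rV[R]_d -> \bar R}).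

Definition partial (i : 'I_d) f (x : 'rV[R]_d) : R := 'D_(delta_mx ord0 i) f x.

(* f is C^1, resp. C^2, on the open set D. *)
Definition C1_on D f : Prop := forall x, D x ->
  {for x, continuous f} /\
  forall i, derivable f x (delta_mx ord0 i) /\ {for x, continuous (partial i f)}.

Definition C2_on D f : Prop :=
  C1_on D f /\ forall i, C1_on D (partial i f).

Definition harmonic_on D u : Prop :=
  C2_on D u /\ forall x, D x -> \sum_(i < d) partial i (partial i u) x = 0.

Definition L2_on mu D f : Prop :=
  measurable_fun D f /\ (\int[mu]_(x in D) (f x ^+ 2)%:E < +oo)%E.

Definition L2_cvg mu D (f_ : ('rV[R]_d -> R)^nat) f : Prop :=
  (\int[mu]_(x in D) ((f_ n x - f x) ^+ 2)%:E)%E @[n --> \oo] --> 0%E.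

(* In the definitions below Om is a bounded Lipschitz domain and S the
   (d-1)-dimensional volume on its boundary. *)

(* u belongs to H^1(Om), with gradient g and boundary trace t: H^1(Om) is the
   closure, in the H^1 norm, of the restrictions of the C^1 functions on R^d, and
   the trace operator is the continuous extension, from H^1(Om) to L^2 of the
   boundary, of the restriction of such functions to the boundary. *)
Definition H1_trace Om S u (g : 'I_d -> 'rV[R]_d -> R) t : Prop :=
  [/\ L2_on (lebesgue_rV R d) Om u,
      forall i, L2_on (lebesgue_rV R d) Om (g i),
      L2_on S setT t
    & exists phi : ('rV[R]_d -> R)^nat,
      [/\ forall n, C1_on setT (phi n),
          L2_cvg (lebesgue_rV R d) Om phi u,
          forall i, L2_cvg (lebesgue_rV R d) Om (fun n => partial i (phi n)) (g i)
        & L2_cvg S setT phi t]].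

(* h is the outward normal derivative of the harmonic function u, in the sense of
   Green's formula: the integral over Om of grad u . grad phi equals the boundary
   integral of (d_n u) phi. *)
Definition normal_derivative Om S u h : Prop :=
  L2_on S setT h /\
  forall phi, C1_on setT phi ->
    \int[lebesgue_rV R d]_(x in Om) (\sum_(i < d) partial i u x * partial i phi x) =
    \int[S]_x (h x * phi x).

Definition steklov_eigenvalue Om S (sigma : R) : Prop :=
  exists u t h,
    [/\ harmonic_on Om u,
        exists2 x, Om x & u x != 0,
        H1_trace Om S u (fun i => partial i u) t,
        normal_derivative Om S u h
      & {ae S, forall x, h x = sigma * t x}].

End steklov.

(* The Steklov spectrum is discrete and bounded below, so this infimum is the
   smallest nonzero eigenvalue. *)
Definition sigma1 (R : realType) (d : nat) (a : 'rV[R]_d) : R :=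
  inf [set sigma |
    steklov_eigenvalue (cuboid a) (surface_measure a) sigma /\ sigma != 0].

(* Main.v *)
(* Testing against constants shows that a Steklov eigenvalue [sg <> 0] has an
   eigenfunction of mean zero on the boundary, so adding a constant makes it
   orthogonal to a given positive function without increasing the form [|grad
   u|^2 - sg u^2] (interior minus boundary), which splits over the coordinates
   into one-dimensional Robin forms. On [(-b, b)] choose [be] with [be tanh (be
   b) = sg]; the ground state [cosh (be x)] has energy [- be^2], and if [sg < al
   cot (al b)] every function orthogonal to it has energy at least [al^2], since
   correcting it by a multiple of the ground state makes it vanish at 0, where
   Riccati comparison applies on both halves. The projections onto the fibre
   ground states commute, so tensorization bounds the form from below by a
   positive multiple of the squared norm off the product ground state as soon as
   [al^2 > (d - 1) be^2]. Hence for the cube [sigma_1] is the common value of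
   [be tanh (be b)] and [al cot (al b)] with [al^2 = (d - 1) be^2]. For a cuboid
   with longest side [i0], [sin (al x_i0) prod_j cosh (be_j x_j)] with [al^2 =
   sum_j be_j^2] is an eigenfunction, which bounds [sigma_1] from above. Either
   volume constraint gives [b <= a_i0] and makes the product of the other half-
   lengths smaller than [b^(d - 1)] unless the cuboid is the cube; since the
   half-length solving [be tanh (be x) = sg] is a log-convex function of [be^2],
   this makes the eigenvalue of the cuboid strictly smaller. *)
Require Import Defs.
From HB Require Import structures.
From mathcomp Require Import all_boot all_order all_algebra.
From mathcomp Require Import all_classical all_reals all_analysis.
From mathcomp Require Import measurable_realfun ring lra.
Set Implicit Arguments.
Unset Strict Implicit.
Unset Printing Implicit Defensive.
Import Order.TTheory GRing.Theory Num.Theory.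
Import numFieldNormedType.Exports.
Local Open Scope classical_set_scope.
Local Open Scope ring_scope.

(** * Integration over cuboids and their boundaries *)

(** The definitions provide no variational characterization, so both bounds on the infimum are
    obtained eigenvalue by eigenvalue. An eigenfunction is only an $H^1$ limit of $C^1$ functions on
    the whole space; the inequalities between forms are therefore proved for such functions, where
    they reduce to calculus on fibres, and then passed to the limit together with the trace. Since
    [inf] takes a default value on a set without lower bound, bounding it by one eigenvalue also
    requires some lower bound for the nonzero eigenvalues of an arbitrary cuboid; a Friedrichs
    inequality supplies it. At the root belonging to the cube, both conditions for the gap
    degenerate to equalities; a hypothetical eigenvalue below the root leaves room for a smaller
    $\sigma$ at which, with the same $\alpha$, both are strict. The comparison of the two roots is
    by contradiction: if the root of the cuboid were at least that of the cube, monotonicity of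
    $x\cot x$ would bound $\sum_j\beta_j^2$, taken at the root of the cube, by its value for the
    cube, and summing tangent lines of the log-convex function would force the product of the
    shorter half-lengths up to $b^{d-1}$. *)

Section measure_sum.
Context d (T : measurableType d) (R : realType).

(** Lets the boundary volume be integrated face by face. The list of measures is read as the initial
    segment of a sequence padded with the zero measure, which is the shape [msum] expects. *)
Lemma ge0_integral_fin_measure_sum (I : Type) (s : seq I)
    (m : I -> {measure set T -> \bar R}) (mu : {measure set T -> \bar R})
    (D : set T) (f : T -> \bar R) :
  (forall A, measurable A -> mu A = \sum_(i <- s) m i A)%E ->
  measurable D -> measurable_fun D f -> (forall x, D x -> 0 <= f x)%E ->
  (\int[mu]_(x in D) f x = \sum_(i <- s) \int[m i]_(x in D) f x)%E.
Proof.
move=> muE mD mf f0.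
pose m_ : {measure set T -> \bar R}^nat :=
  fun n => nth (mzero : {measure set T -> \bar R}) (map m s) n.
rewrite (@eq_measure_integral _ _ _ _ (msum m_ (size s))); last first.
  move=> A mA _; rewrite muE// /msum.
  rewrite -(big_map m xpredT (fun k : {measure set T -> \bar R} => k A)).
  by rewrite (big_nth (mzero : {measure set T -> \bar R})) size_map big_mkord.
rewrite ge0_integral_measure_sum//.
rewrite -(big_map m xpredT
  (fun k : {measure set T -> \bar R} => \int[k]_(x in D) f x)%E).
by rewrite (big_nth (mzero : {measure set T -> \bar R})) size_map big_mkord.
Qed.

End measure_sum.

Section continuous_measurable.
Context {R : realType} {n : nat}.

Let box (p : 'rV[rat]_n * nat) : set 'rV[R]_n :=
  [set x | forall i, `|x ord0 i - ratr (p.1 ord0 i)| < p.2.+1%:R^-1].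

Let measurable_box p : measurable (box p).
Proof.
rewrite (_ : box p = \bigcap_(i in [set: 'I_n])
    ((fun x : 'rV[R]_n => x ord0 i : measurableTypeR R) @^-1`
       (ball (ratr (p.1 ord0 i) : R) p.2.+1%:R^-1))); last first.
  by apply/seteqP; split=> x /= xp i => [_|]; have := xp i;
    rewrite /ball/= distrC; [|apply].
apply: fin_bigcap_measurable => // i _; rewrite -[X in measurable X]setTI.
by apply: measurable_coord => //; exact: measurable_ball.
Qed.

(** The sigma-algebra is generated by the coordinates, so this rests on second countability: an open
    set is the union of the boxes inside it with rational centre and radius $1/(k+1)$, of which
    there are countably many. *)
Lemma open_measurable_rV (U : set 'rV[R]_n) : open U -> measurable U.
Proof.
move=> oU.
have -> : U = \bigcup_(p in [set p | box p `<=` U]) box p.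
  apply/seteqP; split => [x Ux|x [p /= pU]]; last exact: pU.
  have /nbhs_ballP[e /= e0 xeU] : nbhs x U by exact: open_nbhs_nbhs.
  (* The rational centre lies within one radius of [x], so a radius below [e / 2] keeps the whole
     box in the ball. *)
  have [k ke] : exists k : nat, k.+1%:R^-1 < e / 2.
    exists (Num.truncn (2 / e)).
    rewrite invf_plt ?posrE ?divr_gt0// invf_div.
    by rewrite truncnS_gt.
  have /choice[q qE] : forall i, exists q : rat, `|x ord0 i - ratr q| < k.+1%:R^-1.
    move=> i; have : 0 < k.+1%:R^-1 :> R by rewrite invr_gt0.
    move: (k.+1%:R^-1 : R) => r r0; have [|q] := @rat_in_itvoo R (x ord0 i - r) (x ord0 i + r).
      by rewrite ltrBlDr -addrA ltrDl addr_gt0.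
    rewrite in_itv/= => /andP[q1 q2]; exists q; rewrite ltr_norml.
    by apply/andP; split; lra.
  exists (\row_i q i, k) => /=; last by move=> i /=; rewrite mxE.
  move=> y /= yq; apply: xeU; split=> // i j; rewrite !ord1 /ball/=.
  have := yq j; have := qE j; rewrite mxE /=; move: (k.+1%:R^-1 : R) ke => r rk a1 a2.
  rewrite (_ : _ - _ = (x ord0 j - ratr (q j)) - (y ord0 j - ratr (q j))); last by ring.
  by rewrite (le_lt_trans (ler_normB _ _))//; lra.
rewrite bigcup_mkcond; apply: countable_bigcupT_measurable.
  exact: countableP.
by move=> p; case: ifPn.
Qed.

Lemma continuous_measurable_rV (f : 'rV[R]_n -> R) :
  continuous f -> measurable_fun setT f.
Proof.
move=> cf; apply: (measurability _ (RGenOpens.measurableE R)).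
move=> _ [_ [x [y ->]] <-]; rewrite setTI; apply: open_measurable_rV.
by apply: open_comp => //; exact: interval_open.
Qed.

End continuous_measurable.

Section insert_coord.
Context {R : realType}.

Lemma insert_coord_swap (n : nat) (j : 'I_n.+1) (c e : R) (y : 'rV[R]_n) :
  insert_coord (ord0 : 'I_n.+2) e (insert_coord j c y : 'rV[R]_n.+1) =
  insert_coord (lift ord0 j : 'I_n.+2) c
    (insert_coord (ord0 : 'I_n.+1) e y : 'rV[R]_n.+1).
Proof.
apply/rowP => k; rewrite !mxE.
case: (unliftP ord0 k) => [k' ->|->]; last first.
  case: unliftP => [k' /= e0|/(congr1 val)//].
  rewrite mxE; case: unliftP => // k'' e1; move: e0; rewrite e1 => /(congr1 val)/=.
  by rewrite /bump /= addnC.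
rewrite mxE; case: (unliftP j k') => [l ->|->]; last first.
  by rewrite unlift_none.
rewrite (_ : lift ord0 (lift j l) = lift (lift ord0 j) (lift ord0 l)); last first.
  by apply: val_inj; rewrite /= /bump /= !add1n ltnS addnS.
by rewrite liftK mxE liftK.
Qed.

Lemma insert_coord_at (n : nat) (i : 'I_n.+1) (c : R) (y : 'rV[R]_n) :
  insert_coord i c y ord0 i = c.
Proof. by rewrite mxE unlift_none. Qed.

Lemma insert_coord_lift (n : nat) (i : 'I_n.+1) j (c : R) (y : 'rV[R]_n) :
  insert_coord i c y ord0 (lift i j) = y ord0 j.
Proof. by rewrite mxE liftK. Qed.

Lemma cuboid_insert_coord (n : nat) (a : 'rV[R]_n.+1) (i : 'I_n.+1) c (y : 'rV[R]_n) :
  cuboid a (insert_coord i c y) <->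
  (- a ord0 i < c < a ord0 i) /\ cuboid (col' i a) y.
Proof.
split=> [h|[h1 h2] j].
  split; first by have := h i; rewrite insert_coord_at.
  by move=> j; have := h (lift i j); rewrite insert_coord_lift mxE.
case: (unliftP i j) => [k ->|->]; last by rewrite insert_coord_at.
by rewrite insert_coord_lift; have := h2 k; rewrite mxE.
Qed.

Lemma measurable_insert_coordl (n : nat) (i : 'I_n.+1) (y : 'rV[R]_n) :
  measurable_fun [set: measurableTypeR R] (fun c => insert_coord i c y).
Proof.
apply/measurable_fun_coordP => j; under eq_fun do rewrite mxE.
by case: (unlift i j) => [k|]; [exact: measurable_cst|exact: measurable_id].
Qed.

Local Open Scope ereal_scope.

(** Lebesgue measure is built by adding coordinate 0, so only that coordinate splits off by
    definition. For another one, coordinate 0 is split off, the induction hypothesis is applied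
    inside, the two insertions are exchanged by [insert_coord_swap], and coordinate 0 is folded
    back. *)
Lemma tonelli_insert_coord (n : nat) (i : 'I_n.+1) (f : 'rV[R]_n.+1 -> \bar R) :
  measurable_fun setT f -> (forall x, 0 <= f x) ->
  \int[lebesgue_rV R n.+1]_x f x =
  \int[lebesgue_rV R n]_y \int[lebesgue_measure]_c f (insert_coord i c y).
Proof.
have step0 m (g : 'rV[R]_m.+1 -> \bar R) :
  measurable_fun setT g -> (forall x, 0 <= g x) ->
  \int[lebesgue_rV R m.+1]_x g x =
  \int[(lebesgue_measure \x lebesgue_rV R m)%E]_p g (insert_coord (ord0 : 'I_m.+1) p.1 p.2).
  move=> mg g0.
  rewrite /=/lebesgue_rVS/= ge0_integral_pushforward//.
  exact: (@measurable_insert_coord R m.+1 ord0).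
have mins m (g : 'rV[R]_m.+1 -> \bar R) j : measurable_fun setT g ->
    measurable_fun setT (fun p : measurableTypeR R * 'rV[R]_m =>
       g (insert_coord (j : 'I_m.+1) p.1 p.2)).
  by move=> mg; apply: measurableT_comp => //; exact: (@measurable_insert_coord R m.+1 j).
elim: n i f => [|n IH] i f mf f0.
  by rewrite (ord1 i) step0// fubini_tonelli2//; exact: mins.
case: (unliftP ord0 i) => [j ->|->]; last first.
  by rewrite step0// fubini_tonelli2//; exact: mins.
rewrite step0// fubini_tonelli1//; last exact: mins.
rewrite /fubini_F /=.
transitivity (\int[lebesgue_measure]_e \int[lebesgue_rV R n]_y
    \int[lebesgue_measure]_c f (insert_coord (lift ord0 j : 'I_n.+2) c
       (insert_coord (ord0 : 'I_n.+1) e y : 'rV[R]_n.+1))).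
  apply: eq_integral => e _; rewrite (IH j (fun y => f (insert_coord (ord0 : 'I_n.+2) e y)))//.
    by apply: eq_integral => y _; apply: eq_integral => c _; rewrite insert_coord_swap.
  by apply: measurableT_comp => //; exact: (@measurable_insert_coordr R n.+2 ord0).
pose h (z : 'rV[R]_n.+1) := \int[lebesgue_measure]_c f (insert_coord (lift ord0 j : 'I_n.+2) c z).
have mh : measurable_fun setT h.
  apply: (measurable_fun_fubini_tonelli_G (m1 := lebesgue_measure)
    (fun p : measurableTypeR R * 'rV[R]_n.+1 =>
       f (insert_coord (lift ord0 j : 'I_n.+2) p.1 p.2))) => //.
  exact: mins.
have h0 z : 0 <= h z by exact: integral_ge0.
transitivity (\int[lebesgue_rV R n.+1]_z h z) => //.
rewrite step0// fubini_tonelli1//; exact: mins.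
Qed.

End insert_coord.

Section bounded_measurable.
Context d (T : measurableType d) (R : realType).
Variables (mu : {measure set T -> \bar R}) (D : set T).
Implicit Types f g : T -> R.

(** On a set of finite measure this class lies in $L^1$ and is stable under sums and products, so
    integrability conditions follow the shape of the integrand. *)
Definition bmeas f :=
  measurable_fun D f /\ exists M, forall x, D x -> `|f x| <= M.

Lemma bmeas_cst c : bmeas (fun=> c).
Proof. by split; [exact: measurable_cst|exists `|c|]. Qed.

Lemma bmeasD f g : bmeas f -> bmeas g -> bmeas (fun x => f x + g x).
Proof.
move=> [mf [M fM]] [mg [N gN]]; split; first exact: measurable_funD.
exists (M + N) => x Dx; rewrite (le_trans (ler_normD _ _))//.
by rewrite lerD// ?fM ?gN.
Qed.

Lemma bmeasM f g : bmeas f -> bmeas g -> bmeas (fun x => f x * g x).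
Proof.
move=> [mf [M fM]] [mg [N gN]]; split; first exact: measurable_funM.
exists (M * N) => x Dx; rewrite normrM ler_pM// ?fM ?gN//.
Qed.

Lemma bmeasZ c f : bmeas f -> bmeas (fun x => c * f x).
Proof. by move=> bf; apply: bmeasM => //; exact: bmeas_cst. Qed.

Lemma bmeasB f g : bmeas f -> bmeas g -> bmeas (fun x => f x - g x).
Proof.
move=> [mf [M fM]] [mg [N gN]]; split; first exact: measurable_funB.
exists (M + N) => x Dx; rewrite (le_trans (ler_normB _ _))//.
by rewrite lerD// ?fM ?gN.
Qed.

Lemma bmeasX2 f : bmeas f -> bmeas (fun x => f x ^+ 2).
Proof. by move=> bf; under eq_fun do rewrite expr2; exact: bmeasM. Qed.

Lemma bmeas_sum (I : Type) (s : seq I) (F : I -> T -> R) :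
  (forall i, bmeas (F i)) -> bmeas (fun x => \sum_(i <- s) F i x).
Proof.
move=> bF; elim: s => [|i s IH].
  by under eq_fun do rewrite big_nil; exact: bmeas_cst.
by under eq_fun do rewrite big_cons; exact: bmeasD.
Qed.

Lemma eq_bmeas f g : {in D, f =1 g} -> bmeas f -> bmeas g.
Proof.
move=> fg [mf [M fM]]; split; first by apply/(measurable_fun_eqP _ fg).
by exists M => x Dx; rewrite -fg ?inE//; exact: fM.
Qed.

Hypotheses (mD : measurable D) (Dfin : (mu D < +oo)%E).

Lemma bmeas_integrable f : bmeas f -> mu.-integrable D (EFin \o f).
Proof.
move=> [mf [M fM]]; apply: measurable_bounded_integrable => //.
exists M; split; first exact: num_real.
by move=> N MN x /= Dx; rewrite (le_trans (fM _ Dx))// ltW.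
Qed.

Let int := bmeas_integrable.

Lemma RintD f g : bmeas f -> bmeas g ->
  \int[mu]_(x in D) (f x + g x) =
  \int[mu]_(x in D) f x + \int[mu]_(x in D) g x.
Proof. by move=> bf bg; rewrite RintegralD//; exact: int. Qed.

Lemma RintB f g : bmeas f -> bmeas g ->
  \int[mu]_(x in D) (f x - g x) =
  \int[mu]_(x in D) f x - \int[mu]_(x in D) g x.
Proof. by move=> bf bg; rewrite RintegralB//; exact: int. Qed.

Lemma RintZ c f : bmeas f ->
  \int[mu]_(x in D) (c * f x) = c * \int[mu]_(x in D) f x.
Proof. by move=> bf; rewrite RintegralZl//; exact: int. Qed.

Lemma RintZr c f : bmeas f ->
  \int[mu]_(x in D) (f x * c) = (\int[mu]_(x in D) f x) * c.
Proof. by move=> bf; rewrite RintegralZr//; exact: int. Qed.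

Lemma Rint_sum (I : Type) (s : seq I) (F : I -> T -> R) :
  (forall i, bmeas (F i)) ->
  \int[mu]_(x in D) (\sum_(i <- s) F i x) =
  \sum_(i <- s) \int[mu]_(x in D) F i x.
Proof.
move=> bF; elim: s => [|i s IH].
  rewrite big_nil; under eq_Rintegral do rewrite big_nil.
  by rewrite Rintegral_cst// mul0r.
rewrite big_cons -IH -RintD//; last exact: bmeas_sum.
by apply: eq_Rintegral => x _; rewrite big_cons.
Qed.

Lemma le_Rint f g : bmeas f -> bmeas g -> (forall x, D x -> f x <= g x) ->
  \int[mu]_(x in D) f x <= \int[mu]_(x in D) g x.
Proof. by move=> bf bg fg; apply: le_Rintegral => //; exact: int. Qed.

Lemma EFin_Rint f : bmeas f ->
  (\int[mu]_(x in D) f x)%:E = (\int[mu]_(x in D) (f x)%:E)%E.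
Proof.
move=> bf; rewrite /Rintegral fineK//; exact: (integrable_fin_num mD (int bf)).
Qed.

Lemma norm_Rint_le f M : bmeas f -> (forall x, D x -> `|f x| <= M) ->
  `|\int[mu]_(x in D) f x| <= M * fine (mu D).
Proof.
move=> bf fM; apply: le_trans (le_normr_Rintegral mD (int bf)) _.
rewrite -(Rintegral_cst _ mD)//; apply: le_Rint => //; last exact: bmeas_cst.
split; first exact: measurableT_comp (bf.1).
by exists M => x Dx; rewrite normr_id fM.
Qed.

End bounded_measurable.

Section parametric_integral.
Context d1 d2 (T1 : measurableType d1) (T2 : measurableType d2) (R : realType).
Variables (m2 : {sigma_finite_measure set T2 -> \bar R}) (D : set T2).
Hypothesis mD : measurable D.

(** Measurability of a parametric integral is a Tonelli statement for nonnegative functions: the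
    integrand is cut off by the indicator of [D] and split into its positive and negative parts. *)
Lemma measurable_Rint (f : T1 * T2 -> R) : measurable_fun setT f ->
  measurable_fun setT (fun x => \int[m2]_(y in D) f (x, y)).
Proof.
move=> mf; apply: measurableT_comp => //=.
under eq_fun do rewrite integral_mkcond.
pose g (p : T1 * T2) : R := f p * \1_D p.2.
rewrite (_ : (fun _ => _) = fun x => \int[m2]_y (EFin \o g) (x, y))%E; last first.
  apply/funext => x; apply: eq_integral => y _.
  rewrite /g /= /patch indicE.
  by case: ifPn => [yD|/negPf yD]; rewrite ?mulr1 ?mulr0.
have mg : measurable_fun setT (EFin \o g).
  apply/measurable_EFinP; apply: measurable_funM => //.
  apply: (@measurableT_comp _ _ _ _ _ _ (\1_D : T2 -> R) _ snd) => //.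
under eq_fun do rewrite integralE.
apply: emeasurable_funB.
  have /(_ (measurable_funepos mg) (fun=> funepos_ge0 _ _)) :=
    measurable_fun_fubini_tonelli_F (m2 := m2) ((EFin \o g)^\+)%E.
  by congr (measurable_fun _ _); apply/funext => x; apply: eq_integral => y _; rewrite !funeposE.
have /(_ (measurable_funeneg mg) (fun=> funeneg_ge0 _ _)) :=
  measurable_fun_fubini_tonelli_F (m2 := m2) ((EFin \o g)^\-)%E.
by congr (measurable_fun _ _); apply/funext => x; apply: eq_integral => y _; rewrite !funenegE.
Qed.

End parametric_integral.

Section cuboid_fubini.
Context {R : realType} {n : nat}.
Variable a : 'rV[R]_n.+1.
Hypothesis a0 : forall i, 0 < a ord0 i.
Implicit Types i : 'I_n.+1.
Notation leb := (@lebesgue_measure R).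

Definition side i : set (measurableTypeR R) := `]- a ord0 i, a ord0 i[%classic.

Lemma measurable_side i : measurable (side i).
Proof. exact: measurable_itv. Qed.

Lemma leb_side i : leb (side i) = (2 * a ord0 i)%:E.
Proof.
rewrite /side lebesgue_measure_itv/= lte_fin ifT; last by have := a0 i; lra.
by rewrite -EFinD; congr EFin; ring.
Qed.

Lemma leb_side_fin i : (leb (side i) < +oo)%E.
Proof. by rewrite leb_side ltry. Qed.

Lemma tonelli_cuboid i (f : 'rV[R]_n.+1 -> \bar R) :
  measurable_fun setT f -> (forall x, cuboid a x -> 0 <= f x)%E ->
  (\int[lebesgue_rV R n.+1]_(x in cuboid a) f x =
  \int[lebesgue_rV R n]_(y in cuboid (col' i a)) \int[leb]_(c in side i)
     f (insert_coord i c y))%E.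
Proof.
move=> mf f0; rewrite integral_mkcond (tonelli_insert_coord i).
- rewrite [RHS]integral_mkcond; apply: eq_integral => y _; rewrite {2}/patch.
  case: ifPn => [yK|yK].
    rewrite [RHS]integral_mkcond; apply: eq_integral => c _; rewrite /patch.
    congr (if _ then _ else _); apply/asboolP/asboolP.
    + by move/cuboid_insert_coord => [+ _]; rewrite /side/= in_itv.
    + rewrite /side/= in_itv/= => ci; apply/cuboid_insert_coord; split=> //.
      by rewrite inE in yK.
  rewrite integral0_eq// => c _; rewrite /patch ifF//.
  apply/negbTE/asboolP => /cuboid_insert_coord [_ yK'].
  by move/negP: yK; apply; rewrite inE.
- by apply/(measurable_restrictT _ (measurable_cuboid a)); exact: measurable_funTS.
- by move=> x; rewrite /patch; case: ifPn => //; rewrite inE => /f0.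
Qed.

End cuboid_fubini.

Lemma lebesgue_cuboid (R : realType) (n : nat) (a : 'rV[R]_n) :
  (forall i, 0 < a ord0 i) ->
  lebesgue_rV R n (cuboid a) = (\prod_(i < n) (2 * a ord0 i))%:E.
Proof.
elim: n a => [|n IH] a a0.
  rewrite big_ord0 /= diracE; case: (boolP (_ \in _)) => //.
  by move/negP; case; rewrite inE => -[].
rewrite -[LHS]mul1e -integral_cst; last exact: measurable_cuboid.
rewrite (tonelli_cuboid ord0)//.
rewrite (eq_integral (cst (2 * a ord0 ord0)%:E)) => [|y _]; last first.
  rewrite integral_cst; last exact: measurable_side.
  by rewrite mul1e; exact: leb_side.
rewrite integral_cst; last exact: measurable_cuboid.
transitivity ((2 * a ord0 ord0)%:E *
    (\prod_(i < n) (2 * col' ord0 a ord0 i))%:E)%E.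
  by congr (_ * _)%E; apply: IH => i; rewrite mxE.
rewrite -EFinM big_ord_recl; congr (_ * _)%:E.
by apply: eq_bigr => i _; rewrite mxE.
Qed.

Section cuboid_fubini_signed.
Context {R : realType} {n : nat}.
Variable a : 'rV[R]_n.+1.
Hypothesis a0 : forall i, 0 < a ord0 i.
Implicit Types i : 'I_n.+1.
Notation leb := (@lebesgue_measure R).
Notation lam := (lebesgue_rV R).

Lemma col'_gt0 i j : 0 < col' i a ord0 j.
Proof. by rewrite mxE. Qed.

Lemma cuboid_fin (m : nat) (b : 'rV[R]_m) :
  (forall j, 0 < b ord0 j) -> (lam m (cuboid b) < +oo)%E.
Proof. by move=> b0; rewrite lebesgue_cuboid// ltry. Qed.

Lemma bmeas_insert_coord i (F : 'rV[R]_n.+1 -> R) y :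
  measurable_fun setT F -> bmeas (cuboid a) F -> cuboid (col' i a) y ->
  bmeas (side a i) (fun c => F (insert_coord i c y)).
Proof.
move=> mF [_ [M FM]] yK; split.
  apply: measurable_funTS; apply: measurableT_comp => //.
  exact: measurable_insert_coordl.
exists M => c; rewrite /side/= in_itv/= => ci; apply: FM.
exact/cuboid_insert_coord.
Qed.

Lemma measurable_Rint_insert i (F : 'rV[R]_n.+1 -> R) :
  measurable_fun setT F ->
  measurable_fun setT (fun y => \int[leb]_(c in side a i) F (insert_coord i c y)).
Proof.
move=> mF; apply: (measurable_Rint leb (measurable_side a i)
  (f := fun p : 'rV[R]_n * measurableTypeR R => F (insert_coord i p.2 p.1))).
apply: measurableT_comp => //.
apply: (measurableT_comp (@measurable_insert_coord R n.+1 i)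
  (g := fun p : 'rV[R]_n * measurableTypeR R => (p.2, p.1))).
exact: measurable_swap.
Qed.

Lemma bmeas_Rint_insert i (F : 'rV[R]_n.+1 -> R) :
  measurable_fun setT F -> bmeas (cuboid a) F ->
  bmeas (cuboid (col' i a))
    (fun y => \int[leb]_(c in side a i) F (insert_coord i c y)).
Proof.
move=> mF bF; split; first by apply: measurable_funTS; exact: measurable_Rint_insert.
have [_ [M FM]] := bF; exists (M * fine (leb (side a i))) => y yK.
apply: norm_Rint_le.
- exact: measurable_side.
- exact: leb_side_fin.
- exact: bmeas_insert_coord.
- by move=> c ci; apply: FM; apply/cuboid_insert_coord; move: ci; rewrite /side/= in_itv.
Qed.

(** Tonelli applies to [F + M], nonnegative on the cuboid when [M] bounds [F] there; the
    contribution of the constant [M] then cancels. *)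
Lemma fubini_cuboid i (F : 'rV[R]_n.+1 -> R) :
  measurable_fun setT F -> bmeas (cuboid a) F ->
  \int[lam n.+1]_(x in cuboid a) F x =
  \int[lam n]_(y in cuboid (col' i a)) \int[leb]_(c in side a i)
     F (insert_coord i c y).
Proof.
have mK := measurable_cuboid a.
have mK' := measurable_cuboid (col' i a).
have Kf := cuboid_fin a0.
have K'f := cuboid_fin (col'_gt0 i).
have mI := measurable_side a i.
have If := leb_side_fin a0 i.
have ge0 (G : 'rV[R]_n.+1 -> R) : measurable_fun setT G -> bmeas (cuboid a) G ->
    (forall x, cuboid a x -> 0 <= G x) ->
    \int[lam n.+1]_(x in cuboid a) G x =
    \int[lam n]_(y in cuboid (col' i a)) \int[leb]_(c in side a i)
     G (insert_coord i c y).
  move=> mG bG G0; rewrite [LHS]/Rintegral [RHS]/Rintegral; congr fine.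
  rewrite (tonelli_cuboid i)//=; [|exact/measurable_EFinP].
  apply: eq_integral => y; rewrite inE => yK; rewrite EFin_Rint//.
  exact: bmeas_insert_coord.
move=> mF bF; have [_ [M FM]] := bF.
have := ge0 (fun x => F x + M); rewrite RintD//; last exact: bmeas_cst.
have M0 x : cuboid a x -> 0 <= M by move=> /FM; apply: le_trans.
rewrite (ge0 (fun=> M))//; last exact: bmeas_cst.
rewrite (_ : \int[_]_(y in _) \int[_]_(c in _) (_ + _) =
  \int[lam n]_(y in cuboid (col' i a))
    (\int[leb]_(c in side a i) F (insert_coord i c y) +
    \int[leb]_(c in side a i) M)); last first.
  apply: eq_Rintegral => y; rewrite inE => yK; rewrite RintD//; last exact: bmeas_cst.
  exact: bmeas_insert_coord.
rewrite RintD//; last 2 first.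
- exact: bmeas_Rint_insert.
- exact: bmeas_cst.
move=> H; apply/(@addIr _ (\int[lam n]_(y in cuboid (col' i a))
    \int[leb]_(c in side a i) M)); apply: H.
- by apply: measurable_funD => //.
- by apply: bmeasD => //; exact: bmeas_cst.
- by move=> x /FM; rewrite ler_norml => /andP[]; lra.
Qed.

End cuboid_fubini_signed.

Section integral_mrestr.
Context d (T : measurableType d) (R : realType).
Local Open Scope ereal_scope.

Lemma ge0_integral_mrestr (mu : {measure set T -> \bar R}) (D : set T)
    (mD : measurable D) (f : T -> \bar R) :
  measurable_fun setT f -> (forall x, 0 <= f x) ->
  \int[mrestr mu mD]_x f x = \int[mu]_(x in D) f x.
Proof.
move=> mf f0; have mDC : measurable (~` D) by exact: measurableC.
rewrite -(setUv D) ge0_integral_setU//; last 2 first.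
- exact: measurable_funTS.
- by apply/eqP; rewrite setICr.
rewrite [X in _ + X]null_set_integral ?adde0//; last 2 first.
- exact: measurable_funTS.
- by rewrite /= /mrestr setICl measure0.
apply: eq_measure_integral => A mA AD.
by rewrite /= /mrestr; congr (mu _); apply/setIidPl.
Qed.

End integral_mrestr.

Section closed_cuboid.
Context {R : realType} {n : nat}.
Implicit Types a : 'rV[R]_n.

(** The closed cuboid: compact, and it contains the faces, so one bound for a continuous function
    serves the interior and the boundary integrals alike. *)
Definition ccuboid a : set 'rV[R]_n :=
  [set x | forall i, x ord0 i \in `[- a ord0 i, a ord0 i]].

Lemma cuboid_ccuboid a : cuboid a `<=` ccuboid a.
Proof.
by move=> x ax i; rewrite in_itv/=; have /andP[? ?] := ax i; rewrite !ltW.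
Qed.

Lemma continuous_bounded a (f : 'rV[R]_n -> R) : continuous f ->
  exists M, forall x, ccuboid a x -> `|f x| <= M.
Proof.
move=> cf; have cK : compact (ccuboid a).
  apply: (@rV_compact _ _ (fun i => `[- a ord0 i, a ord0 i]%classic)) => i.
  exact: segment_compact.
have := compact_bounded (continuous_compact (continuous_subspaceT cf) cK).
move=> [M [_ /(_ (M + 1))]] H; exists (M + 1) => x Kx.
by apply: H; [rewrite ltrDl|exists x].
Qed.

Lemma continuous_bmeas a (f : 'rV[R]_n -> R) : continuous f ->
  bmeas (cuboid a) f.
Proof.
move=> cf; split; first by apply: measurable_funTS; exact: continuous_measurable_rV.
have [M fM] := continuous_bounded a cf; exists M => x /cuboid_ccuboid; exact: fM.
Qed.

End closed_cuboid.

Section surface_integral.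
Context {R : realType} {n : nat}.
Variable a : 'rV[R]_n.+1.
Hypothesis a0 : forall i, 0 < a ord0 i.
Notation lam := (lebesgue_rV R).

Definition face (i : 'I_n.+1) (s : bool) (y : 'rV[R]_n) : 'rV[R]_n.+1 :=
  insert_coord i ((-1) ^+ s * a ord0 i) y.

Lemma measurable_face i s : measurable_fun setT (face i s).
Proof. exact: (@measurable_insert_coordr R n.+1). Qed.

Lemma ccuboid_insert_coord (i : 'I_n.+1) c (y : 'rV[R]_n) :
  c \in `[- a ord0 i, a ord0 i] -> ccuboid (col' i a) y ->
  ccuboid a (insert_coord i c y).
Proof.
move=> ci yK j; case: (unliftP i j) => [k ->|->]; last by rewrite insert_coord_at.
by rewrite insert_coord_lift; have := yK k; rewrite mxE.
Qed.

Lemma ccuboid_face i s (y : 'rV[R]_n) :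
  ccuboid (col' i a) y -> ccuboid a (face i s y).
Proof.
apply: ccuboid_insert_coord; rewrite in_itv/=; have := a0 i.
by case: s; rewrite ?(expr1, expr0, mulN1r, mul1r); lra.
Qed.

Let face_measure (p : 'I_n.+1 * bool) : {measure set 'rV[R]_n.+1 -> \bar R} :=
  measure_function_pushforward__canonical__measure_function_Measure
    (mrestr (lam n) (measurable_cuboid (col' p.1 a))) (measurable_face p.1 p.2).

Lemma ge0_integral_surface (f : 'rV[R]_n.+1 -> \bar R) :
  measurable_fun setT f -> (forall x, 0 <= f x)%E ->
  (\int[surface_measure a]_x f x =
   \sum_(i < n.+1) \sum_(s : bool)
     \int[lam n]_(y in cuboid (col' i a)) f (face i s y))%E.
Proof.
move=> mf f0.
rewrite (@ge0_integral_fin_measure_sum _ _ _ _ (index_enum _) face_measure)//.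
  rewrite pair_bigA/=; apply: eq_bigr => -[i s] _ /=.
  rewrite /face_measure/= ge0_integral_pushforward//; last exact: measurable_face.
  rewrite ge0_integral_mrestr//; last by move=> y; exact: f0.
  by apply: measurableT_comp => //; exact: measurable_face.
move=> A mA; rewrite /= /surface_measure pair_bigA/=.
by apply: eq_bigr => -[i s] _; rewrite /pushforward /mrestr /= setIC.
Qed.

Let bface i s (F : 'rV[R]_n.+1 -> R) : measurable_fun setT F ->
  (exists M, forall x, ccuboid a x -> `|F x| <= M) ->
  bmeas (cuboid (col' i a)) (fun y => F (face i s y)).
Proof.
move=> mF [M FM]; split.
  apply: measurable_funTS; apply: measurableT_comp => //; exact: measurable_face.
by exists M => y yK; apply/FM/ccuboid_face/cuboid_ccuboid.
Qed.

Lemma bmeas_face i s (F : 'rV[R]_n.+1 -> R) : continuous F ->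
  bmeas (cuboid (col' i a)) (fun y => F (face i s y)).
Proof.
move=> cF; apply: bface; first exact: continuous_measurable_rV.
exact: continuous_bounded.
Qed.

Lemma EFin_integral_surface (F : 'rV[R]_n.+1 -> R) :
  measurable_fun setT F -> (forall x, 0 <= F x) ->
  (exists M, forall x, ccuboid a x -> `|F x| <= M) ->
  (\int[surface_measure a]_x (F x)%:E =
   (\sum_(i < n.+1) \sum_(s : bool)
     \int[lam n]_(y in cuboid (col' i a)) F (face i s y))%:E)%E.
Proof.
move=> mF F0 bF; rewrite ge0_integral_surface//; last exact/measurable_EFinP.
rewrite -sumEFin; apply: eq_bigr => i _; rewrite -sumEFin; apply: eq_bigr => s _.
rewrite EFin_Rint//.
- exact: measurable_cuboid.
- by apply: cuboid_fin => j; rewrite mxE.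
- exact: bface.
Qed.

Lemma integral_surface (F : 'rV[R]_n.+1 -> R) :
  measurable_fun setT F ->
  (exists M, forall x, ccuboid a x -> `|F x| <= M) ->
  \int[surface_measure a]_x F x =
  \sum_(i < n.+1) \sum_(s : bool)
     \int[lam n]_(y in cuboid (col' i a)) F (face i s y).
Proof.
move=> mF [M FM]; rewrite /Rintegral integralE.
have mFp : measurable_fun setT (F^\+)%R by exact: measurable_funrpos.
have mFn : measurable_fun setT (F^\-)%R by exact: measurable_funrneg.
have bp : exists M, forall x, ccuboid a x -> `|(F^\+)%R x| <= M.
  exists M => x /FM; apply: le_trans; rewrite /funrpos ger0_norm ?le_max ?lexx ?orbT//.
  by rewrite ge_max ler_norm normr_ge0.
have bn : exists M, forall x, ccuboid a x -> `|(F^\-)%R x| <= M.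
  exists M => x /FM; apply: le_trans; rewrite /funrneg ger0_norm ?le_max ?lexx ?orbT//.
  by rewrite ge_max -normrN ler_norm normr_ge0.
rewrite funerpos funerneg /=.
rewrite (EFin_integral_surface mFp)// (EFin_integral_surface mFn)//.
rewrite -EFinB/= -sumrB; apply: eq_bigr => i _; rewrite -sumrB; apply: eq_bigr => s _.
rewrite -RintB.
- by apply: eq_Rintegral => y _; rewrite -[in RHS](funrposBneg F).
- exact: measurable_cuboid.
- by apply: cuboid_fin => j; rewrite mxE.
- exact: bface.
- exact: bface.
Qed.

Lemma surface_measureT : surface_measure a setT =
  (2 * \sum_(i < n.+1) \prod_(j < n) (2 * a ord0 (lift i j)))%:E.
Proof.
rewrite -[LHS]mul1e -integral_cst//.
rewrite (EFin_integral_surface (F := cst 1))//; last first.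
  by exists 1 => x _; rewrite normr1.
congr EFin; rewrite mulr_sumr; apply: eq_bigr => i _.
rewrite big_bool/= Rintegral_cst; last exact: measurable_cuboid.
transitivity (2 * fine (\prod_(j < n) (2 * col' i a ord0 j))%:E).
  rewrite -lebesgue_cuboid; last by move=> j; rewrite mxE.
  by rewrite !mul1r mulr2n mulrDl !mul1r.
by rewrite /=; congr (_ * _); apply: eq_bigr => j _; rewrite mxE.
Qed.

End surface_integral.

(** * One-dimensional Robin forms *)

Section segment_calculus.
Context {R : realType}.
Implicit Types (f g F G : R -> R) (p q : R).
Notation leb := (@lebesgue_measure R).

(** Two-sided continuity at every point, ends included. It is stronger than continuity within the
    segment, but it passes through sums and products as plain limits and follows directly from
    differentiability. *)
Definition cont_seg p q f := forall x, x \in `[p, q] -> {for x, continuous f}.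

Lemma cont_seg_within p q f :
  cont_seg p q f -> {within `[p, q], continuous f}.
Proof.
by move=> cf; apply/subspace_continuousP => x px; apply: cvg_within_filter; exact: cf.
Qed.

Lemma cont_segT p q f : continuous f -> cont_seg p q f.
Proof. by move=> cf x _; exact: cf. Qed.

Lemma cont_seg_cst p q c : cont_seg p q (fun=> c).
Proof. by apply: cont_segT => x; exact: cvg_cst. Qed.

Lemma cont_segB p q f g : cont_seg p q f -> cont_seg p q g ->
  cont_seg p q (fun x => f x - g x).
Proof. by move=> cf cg x px; apply: cvgB; [exact: cf|exact: cg]. Qed.

Lemma cont_segD p q f g : cont_seg p q f -> cont_seg p q g ->
  cont_seg p q (fun x => f x + g x).
Proof. by move=> cf cg x px; apply: cvgD; [exact: cf|exact: cg]. Qed.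

Lemma cont_segM p q f g : cont_seg p q f -> cont_seg p q g ->
  cont_seg p q (fun x => f x * g x).
Proof. by move=> cf cg x px; apply: cvgM; [exact: cf|exact: cg]. Qed.

Lemma cont_segX2 p q f : cont_seg p q f -> cont_seg p q (fun x => f x ^+ 2).
Proof. by move=> cf; under eq_fun do rewrite expr2; exact: cont_segM. Qed.

Lemma derive_cont_seg p q F f :
  (forall x, x \in `[p, q] -> is_derive x 1 F (f x)) -> cont_seg p q F.
Proof.
move=> dF x px; apply: differentiable_continuous; apply/derivable1_diffP.
by have [] := dF x px.
Qed.

Lemma cont_seg_bmeas p q f : cont_seg p q f ->
  bmeas (`[p, q]%classic : set (measurableTypeR R)) f.
Proof.
move=> cf; have wf := cont_seg_within cf; split.
  exact: subspace_continuous_measurable_fun.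
have := compact_bounded (continuous_compact wf (segment_compact (a:=p) (b:=q))).
move=> [M [_ /(_ (M + 1))]] H; exists (M + 1) => x Kx.
by apply: H; [rewrite ltrDl|exists x].
Qed.

Lemma leb_seg_fin p q : (leb `[p, q]%classic < +oo)%E.
Proof. by rewrite lebesgue_measure_itv /=; case: ifPn => _; rewrite ltry. Qed.

Lemma Rint_open p q f : cont_seg p q f ->
  \int[leb]_(x in `]p, q[) f x = \int[leb]_(x in `[p, q]) f x.
Proof.
move=> cf; have int : leb.-integrable `[p, q] (EFin \o f).
  apply: bmeas_integrable; [exact: measurable_itv|exact: leb_seg_fin|].
  exact: cont_seg_bmeas.
rewrite Rintegral_itv_obnd_cbnd ?Rintegral_itv_bndo_bndc//;
  apply: integrableS int => //.
  exact: subset_itv_co_cc.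
exact: subset_itv_oo_cc.
Qed.

Lemma FTC_seg p q F f : p < q ->
  (forall x, x \in `[p, q] -> is_derive x 1 F (f x)) -> cont_seg p q f ->
  \int[leb]_(x in `[p, q]) f x = F q - F p.
Proof.
move=> pq dF cf; have cF := derive_cont_seg dF.
have pin : p \in `[p, q] by rewrite in_itv/= lexx ltW.
have qin : q \in `[p, q] by rewrite in_itv/= lexx ltW.
rewrite /Rintegral (continuous_FTC2 pq (F := F))//.
- exact: cont_seg_within.
- split.
  + by move=> x /subset_itv_oo_cc xpq; have [] := dF _ xpq.
  + exact: cvg_at_right_filter (cF _ pin).
  + exact: cvg_at_left_filter (cF _ qin).
- move=> x /subset_itv_oo_cc xpq; rewrite derive1E; have [_ ->//] := dF _ xpq.
Qed.

Lemma Rint_segD p q f g : cont_seg p q f -> cont_seg p q g ->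
  \int[leb]_(x in `[p, q]) (f x + g x) =
  \int[leb]_(x in `[p, q]) f x + \int[leb]_(x in `[p, q]) g x.
Proof.
by move=> cf cg; rewrite RintD//; [exact: leb_seg_fin|
  exact: cont_seg_bmeas|exact: cont_seg_bmeas].
Qed.

Lemma Rint_segZ p q c f : cont_seg p q f ->
  \int[leb]_(x in `[p, q]) (c * f x) = c * \int[leb]_(x in `[p, q]) f x.
Proof.
by move=> cf; rewrite RintZ//; [exact: leb_seg_fin|
  exact: cont_seg_bmeas].
Qed.

Lemma le_Rint_seg p q f g : cont_seg p q f -> cont_seg p q g ->
  (forall x, x \in `[p, q] -> f x <= g x) ->
  \int[leb]_(x in `[p, q]) f x <= \int[leb]_(x in `[p, q]) g x.
Proof.
by move=> cf cg fg; apply: le_Rint => //; [exact: leb_seg_fin|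
  exact: cont_seg_bmeas|exact: cont_seg_bmeas].
Qed.

Lemma Rint_seg_split p q r f : p <= q -> q <= r -> cont_seg p r f ->
  \int[leb]_(x in `[p, r]) f x =
  \int[leb]_(x in `[p, q]) f x + \int[leb]_(x in `[q, r]) f x.
Proof.
move=> pq qr cf.
have int : leb.-integrable `[p, r] (EFin \o f).
  apply: bmeas_integrable; [exact: measurable_itv|exact: leb_seg_fin|].
  exact: cont_seg_bmeas.
have /(_ q) := Rintegral_itvB int; rewrite !bnd_simp => /(_ pq qr).
rewrite Rintegral_itv_obnd_cbnd; first by move=> <-; rewrite addrC subrK.
apply: integrableS int => //; apply: subset_itv; rewrite ?bnd_simp//.
Qed.

(* Completing the square: (f' - f G)^2 >= 0 bounds f'^2 below by
   (f^2 G)' - (G' + G^2) f^2. *)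
Lemma riccati p q (f f' G G' : R -> R) (k : R) : p < q ->
  (forall x : R, is_derive x 1 f (f' x)) -> continuous f' ->
  (forall x, x \in `[p, q] -> is_derive x 1 G (G' x)) -> cont_seg p q G' ->
  (forall x, x \in `[p, q] -> G' x + G x ^+ 2 <= k) ->
  f q ^+ 2 * G q - f p ^+ 2 * G p <=
  \int[leb]_(x in `[p, q]) (f' x ^+ 2) + k * \int[leb]_(x in `[p, q]) (f x ^+ 2).
Proof.
move=> pq df cf' dG cG' Gk.
have cf : cont_seg p q f by apply: derive_cont_seg => x _; exact: df.
have cG := derive_cont_seg dG.
have c' := cont_segT cf' (p := p) (q := q).
pose h x := (2 * f x * f' x) * G x + f x ^+ 2 * G' x.
have ch : cont_seg p q h.
  apply: cont_segD; apply: cont_segM => //; last exact: cont_segX2.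
  apply: cont_segM => //; apply: cont_segM => //.
  exact: cont_seg_cst.
have <- : \int[leb]_(x in `[p, q]) h x = f q ^+ 2 * G q - f p ^+ 2 * G p.
  apply: (FTC_seg (F := fun x => f x ^+ 2 * G x)) => // x px.
  have := df x; have := dG x px => ? ?.
  by apply: is_derive_eq; rewrite /h /GRing.scale/=; ring.
rewrite -Rint_segZ; last exact: cont_segX2.
rewrite -Rint_segD; [|exact: cont_segX2|].
  apply: le_Rint_seg => //.
    apply: cont_segD; first exact: cont_segX2.
    apply: cont_segM; last exact: cont_segX2.
    exact: cont_seg_cst.
  move=> x px; have := Gk x px; rewrite /h.
  have := sqr_ge0 (f' x - f x * G x); have := sqr_ge0 (f x).
  by nra.
apply: cont_segM; last exact: cont_segX2.
exact: cont_seg_cst.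
Qed.

End segment_calculus.

Section hyperbolic.
Context {R : realType}.
Implicit Types x y : R.

Definition coshR x : R := (expR x + expR (- x)) / 2.
Definition sinhR x : R := (expR x - expR (- x)) / 2.

Lemma coshRN x : coshR (- x) = coshR x.
Proof. by rewrite /coshR opprK addrC. Qed.

Lemma sinhRN x : sinhR (- x) = - sinhR x.
Proof. by rewrite /sinhR opprK -mulNr opprB. Qed.

Lemma coshR0 : coshR 0 = 1.
Proof. by rewrite /coshR oppr0 expR0; field. Qed.

Lemma sinhR0 : sinhR 0 = 0.
Proof. by rewrite /sinhR oppr0 subrr mul0r. Qed.

Lemma coshR_gt0 x : 0 < coshR x.
Proof. by rewrite /coshR divr_gt0// addr_gt0 ?expR_gt0. Qed.

Lemma cosh2Bsinh2 x : coshR x ^+ 2 - sinhR x ^+ 2 = 1.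
Proof.
rewrite /coshR /sinhR expRN; have := lt0r_neq0 (expR_gt0 x).
by move=> ex; field.
Qed.

Global Instance is_derive_coshR x : is_derive x 1 coshR (sinhR x).
Proof.
rewrite /coshR /sinhR.
have H : is_derive x 1 (fun y : R => expR (- y)) (- expR (- x)).
  have := @is_derive1_comp R expR -%R x _ _ (is_derive_expR (- x)) (is_deriveNid x 1).
  by rewrite mulrN1.
by apply: is_derive_eq; rewrite /GRing.scale/=; ring.
Qed.

Global Instance is_derive_sinhR x : is_derive x 1 sinhR (coshR x).
Proof.
rewrite /coshR /sinhR.
have H : is_derive x 1 (fun y : R => expR (- y)) (- expR (- x)).
  have := @is_derive1_comp R expR -%R x _ _ (is_derive_expR (- x)) (is_deriveNid x 1).
  by rewrite mulrN1.
by apply: is_derive_eq; rewrite /GRing.scale/=; ring.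
Qed.

Lemma is_derive_lin (k x : R) : is_derive x 1 (fun y : R => k * y) k.
Proof. by apply: is_derive_eq; rewrite /GRing.scale/=; ring. Qed.

Lemma is_derive_comp_lin (f : R -> R) (k x l : R) : is_derive (k * x) 1 f l ->
  is_derive x 1 (fun y => f (k * y)) (k * l).
Proof.
move=> df; have := @is_derive1_comp R f (fun y => k * y) x _ _ df (is_derive_lin k x).
by rewrite mulrC.
Qed.

Lemma continuous_derive (f f' : R -> R) :
  (forall x : R, is_derive x 1 f (f' x)) -> continuous f.
Proof.
move=> df x; apply: differentiable_continuous; apply/derivable1_diffP.
by have [] := df x.
Qed.

Lemma continuous_coshR : continuous coshR.
Proof. exact: continuous_derive is_derive_coshR. Qed.

Lemma continuous_sinhR : continuous sinhR.
Proof. exact: continuous_derive is_derive_sinhR. Qed.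

Lemma sinhR_gt0 x : 0 < x -> 0 < sinhR x.
Proof. by move=> x0; rewrite /sinhR divr_gt0// subr_gt0 ltr_expR; lra. Qed.

Lemma sinhR_lt_coshR x : sinhR x < coshR x.
Proof. by rewrite /sinhR /coshR ltr_pM2r//; have := expR_gt0 (- x); lra. Qed.

End hyperbolic.

Section robin_interval.
Context {R : realType}.
Notation leb := (@lebesgue_measure R).
Variables (b al sg : R).
Hypotheses (b0 : 0 < b) (al0 : 0 < al) (alb : al * b < pi).
Hypothesis sg_lt : sg * sin (al * b) < al * cos (al * b).

(** Both strict hypotheses on [b] are open conditions, so they survive a small enlargement of the
    half-length, up to making the second one non-strict. The enlargement is what moves the pole of
    the comparison function off the interval. *)
Let shift : exists e : R, [/\ 0 < e, al * (b + e) < pi &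
  sg * sin (al * (b + e)) <= al * cos (al * (b + e))].
Proof.
pose g (z : R) := al * cos (al * (b + z)) - sg * sin (al * (b + z)).
have cl : continuous (fun z : R => al * (b + z)).
  move=> z; apply: cvgM; first exact: cvg_cst.
  by apply: cvgD; [exact: cvg_cst|exact: cvg_id].
have cg : continuous g.
  move=> z; apply: cvgB; apply: cvgM; try exact: cvg_cst.
  - by apply: (continuous_comp (cl z)); exact: continuous_cos.
  - by apply: (continuous_comp (cl z)); exact: continuous_sin.
have H1 : \forall z \near 0^'+, al * (b + z) < pi.
  have : (fun z : R => al * (b + z)) z @[z --> 0^'+] --> al * (b + 0).
    exact: cvg_at_right_filter (cl 0).
  by move/cvgr_lt; apply; rewrite addr0.
have H2 : \forall z \near 0^'+, 0 < g z.
  have : g z @[z --> 0^'+] --> g 0 by exact: cvg_at_right_filter (cg 0).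
  by move/cvgr_gt; apply; rewrite /g addr0 subr_gt0.
have H3 : \forall z \near (0 : R)^'+, 0 < z by exact: nbhs_right_gt.
have [z [h1 [h2 h3]]] := filter_ex (filterI H1 (filterI H2 H3)).
by exists z; split => //; move: h2; rewrite /g subr_gt0 => /ltW.
Qed.

Variables (h h' : R -> R).
Hypotheses (dh : forall x : R, is_derive x 1 h (h' x)) (ch' : continuous h').

Let ch : continuous h. Proof. exact: continuous_derive dh. Qed.

(* On each half of the interval the comparison function is
   al cot(al (x +- e)), whose pole lies just outside of it. *)
Lemma robin_vanishing : h 0 = 0 ->
  sg * (h b ^+ 2 + h (- b) ^+ 2) + al ^+ 2 * \int[leb]_(x in `[- b, b]) (h x ^+ 2) <=
  \int[leb]_(x in `[- b, b]) (h' x ^+ 2).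
Proof.
move=> h00; have [e [e0 abe sge]] := shift.
have half (t : R) (p q : R) : p < q ->
    (forall x, x \in `[p, q] -> sin (al * (x + t)) != 0) ->
    h q ^+ 2 * (al * cos (al * (q + t)) / sin (al * (q + t))) -
    h p ^+ 2 * (al * cos (al * (p + t)) / sin (al * (p + t))) <=
    \int[leb]_(x in `[p, q]) (h' x ^+ 2) - al ^+ 2 * \int[leb]_(x in `[p, q]) (h x ^+ 2).
  move=> pq s0.
  have dl (x : R) : is_derive x 1 (fun z => al * (z + t)) al.
    by apply: is_derive_eq; rewrite /GRing.scale/=; ring.
  have dc (x : R) : is_derive x 1 (fun z => cos (al * (z + t))) (- al * sin (al * (x + t))).
    have := @is_derive1_comp R cos _ x _ _ (is_derive_cos _) (dl x).
    by move/is_derive_eq; apply; ring.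
  have ds (x : R) : is_derive x 1 (fun z => sin (al * (z + t))) (al * cos (al * (x + t))).
    have := @is_derive1_comp R sin _ x _ _ (is_derive_sin _) (dl x).
    by move/is_derive_eq; apply; ring.
  (* This [G] solves $G'+G^2=-\alpha^2$, so the Riccati bound applies with the constant
     [- al ^+ 2]. *)
  pose G z := al * cos (al * (z + t)) / sin (al * (z + t)).
  pose G' z := - al ^+ 2 - G z ^+ 2.
  have dG x : x \in `[p, q] -> is_derive x 1 G (G' x).
    move=> px; have sx := s0 x px.
    have dsV := @is_deriveV R _ x _ 1 sx (ds x).
    have := dc x => ?.
    apply: is_derive_eq; rewrite /G' /G /GRing.scale /=.
    have := cos2Dsin2 (al * (x + t)) => /eqP; rewrite -subr_eq0 => /eqP cs.
    apply/eqP; rewrite -subr_eq0; apply/eqP; field.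
    exact: sx.
  have := @riccati R p q h h' G G' (- al ^+ 2) pq dh ch' dG.
  rewrite mulNr; apply.
  + rewrite /G'; have cG := derive_cont_seg dG.
    apply: (@cont_segB R p q (cst (- al ^+ 2)) (fun x => G x ^+ 2)).
      exact: cont_seg_cst.
    exact: cont_segX2.
  + by move=> x px; rewrite /G' subrK.
have nb : - b < 0 by rewrite oppr_lt0.
have s1 : 0 < sin (al * (b + e)).
  by apply: sin_gt0_pi; rewrite abe andbT mulr_gt0// addr_gt0.
(* The pole sits at [- e] for the right half and at [e] for the left one; the boundary terms at 0
   disappear because [h 0 = 0]. *)
have r := half e 0 b b0; have l := half (- e) (- b) 0 nb.
have {r} : h b ^+ 2 * (al * cos (al * (b + e)) / sin (al * (b + e))) <=
   \int[leb]_(x in `[0, b]) (h' x ^+ 2) - al ^+ 2 * \int[leb]_(x in `[0, b]) (h x ^+ 2).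
  rewrite h00 expr0n/= mul0r subr0 in r; apply: r => x; rewrite in_itv/= => /andP[x0 xb].
  apply/lt0r_neq0/sin_gt0_pi; rewrite mulr_gt0//=; last by rewrite ltr_wpDl.
  by rewrite (le_lt_trans _ abe)// ler_pM2l// lerD2r.
have {l} : h (- b) ^+ 2 * (al * cos (al * (b + e)) / sin (al * (b + e))) <=
   \int[leb]_(x in `[- b, 0]) (h' x ^+ 2) - al ^+ 2 * \int[leb]_(x in `[- b, 0]) (h x ^+ 2).
  rewrite h00 expr0n/= mul0r sub0r -opprD mulrN cosN sinN invrN !mulrN opprK in l.
  apply: l => x; rewrite in_itv/= => /andP[xb x0].
  rewrite -[x]opprK -opprD mulrN sinN oppr_eq0.
  apply/lt0r_neq0/sin_gt0_pi; rewrite mulr_gt0//=; last by rewrite ltr_wpDl ?oppr_ge0.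
  by rewrite (le_lt_trans _ abe)// ler_pM2l// lerD2r lerNl.
have cot : sg <= al * cos (al * (b + e)) / sin (al * (b + e)).
  by rewrite ler_pdivlMr.
have c2 p q (g : R -> R) : continuous g -> cont_seg p q (fun x => g x ^+ 2).
  by move=> cg; apply: cont_segX2; exact: cont_segT.
rewrite !(@Rint_seg_split R (- b) 0 b) ?(ltW nb) ?(ltW b0)//; try exact: c2.
move: (_ / _) cot => C sgC.
have := ler_wpM2l (sqr_ge0 (h b)) sgC; have := ler_wpM2l (sqr_ge0 (h (- b))) sgC.
lra.
Qed.

End robin_interval.

Section robin_gap.
Context {R : realType}.
Notation leb := (@lebesgue_measure R).
Variables (b al be : R).
Hypotheses (b0 : 0 < b) (al0 : 0 < al) (alb : al * b < pi) (be0 : 0 < be).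
Let phi (x : R) := coshR (be * x).
Let phi' (x : R) := be * sinhR (be * x).
Let sg := be * sinhR (be * b) / coshR (be * b).
Hypothesis sg_lt : sg * sin (al * b) < al * cos (al * b).
Variables (f f' : R -> R).
Hypotheses (df : forall x : R, is_derive x 1 f (f' x)) (cf' : continuous f').

Let cf : continuous f. Proof. exact: continuous_derive df. Qed.

Let dphi (x : R) : is_derive x 1 phi (phi' x).
Proof. exact: is_derive_comp_lin. Qed.

Let dphi' (x : R) : is_derive x 1 phi' (be ^+ 2 * phi x).
Proof.
have := is_derive_comp_lin (is_derive_sinhR (be * x)) => ?.
by apply: is_derive_eq; rewrite /GRing.scale/= /phi; ring.
Qed.

Let cphi : continuous phi. Proof. exact: continuous_derive dphi. Qed.
Let cphi' : continuous phi'. Proof. exact: continuous_derive dphi'. Qed.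

(** Pairing with the ground state: $\phi''=\beta^2\phi$ inside, and the outward derivative of $\phi$
    equals [sg] times $\phi$ at both ends, so $\phi$ is an eigenvector of the Robin form with
    eigenvalue $-\beta^2$. *)
Let parts (g g' : R -> R) : (forall x : R, is_derive x 1 g (g' x)) ->
    continuous g' ->
  \int[leb]_(x in `[- b, b]) (g' x * phi' x) =
  sg * phi b * (g b + g (- b)) - be ^+ 2 * \int[leb]_(x in `[- b, b]) (g x * phi x).
Proof.
move=> dg cg'; have cg : continuous g by exact: continuous_derive dg.
have cM (u v : R -> R) : continuous u -> continuous v ->
    cont_seg (- b) b (fun x => u x * v x).
  by move=> cu cv; apply: cont_segM; exact: cont_segT.
have : \int[leb]_(x in `[- b, b]) (g' x * phi' x + be ^+ 2 * (g x * phi x)) =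
    g b * phi' b - g (- b) * phi' (- b).
  have bb : - b < b by move: b0; lra.
  apply: (FTC_seg (F := fun x => g x * phi' x) bb).
    move=> x _; have := dg x; have := dphi' x => ? ?.
    by apply: is_derive_eq; rewrite /GRing.scale/=; ring.
  apply: cont_segD; first exact: cM.
  by apply: cont_segM; [apply: cont_segT => x; exact: cvg_cst|exact: cM].
rewrite Rint_segD; [|exact: cM|]; last first.
  by apply: cont_segM; [apply: cont_segT => x; exact: cvg_cst|exact: cM].
rewrite Rint_segZ; last exact: cM.
have -> : phi' (- b) = - phi' b by rewrite /phi' mulrN sinhRN mulrN.
have -> : sg * phi b = phi' b.
  by rewrite /sg /phi /phi' divfK// lt0r_neq0// coshR_gt0.
by move/(canRL (addrK _)) => ->; ring.
Qed.

(** The left side is the form equal to $\alpha^2$ off the ground state and to $-\beta^2$ on it. With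
    $A=\langle f,\phi\rangle$, $N=\|\phi\|^2$ and $k=f(0)$, expanding the estimate for $f-k\phi$
    gives the claim with the surplus $(\alpha^2+\beta^2)(kN-A)^2/N\ge0$, so no orthogonality has to
    be arranged beforehand. *)
Lemma robin_gap :
  al ^+ 2 * \int[leb]_(x in `[- b, b]) (f x ^+ 2) -
  (al ^+ 2 + be ^+ 2) * (\int[leb]_(x in `[- b, b]) (f x * phi x)) ^+ 2 /
    \int[leb]_(x in `[- b, b]) (phi x ^+ 2) <=
  \int[leb]_(x in `[- b, b]) (f' x ^+ 2) - sg * (f b ^+ 2 + f (- b) ^+ 2).
Proof.
set F := \int[leb]_(x in _) (f x ^+ 2); set A := \int[leb]_(x in _) (f x * phi x).
set N := \int[leb]_(x in _) (phi x ^+ 2); set F' := \int[leb]_(x in _) (f' x ^+ 2).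
have cM (u v : R -> R) : continuous u -> continuous v ->
    cont_seg (- b) b (fun x => u x * v x).
  by move=> cu cv; apply: cont_segM; exact: cont_segT.
have c2 (u : R -> R) : continuous u -> cont_seg (- b) b (fun x => u x ^+ 2).
  by move=> cu; apply: cont_segX2; exact: cont_segT.
have cZ c (u : R -> R) : cont_seg (- b) b u -> cont_seg (- b) b (fun x => c * u x).
  by move=> cu; apply: cont_segM => //; apply: cont_segT => x; exact: cvg_cst.
have N0 : 0 < N.
  have : \int[leb]_(x in `[- b, b]) (cst 1 x) <= N.
    apply: le_Rint_seg.
    - by apply: cont_segT => x; exact: cvg_cst.
    - exact: c2.
    - move=> x _ /=; rewrite -(cosh2Bsinh2 (be * x)) /phi lerBlDr lerDl; exact: sqr_ge0.
  have L : leb `[- b, b]%classic = (2 * b)%:E.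
    rewrite lebesgue_measure_itv/= lte_fin ifT; last by move: b0; lra.
    by rewrite -EFinD; congr EFin; ring.
  apply: lt_le_trans; rewrite Rintegral_cst// mul1r.
  have -> : fine (leb `[- b, b]%classic) = 2 * b by rewrite L.
  by rewrite mulr_gt0.
pose k := f 0; pose h x := f x - k * phi x; pose h' x := f' x - k * phi' x.
have dh (x : R) : is_derive x 1 h (h' x).
  have := df x; have := dphi x => ? ?.
  by apply: is_derive_eq; rewrite /GRing.scale/= /h'.
have ch' : continuous h'.
  move=> x; apply: cvgB; first exact: cf'.
  by apply: cvgM; [exact: cvg_cst|exact: cphi'].
have h00 : h 0 = 0 by rewrite /h /k /phi mulr0 coshR0 mulr1 subrr.
have := robin_vanishing b0 al0 alb sg_lt dh ch' h00.
have sq (u v : R -> R) : continuous u -> continuous v ->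
    \int[leb]_(x in `[- b, b]) ((u x - k * v x) ^+ 2) =
    \int[leb]_(x in `[- b, b]) (u x ^+ 2)
    + (- (2 * k)) * \int[leb]_(x in `[- b, b]) (u x * v x)
    + k ^+ 2 * \int[leb]_(x in `[- b, b]) (v x ^+ 2).
  move=> cu cv; rewrite -!Rint_segZ; [|exact: c2|exact: cM].
  rewrite -!Rint_segD; [|apply: cont_segD|exact: cZ (c2 _ _)|exact: c2|exact: cZ (cM _ _ _ _)].
  - by apply: eq_Rintegral => x _; ring.
  - exact: c2.
  - exact: cZ (cM _ _ _ _).
rewrite /h /h' !sq// -/F -/F' -/A -/N.
have -> : \int[leb]_(x in `[- b, b]) (phi' x ^+ 2) = 2 * sg * phi b ^+ 2 - be ^+ 2 * N.
  rewrite (_ : \int[leb]_(x in _) _ = \int[leb]_(x in `[- b, b]) (phi' x * phi' x)); last first.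
    by apply: eq_Rintegral => x _; rewrite expr2.
  rewrite (parts dphi)// (_ : phi (- b) = phi b); last by rewrite /phi mulrN coshRN.
  rewrite (_ : \int[leb]_(x in _) (phi x * _) = N); first by ring.
  by apply: eq_Rintegral => x _; rewrite expr2.
rewrite (parts df)// -/A (_ : phi (- b) = phi b); last by rewrite /phi mulrN coshRN.
move=> H; rewrite -subr_ge0.
have E : (k * N - A) ^+ 2 / N = k ^+ 2 * N - 2 * k * A + A ^+ 2 / N.
  by field; exact: lt0r_neq0.
have : 0 <= (al ^+ 2 + be ^+ 2) * ((k * N - A) ^+ 2 / N).
  by rewrite mulr_ge0 ?addr_ge0 ?divr_ge0 ?sqr_ge0// ltW.
rewrite E -[(al ^+ 2 + be ^+ 2) * A ^+ 2 / N]mulrA; move: (A ^+ 2 / N) => AN H2.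
by rewrite -subr_ge0 in H; apply: le_trans (addr_ge0 H H2) _;
  rewrite le_eqVlt; apply/orP; left; apply/eqP; ring.
Qed.

End robin_gap.

(** * Commuting fibre projections *)

Section Rint_swap.
Context d1 d2 (T1 : measurableType d1) (T2 : measurableType d2) (R : realType).
Variables (m1 : {sigma_finite_measure set T1 -> \bar R})
  (m2 : {sigma_finite_measure set T2 -> \bar R}) (D1 : set T1) (D2 : set T2).
Hypotheses (mD1 : measurable D1) (mD2 : measurable D2).
Hypotheses (fD1 : (m1 D1 < +oo)%E) (fD2 : (m2 D2 < +oo)%E).

Lemma Rint_swap (H : T1 * T2 -> R) (M : R) : measurable_fun setT H ->
  (forall x y, D1 x -> D2 y -> `|H (x, y)| <= M) ->
  \int[m1]_(x in D1) \int[m2]_(y in D2) H (x, y) =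
  \int[m2]_(y in D2) \int[m1]_(x in D1) H (x, y).
Proof.
move=> mH HM.
pose f := (fun p => (H p)%:E) \_ (D1 `*` D2).
have mf : measurable_fun setT f.
  apply/(measurable_restrictT _ (measurableX mD1 mD2)).
  by apply: measurable_funTS; exact/measurable_EFinP.
have fE x y : D1 x -> f (x, y) = ((fun y => (H (x, y))%:E) \_ D2) y.
  by move=> Dx; rewrite /f /patch; congr (if _ then _ else _);
    apply/asboolP/asboolP => [[]|].
have fE' x y : D2 y -> f (x, y) = ((fun x => (H (x, y))%:E) \_ D1) x.
  by move=> Dy; rewrite /f /patch; congr (if _ then _ else _);
    apply/asboolP/asboolP => [[]|].
have f0 x y : ~ D1 x -> f (x, y) = 0%E.
  by move=> Dx; rewrite /f /patch ifF//; apply/negbTE/asboolP => -[].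
have f0' x y : ~ D2 y -> f (x, y) = 0%E.
  by move=> Dy; rewrite /f /patch ifF//; apply/negbTE/asboolP => -[].
have intf : (m1 \x m2)%E.-integrable setT f.
  apply/(integrable_mkcond _ (measurableX mD1 mD2)).
  apply: (@bmeas_integrable _ _ _ (m1 \x m2)%E _ _ _ H).
  - exact: measurableX.
  - by rewrite /= product_measure1E// lte_mul_pinfty// ge0_fin_numE.
  - split; first exact: measurable_funTS.
    by exists M => -[x y] [Dx Dy]; exact: HM.
have sec1 x : D1 x -> measurable_fun D2 (fun y => H (x, y)).
  move=> _; apply: measurable_funTS; apply: measurableT_comp => //.
have sec2 y : D2 y -> measurable_fun D1 (fun x => H (x, y)).
  move=> _; apply: measurable_funTS; apply: measurableT_comp => //.
have Fub := Fubini intf.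
transitivity (fine (\int[m1]_x \int[m2]_y f (x, y))%E).
  rewrite /Rintegral; congr fine; rewrite [LHS]integral_mkcond.
  apply: eq_integral => x _; rewrite {1}/patch; case: ifPn => xD.
    rewrite inE in xD; rewrite -[LHS]/((_)%:E) EFin_Rint//; last first.
      by split; [exact: sec1|exists M => y Dy; exact: HM].
    by rewrite integral_mkcond; apply: eq_integral => y _; rewrite fE.
  by rewrite integral0_eq// => y _; apply: f0; rewrite -notin_setE.
rewrite Fub /Rintegral; congr fine; rewrite [RHS]integral_mkcond.
apply: eq_integral => y _; rewrite {1}/patch; case: ifPn => yD.
  rewrite inE in yD; rewrite -[RHS]/((_)%:E) EFin_Rint//; last first.
    by split; [exact: sec2|exists M => x Dx; exact: HM].
  by rewrite integral_mkcond; apply: eq_integral => x _; rewrite fE'.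
by rewrite integral0_eq// => x _; apply: f0'; rewrite -notin_setE.
Qed.

End Rint_swap.

Section projections.
Context {R : realType} {n : nat}.
Variable a : 'rV[R]_n.+1.
Hypothesis a0 : forall i, 0 < a ord0 i.
Variable phi : 'I_n.+1 -> R -> R.
Hypothesis cphi : forall i, continuous (phi i).
Implicit Types (i j : 'I_n.+1) (x : 'rV[R]_n.+1) (u v : 'rV[R]_n.+1 -> R).
Notation leb := (@lebesgue_measure R).
Notation lam := (lebesgue_rV R).
Notation K := (cuboid a).

(** Unlike [insert_coord] this stays in one space, so the fibre operators of different coordinates
    act on the same functions and can be composed. *)
Definition upd x i (c : R) : 'rV[R]_n.+1 :=
  \row_j (if j == i then c else x ord0 j).

Lemma upd_at x i c : upd x i c ord0 i = c.
Proof. by rewrite mxE eqxx. Qed.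

Lemma upd_neq x i j c : j != i -> upd x i c ord0 j = x ord0 j.
Proof. by rewrite mxE => /negPf ->. Qed.

Lemma updd x i c e : upd (upd x i c) i e = upd x i e.
Proof. by apply/rowP => j; rewrite !mxE; case: eqP. Qed.

Lemma updC x i j c e : i != j -> upd (upd x i c) j e = upd (upd x j e) i c.
Proof.
move=> ij; apply/rowP => k; rewrite !mxE.
by case: (eqVneq k i) => [->|]; case: eqVneq => // ij'; rewrite ij' eqxx in ij.
Qed.

Lemma upd_insert_coord i c e (y : 'rV[R]_n) :
  upd (insert_coord i c y) i e = insert_coord i e y.
Proof.
apply/rowP => j; rewrite [LHS]mxE; case: (unliftP i j) => [k ->|->].
  by rewrite eq_sym (negPf (neq_lift _ _)) !insert_coord_lift.
by rewrite eqxx insert_coord_at.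
Qed.

Lemma cuboid_upd x i c : K x -> side a i c -> K (upd x i c).
Proof.
rewrite /side/= in_itv/= => Kx ci j; rewrite mxE.
by case: eqP => [->|_]; [exact: ci|exact: Kx].
Qed.

Lemma measurable_upd i : measurable_fun setT
  (fun p : 'rV[R]_n.+1 * measurableTypeR R => upd p.1 i p.2).
Proof.
apply/measurable_fun_coordP => j; under eq_fun do rewrite mxE.
case: (j == i); first exact: measurable_snd.
exact: (measurableT_comp (measurable_coord j) measurable_fst).
Qed.

Let V u := measurable_fun setT u /\ bmeas K u.
Let N i := \int[leb]_(c in side a i) (phi i c ^+ 2).

(** [marg] and [avg] are the unnormalized and the normalized coefficient of [phi i] on the line
    through [x] parallel to axis [i]; [proj] is then the orthogonal projection onto the functions
    that are multiples of [phi i] on each such line. *)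
Definition marg i u x := \int[leb]_(c in side a i) (u (upd x i c) * phi i c).
Definition avg i u x := marg i u x / N i.
Definition proj i u x := phi i (x ord0 i) * avg i u x.
Definition dot u v := \int[lam n.+1]_(x in K) (u x * v x).

Let mphi i : measurable_fun setT (phi i : measurableTypeR R -> R).
Proof. exact: continuous_measurable_fun. Qed.

Let bphi i : bmeas (side a i) (phi i).
Proof.
have [mphi' [M phiM]] := cont_seg_bmeas (cont_segT (@cphi i) (p := - a ord0 i) (q := a ord0 i)).
split; first exact: measurable_funTS.
by exists M => x /subset_itv_oo_cc; exact: phiM.
Qed.

Let mside i : measurable (side a i). Proof. exact: measurable_side. Qed.
Let fside i := leb_side_fin a0 i.
Let mK := measurable_cuboid a.
Let fK := cuboid_fin a0.

Let bsec i u x : V u -> K x -> bmeas (side a i) (fun c => u (upd x i c)).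
Proof.
move=> [mu [_ [M uM]]] Kx; split.
  apply: measurable_funTS; apply: measurableT_comp => //.
  exact: (measurableT_comp (measurable_upd i) (measurable_pair1 _)).
by exists M => c ci; apply: uM; exact: cuboid_upd.
Qed.

Let measurable_marg i u : measurable_fun setT u -> measurable_fun setT (marg i u).
Proof.
move=> mu; apply: (measurable_Rint leb (mside i)
  (f := fun p : 'rV[R]_n.+1 * measurableTypeR R => u (upd p.1 i p.2) * phi i p.2)).
apply: measurable_funM.
  by apply: measurableT_comp => //; exact: measurable_upd.
exact: (measurableT_comp (mphi i) measurable_snd).
Qed.

Let V_marg i u : V u -> V (marg i u).
Proof.
move=> Vu; have mu := Vu.1; have m1 := measurable_marg i mu.
split=> //; split; first exact: measurable_funTS.
have [_ [M uM]] := Vu.2; have [_ [M' phiM]] := bphi i.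
exists (M * M' * fine (leb (side a i))) => x Kx.
apply: (norm_Rint_le (mside i) (fside i)).
  by apply: bmeasM => //; exact: bsec.
move=> c ci; rewrite normrM ler_pM//; last exact: phiM.
by apply: uM; exact: cuboid_upd.
Qed.

Let V_avg i u : V u -> V (avg i u).
Proof.
move=> /(V_marg i)[mu bu]; split; first by apply: measurable_funM.
exact: (@bmeasM _ _ _ _ _ (fun=> (N i)^-1) bu (bmeas_cst _ _)).
Qed.

Let V_coord i : V (fun x => phi i (x ord0 i)).
Proof.
have m : measurable_fun setT (fun x => phi i (x ord0 i)).
  exact: (measurableT_comp (mphi i) (measurable_coord i)).
split=> //; split; first exact: measurable_funTS.
have [_ [M phiM]] := bphi i; exists M => x Kx; apply: phiM.
by rewrite /side/= in_itv; exact: Kx.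
Qed.

Let VM u v : V u -> V v -> V (fun x => u x * v x).
Proof.
by move=> [mu bu] [mv bv]; split; [exact: measurable_funM|exact: bmeasM].
Qed.

Let VB u v : V u -> V v -> V (fun x => u x - v x).
Proof.
by move=> [mu bu] [mv bv]; split; [exact: measurable_funB|exact: bmeasB].
Qed.

Let V_proj i u : V u -> V (proj i u).
Proof. by move=> Vu; apply: VM; [exact: V_coord|exact: V_avg]. Qed.

Lemma dotC u v : dot u v = dot v u.
Proof. by apply: eq_Rintegral => x _; rewrite mulrC. Qed.

Let dotBl u v w : V u -> V v -> V w -> dot (fun x => u x - v x) w = dot u w - dot v w.
Proof.
move=> Vu Vv Vw; rewrite /dot -RintB//.
- by apply: eq_Rintegral => x _; rewrite mulrBl.
- by apply: bmeasM; [exact: Vu.2|exact: Vw.2].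
- by apply: bmeasM; [exact: Vv.2|exact: Vw.2].
Qed.

Let dotBr u v w : V u -> V v -> V w -> dot w (fun x => u x - v x) = dot w u - dot w v.
Proof. by move=> Vu Vv Vw; rewrite dotC dotBl// !(dotC w). Qed.

Lemma dot_ge0 u : 0 <= dot u u.
Proof. by apply: Rintegral_ge0 => x _; rewrite -expr2 sqr_ge0. Qed.

Let eq_dot u u' v v' : {in K, u =1 u'} -> {in K, v =1 v'} -> dot u v = dot u' v'.
Proof. by move=> uu vv; apply: eq_Rintegral => x Kx; rewrite uu ?vv. Qed.

Lemma marg_insert_coord i u c (y : 'rV[R]_n) :
  marg i u (insert_coord i c y) =
  \int[leb]_(c in side a i) (u (insert_coord i c y) * phi i c).
Proof. by apply: eq_Rintegral => e _; rewrite upd_insert_coord. Qed.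

(** Fubini along coordinate [i] makes the pairing visibly symmetric in [u] and [v], whence
    self-adjointness; it is also the form in which the one-dimensional gap is integrated over the
    fibres. *)
Lemma dot_proj i u v : measurable_fun setT u -> bmeas K u ->
  measurable_fun setT v -> bmeas K v ->
  dot (proj i u) v = \int[lam n]_(y in cuboid (col' i a))
    (\int[leb]_(c in side a i) (u (insert_coord i c y) * phi i c) *
     \int[leb]_(c in side a i) (v (insert_coord i c y) * phi i c) / N i).
Proof.
move=> mu bu mv bv; have Vu : V u by []. have Vv : V v by [].
have [mF bF] := VM (V_proj i Vu) Vv.
rewrite /dot (fubini_cuboid a0 i mF bF); apply: eq_Rintegral => y.
rewrite inE => yK; set A := (X in X * _ / _).
under eq_Rintegral do rewrite /proj /avg marg_insert_coord -/A insert_coord_at.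
rewrite (_ : \int[_]_(c in _) _ =
    \int[leb]_(c in side a i) ((A / N i) * (v (insert_coord i c y) * phi i c))); last first.
  by apply: eq_Rintegral => c _; ring.
rewrite (RintZ (mside i) (fside i)); last by apply: bmeasM => //; exact: bmeas_insert_coord.
by ring.
Qed.

Let dot_projC i u v : V u -> V v -> dot (proj i u) v = dot u (proj i v).
Proof.
move=> [mu bu] [mv bv]; rewrite (dotC u) (dot_proj i mu bu mv bv) (dot_proj i mv bv mu bu).
by apply: eq_Rintegral => y _; congr (_ / _); rewrite mulrC.
Qed.

Lemma avg_upd i u x c : avg i u (upd x i c) = avg i u x.
Proof. by congr (_ / _); apply: eq_Rintegral => e _; rewrite updd. Qed.

Hypothesis N0 : forall i, N i != 0.

Let avg_phi i u x : avg i (fun z => phi i (z ord0 i) * avg i u z) x = avg i u x.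
Proof.
rewrite {1}/avg /marg.
rewrite (_ : \int[_]_(c in _) _ =
    \int[leb]_(c in side a i) (avg i u x * (phi i c ^+ 2))); last first.
  by apply: eq_Rintegral => c _; rewrite upd_at avg_upd; ring.
rewrite (RintZ (mside i) (fside i)); last exact: bmeasX2.
by rewrite -/(N i) mulfK.
Qed.

Let projK i u : proj i (proj i u) = proj i u.
Proof. by apply/funext => x; rewrite {1}/proj avg_phi. Qed.


(** Either order is the same double integral of [u] against the two ground states over a
    two-dimensional fibre, with the integrations exchanged. *)
Lemma proj_comm i j u x : i != j -> V u -> K x ->
  proj i (proj j u) x = proj j (proj i u) x.
Proof.
move=> ij Vu Kx; have ji : j != i by rewrite eq_sym.
have dbl k l : k != l -> proj k (proj l u) x =
    phi k (x ord0 k) * phi l (x ord0 l) / (N k * N l) *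
    \int[leb]_(c in side a k) \int[leb]_(e in side a l)
      (u (upd (upd x k c) l e) * phi l e * phi k c).
  move=> kl; have lk : l != k by rewrite eq_sym.
  rewrite (_ : \int[_]_(c in _) \int[_]_(e in _) _ =
    \int[leb]_(c in side a k) (marg l u (upd x k c) * phi k c)); last first.
    apply: eq_Rintegral => c; rewrite inE => ck; rewrite (RintZr (mside l) (fside l))//.
    by apply: bmeasM => //; apply: bsec => //; exact: cuboid_upd.
  rewrite {1}/proj /avg {1}/marg.
  rewrite (_ : \int[_]_(c in _) _ = \int[leb]_(c in side a k)
     (phi l (x ord0 l) / N l * (marg l u (upd x k c) * phi k c))); last first.
    by apply: eq_Rintegral => c _; rewrite /proj /avg upd_neq//; ring.
  rewrite (RintZ (mside k) (fside k)); first by rewrite invfM; ring.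
  by apply: bmeasM => //; apply: bsec => //; exact: V_marg.
have [_ [M uM]] := Vu.2.
have [_ [Mi phiM]] := bphi i; have [_ [Mj phjM]] := bphi j.
rewrite (dbl i j ij) (dbl j i ji); congr (_ * _).
  by rewrite mulrC [RHS]mulrC (mulrC (N i)) (mulrC (phi i _)).
have := @Rint_swap _ _ _ _ _ leb leb _ _ (mside i) (mside j) (fside i) (fside j)
  (fun p : measurableTypeR R * measurableTypeR R =>
     u (upd (upd x i p.1) j p.2) * phi j p.2 * phi i p.1) (M * Mj * Mi) => /=.
move=> ->.
- apply: eq_Rintegral => e _; apply: eq_Rintegral => c _.
  by rewrite updC//; ring.
- apply: measurable_funM; last exact: (measurableT_comp (mphi i) measurable_fst).
  apply: measurable_funM; last exact: (measurableT_comp (mphi j) measurable_snd).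
  apply: (measurableT_comp Vu.1).
  apply: (measurableT_comp (measurable_upd j)
    (g := fun p : measurableTypeR R * measurableTypeR R => (upd x i p.1, p.2))).
  apply: measurable_fun_pair; last exact: measurable_snd.
  apply: (measurableT_comp (measurable_upd i)
    (g := fun p : measurableTypeR R * measurableTypeR R => (x, p.1))).
  by apply: measurable_fun_pair; [exact: measurable_cst|exact: measurable_fst].
- move=> c e ci ej /=; rewrite !normrM !ler_pM//; [|exact: phjM|exact: phiM].
  by apply/uM/cuboid_upd => //; exact: cuboid_upd.
Qed.

Let dot_projP i u : V u -> dot (proj i u) (proj i u) = dot (proj i u) u.
Proof. by move=> Vu; rewrite dot_projC ?projK 1?dotC//; exact: V_proj. Qed.

Let norm_compl i u : V u ->
  dot (fun x => u x - proj i u x) (fun x => u x - proj i u x) =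
  dot u u - dot (proj i u) u.
Proof.
move=> Vu; have Vp := V_proj i Vu; have Vb := VB Vu Vp.
by rewrite dotBl// !dotBr// dot_projP// (dotC u (proj i u)) subrr subr0.
Qed.

Let proj_le i u : V u -> dot (proj i u) (proj i u) <= dot u u.
Proof.
by move=> Vu; rewrite dot_projP// -subr_ge0 -norm_compl//; exact: dot_ge0.
Qed.

Definition projs (s : seq 'I_n.+1) u := foldl (fun v i => proj i v) u s.

Let projs_cons i s u : projs (i :: s) u = projs s (proj i u). Proof. by []. Qed.

(** By commutation, the part of $P_iu$ off the range of $P_j$ is $P_i(u-P_ju)$, and a projection
    does not increase the norm. *)
Let two_coords i j u : i != j -> V u ->
  dot (proj i u) (proj i u) - dot (proj j (proj i u)) (proj i u) <=
  dot u u - dot (proj j u) u.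
Proof.
move=> ij Vu; have Vi := V_proj i Vu; have Vj := V_proj j Vu.
rewrite -(norm_compl j Vi) -(norm_compl j Vu).
apply: le_trans (proj_le i (VB Vu Vj)).
rewrite le_eqVlt; apply/orP; left; apply/eqP.
have E : {in K, (fun x => proj i u x - proj j (proj i u) x) =1
    proj i (fun x => u x - proj j u x)}.
  move=> x; rewrite inE => Kx; rewrite -proj_comm// /proj -mulrBr; congr (_ * _).
  rewrite /avg -mulrBl; congr (_ / _); rewrite /marg -(RintB (mside i) (fside i)).
  - by apply: eq_Rintegral => c _; rewrite mulrBl.
  - exact: bmeasM (bsec i Vu Kx) (bphi i).
  - exact: bmeasM (bsec i Vj Kx) (bphi i).
exact: (eq_dot E E).
Qed.

(* The tensorization of the variance (Efron-Stein) for commuting orthogonal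
   projections. *)
Lemma efron_stein (s : seq 'I_n.+1) u : uniq s -> V u ->
  dot u u + \sum_(i <- s) dot (proj i u) u <=
  (size s)%:R * dot u u + dot (projs s u) (projs s u).
Proof.
elim: s u => [|i s IH] u; first by rewrite big_nil mul0r add0r addr0.
move=> /= /andP[iNs us] Vu; have Vi := V_proj i Vu.
have := IH _ us Vi; rewrite big_cons -/(projs s (proj i u)).
(* The induction hypothesis speaks of [proj i u]; summing the two-coordinate inequality over the
   remaining coordinates carries it back to [u]. *)
have : \sum_(j <- s) (dot (proj i u) (proj i u) - dot (proj j (proj i u)) (proj i u)) <=
    \sum_(j <- s) (dot u u - dot (proj j u) u).
  rewrite !big_seq; apply: ler_sum => j js; apply: two_coords => //.
  by apply: contraNneq iNs => ->.
have cst (c : R) : \sum_(j <- s) c = (size s)%:R * c.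
  by rewrite big_const_seq count_predT iter_addr_0 mulr_natl.
rewrite [leLHS]sumrB [leRHS]sumrB !cst -natr1 (dot_projP i Vu).
move: (dot (projs _ _) _) (dot u u) (dot (proj i u) u) => A B C.
move: (\sum_(_ <- _) _) (\sum_(_ <- _) _) => X Y; move: (size s)%:R => S.
lra.
Qed.

Let prod_phi (s : seq 'I_n.+1) x := \prod_(i <- s) phi i (x ord0 i).
(** The iterated projection stripped of its factors [phi i]. The result is independent of every
    coordinate already averaged, so over all coordinates it is a constant and the full composition
    of projections has rank one. *)
Definition avgs (s : seq 'I_n.+1) u := foldl (fun v i => avg i v) u s.

Let V_projs s u : V u -> V (projs s u).
Proof. by elim: s u => [//|i s IH] u Vu; apply/IH/V_proj. Qed.

Let avg_eq i u v : {in K, u =1 v} -> {in K, avg i u =1 avg i v}.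
Proof.
move=> uv x; rewrite inE => Kx; congr (_ / _); apply: eq_Rintegral => c.
by rewrite inE => ci; rewrite uv// inE; exact: cuboid_upd.
Qed.

Let projs_eq s u v : {in K, u =1 v} -> {in K, projs s u =1 projs s v}.
Proof.
elim: s u v => [//|i s IH] u v uv; apply: IH => x Kx.
by rewrite /proj (avg_eq i uv).
Qed.

Let proj_coordM i j u : i != j -> V u ->
  {in K, proj j (fun z => phi i (z ord0 i) * u z) =1
         (fun z => phi i (z ord0 i) * proj j u z)}.
Proof.
move=> ij Vu x; rewrite inE => Kx; rewrite /proj [RHS]mulrCA; congr (_ * _).
rewrite /avg mulrA; congr (_ / _); rewrite -(RintZ (mside j) (fside j)).
  by apply: eq_Rintegral => c _; rewrite upd_neq// mulrA.
by apply: bmeasM => //; exact: bsec.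
Qed.

Let projs_coordM i (s : seq 'I_n.+1) u : i \notin s -> V u ->
  {in K, projs s (fun z => phi i (z ord0 i) * u z) =1
         (fun z => phi i (z ord0 i) * projs s u z)}.
Proof.
elim: s u => [//|j s IH] u; rewrite inE negb_or => /andP[ij iNs] Vu x Kx.
rewrite !projs_cons -(IH (proj j u))//; last exact: V_proj.
by apply: projs_eq Kx; exact: proj_coordM.
Qed.

Let projsE (s : seq 'I_n.+1) u : uniq s -> V u ->
  {in K, projs s u =1 (fun x => prod_phi s x * avgs s u x)}.
Proof.
elim: s u => [|i s IH] u; first by move=> _ _ x _; rewrite /prod_phi big_nil mul1r.
rewrite cons_uniq => /andP[iNs us] Vu x Kx; rewrite projs_cons /proj projs_coordM//;
  last exact: V_avg.
by rewrite IH//; [rewrite /prod_phi big_cons mulrA|exact: V_avg].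
Qed.

Let avgs_upd (s : seq 'I_n.+1) i u x c :
  ((forall z e, u (upd z i e) = u z) \/ i \in s) ->
  avgs s u (upd x i c) = avgs s u x.
Proof.
elim: s u => [u [//|//]|j s IH] u H; rewrite /avgs /= -/(avgs s _); apply: IH.
case: (eqVneq i j) => [->|ij]; first by left=> z e; rewrite avg_upd.
case: H => [H|]; last by rewrite inE (negPf ij) => ?; right.
left=> z e; congr (_ / _); apply: eq_Rintegral => e' _.
by rewrite updC// H.
Qed.

Let Phi := prod_phi (index_enum 'I_n.+1).

(** The points [mix s] lead from [x] to [z] by changing one coordinate at a time, and no such change
    affects the full average. *)
Let avgs_const u x z : avgs (index_enum _) u x = avgs (index_enum _) u z.
Proof.
pose mix (s : seq 'I_n.+1) : 'rV[R]_n.+1 :=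
  \row_j (if j \in s then z ord0 j else x ord0 j).
have mixE s : avgs (index_enum _) u (mix s) = avgs (index_enum _) u x.
  elim: s => [|i s IH]; first by congr avgs; apply/rowP => j; rewrite mxE.
  rewrite -IH (_ : mix (i :: s) = upd (mix s) i (z ord0 i)); last first.
    by apply/rowP => j; rewrite !mxE inE; case: eqP => [->|].
  by apply: avgs_upd; right; exact: mem_index_enum.
rewrite -(mixE (index_enum _)); congr avgs.
by apply/rowP => j; rewrite mxE mem_index_enum.
Qed.

Let V_Phi : V Phi.
Proof.
rewrite /Phi /prod_phi; elim: index_enum => [|i s IH].
  under eq_fun do rewrite big_nil.
  by split; [exact: measurable_cst|exact: bmeas_cst].
by under eq_fun do rewrite big_cons; exact: VM (V_coord i) IH.
Qed.

Let proj_Phi i : proj i Phi = Phi.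
Proof.
apply/funext => x; rewrite /proj /avg /marg /Phi /prod_phi.
rewrite (_ : \int[_]_(c in _) _ = \int[leb]_(c in side a i)
    ((\prod_(j | j != i) phi j (x ord0 j)) * phi i c ^+ 2)); last first.
  apply: eq_Rintegral => c _; rewrite (bigD1 i)//= upd_at.
  rewrite (eq_bigr (fun j => phi j (x ord0 j))); first by ring.
  by move=> j ji; rewrite upd_neq.
rewrite (RintZ (mside i) (fside i)); last exact: bmeasX2.
by rewrite -/(N i) mulfK// [RHS](bigD1 i).
Qed.

Let dot_Phi_projs s u : V u -> dot Phi (projs s u) = dot Phi u.
Proof.
elim: s u => [//|i s IH] u Vu; rewrite projs_cons IH; last exact: V_proj.
by rewrite -dot_projC ?proj_Phi.
Qed.

(** The composition of all projections sends [u] to a multiple [k * Phi]. Every projection is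
    self-adjoint and fixes [Phi], so pairing with [Phi] determines [k]. *)
Lemma norm_projs_all u : V u ->
  dot (projs (index_enum _) u) (projs (index_enum _) u) =
  dot u Phi ^+ 2 / dot Phi Phi.
Proof.
move=> Vu; pose k := avgs (index_enum _) u 0.
have E : {in K, projs (index_enum _) u =1 (fun x => k * Phi x)}.
  move=> x Kx; rewrite projsE// ?index_enum_uniq//.
  by rewrite (avgs_const u x 0) mulrC.
have D v : V v -> dot v (projs (index_enum _) u) = k * dot v Phi.
  move=> Vv; rewrite (eq_dot (u' := v) _ E)// /dot -RintZ//.
    by apply: eq_Rintegral => x _; rewrite mulrCA.
  exact: bmeasM Vv.2 V_Phi.2.
have H : dot u Phi = k * dot Phi Phi by rewrite -D// dot_Phi_projs// dotC.
rewrite D; last exact: V_projs.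
rewrite dotC D// H; case: (eqVneq (dot Phi Phi) 0) => [->|Q0]; first by rewrite !mulr0 expr0n mul0r.
by field.
Qed.

(** Rearranged: the squared distance from [u] to the line of the product ground state is at most
    $\sum_i\|u-P_iu\|^2$. *)
Theorem efron_stein_all u : measurable_fun setT u -> bmeas K u ->
  dot u u + \sum_i dot (proj i u) u <=
  n.+1%:R * dot u u + dot u (fun x => \prod_i phi i (x ord0 i)) ^+ 2 /
    dot (fun x => \prod_i phi i (x ord0 i)) (fun x => \prod_i phi i (x ord0 i)).
Proof.
move=> mu bu; have Vu : V u by [].
have := efron_stein (index_enum_uniq _) Vu.
rewrite norm_projs_all// (_ : size (index_enum _) = n.+1)//.
by rewrite [index_enum _]unlock -enumT size_enum_ord.
Qed.

End projections.

(** * From one-dimensional Robin forms to a coercive form on the cuboid *)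

Section fibers.
Context {R : realType} {n : nat}.
Implicit Types (i : 'I_n.+1) (y : 'rV[R]_n) (psi : 'rV[R]_n.+1 -> R).
Notation leb := (@lebesgue_measure R).
Notation lam := (lebesgue_rV R).

Lemma insert_coord_shift i (h c : R) y :
  insert_coord i (h + c) y = h *: delta_mx ord0 i + insert_coord i c y.
Proof.
apply/rowP => j; rewrite [RHS]mxE [X in _ = X + _]mxE.
case: (unliftP i j) => [k ->|->].
  rewrite !insert_coord_lift mxE eqxx/= eq_sym (negPf (neq_lift _ _)).
  by rewrite mulr0 add0r.
by rewrite !insert_coord_at mxE !eqxx mulr1.
Qed.

Lemma continuous_insert_coord i y : continuous (fun c : R => insert_coord i c y).
Proof.
move=> c; apply/cvg_ballP => e e0; near=> c'.
split=> // k j; rewrite !ord1; case: (unliftP i j) => [l ->|->].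
  by rewrite !insert_coord_lift; exact: ballxx.
rewrite !insert_coord_at; near: c'.
exact: (nbhsx_ballx c e e0).
Unshelve. all: by end_near. Qed.

Lemma C1_continuous psi : C1_on setT psi -> continuous psi.
Proof. by move=> h x; have [] := h x I. Qed.

Lemma C1_continuous_partial psi i : C1_on setT psi -> continuous (partial i psi).
Proof. by move=> h x; have [_ /(_ i)[]] := h x I. Qed.

Lemma is_derive_insert_coord psi i y (c : R) :
  derivable psi (insert_coord i c y) (delta_mx ord0 i) ->
  is_derive c 1 (fun c => psi (insert_coord i c y)) (partial i psi (insert_coord i c y)).
Proof.
move=> dpsi.
have E : (fun h : R => h^-1 *: (((fun c => psi (insert_coord i c y)) \o shift c) (h *: 1) -
     psi (insert_coord i c y))) =
  (fun h : R => h^-1 *: ((psi \o shift (insert_coord i c y)) (h *: delta_mx ord0 i) -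
     psi (insert_coord i c y))).
  apply/funext => h /=; rewrite -insert_coord_shift.
  by rewrite [h *: 1]/GRing.scale/= mulr1.
split; first by rewrite /derivable E.
by rewrite /partial /derive E.
Qed.

Variable a : 'rV[R]_n.+1.
Hypothesis a0 : forall i, 0 < a ord0 i.
Variable phi : 'I_n.+1 -> R -> R.
Hypothesis cphi : forall i, continuous (phi i).
Notation K := (cuboid a).

Lemma face_sum i (F : bool -> R) : \sum_(s : bool) F s = F false + F true.
Proof. by rewrite big_bool addrC. Qed.

Lemma faceE i s y : face a i s y = insert_coord i (if s then - a ord0 i else a ord0 i) y.
Proof. by rewrite /face; case: s; rewrite ?(expr1, expr0, mulN1r, mul1r). Qed.

(** The constants are left free for two uses: the Robin gap, with $A=\alpha^2$ and
    $B=\alpha^2+\beta^2$, and the Friedrichs inequality, with $B=0$ and a negative [sg]. *)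
Lemma integrate_fibers psi i (A B sg : R) : C1_on setT psi ->
  (forall f f' : R -> R, (forall x : R, is_derive x 1 f (f' x)) -> continuous f' ->
    A * \int[leb]_(x in `[- a ord0 i, a ord0 i]) (f x ^+ 2) -
    B * (\int[leb]_(x in `[- a ord0 i, a ord0 i]) (f x * phi i x)) ^+ 2 /
      \int[leb]_(x in `[- a ord0 i, a ord0 i]) (phi i x ^+ 2) <=
    \int[leb]_(x in `[- a ord0 i, a ord0 i]) (f' x ^+ 2) -
    sg * (f (a ord0 i) ^+ 2 + f (- a ord0 i) ^+ 2)) ->
  A * dot a psi psi - B * dot a (proj a phi i psi) psi <=
  \int[lam n.+1]_(x in K) (partial i psi x ^+ 2) -
  sg * \sum_(s : bool) \int[lam n]_(y in cuboid (col' i a)) (psi (face a i s y) ^+ 2).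
Proof.
move=> C1 H.
have cpsi := C1_continuous C1; have cp := @C1_continuous_partial _ i C1.
have mpsi := continuous_measurable_rV cpsi; have mp := continuous_measurable_rV cp.
have bpsi := continuous_bmeas a cpsi; have bp := continuous_bmeas a cp.
have mK' := measurable_cuboid (col' i a).
have fK' := cuboid_fin (col'_gt0 a0 i).
have bfib F G : measurable_fun setT F -> bmeas K F -> measurable_fun setT G -> bmeas K G ->
    bmeas (cuboid (col' i a)) (fun y => \int[leb]_(c in side a i)
      (F (insert_coord i c y) * G (insert_coord i c y))).
  move=> mF bF mG bG; apply: (@bmeas_Rint_insert _ _ a a0 i (fun x => F x * G x)).
    exact: measurable_funM.
  exact: bmeasM.
have mphi : measurable_fun setT (fun x : 'rV[R]_n.+1 => phi i (x ord0 i)).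
  by apply: (measurableT_comp (f := phi i : measurableTypeR R -> R) _ (measurable_coord i));
    exact: continuous_measurable_fun.
have bphi : bmeas K (fun x : 'rV[R]_n.+1 => phi i (x ord0 i)).
  split; first exact: measurable_funTS.
  have [_ [M phiM]] := cont_seg_bmeas (cont_segT (@cphi i) (p := - a ord0 i) (q := a ord0 i)).
  exists M => x Kx; apply: phiM; apply: subset_itv_oo_cc.
  by rewrite /= in_itv; exact: Kx.
rewrite dot_proj// /dot.
rewrite (fubini_cuboid a0 i (F := fun x => psi x * psi x)); last 2 first.
- exact: measurable_funM.
- exact: bmeasM.
rewrite (fubini_cuboid a0 i (F := fun x => partial i psi x ^+ 2)); last 2 first.
- by under eq_fun do rewrite expr2; exact: measurable_funM.
- exact: bmeasX2.
have b1 := bfib _ _ mpsi bpsi mpsi bpsi.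
have b2 : bmeas (cuboid (col' i a)) (fun y => \int[leb]_(c in side a i)
      (psi (insert_coord i c y) * phi i c)).
  have := bfib _ _ mpsi bpsi mphi bphi.
  by apply: eq_bmeas => y _; apply: eq_Rintegral => c _; rewrite insert_coord_at.
have b3 : bmeas (cuboid (col' i a)) (fun y => \int[leb]_(c in side a i)
      (partial i psi (insert_coord i c y) ^+ 2)).
  have := bfib _ _ mp bp mp bp.
  by apply: eq_bmeas => y _; apply: eq_Rintegral => c _; rewrite expr2.
have b4 s : bmeas (cuboid (col' i a)) (fun y => psi (face a i s y) ^+ 2).
  by apply: bmeasX2; exact: bmeas_face.
set N := \int[leb]_(c in side a i) (phi i c ^+ 2).
have b5 : bmeas (cuboid (col' i a)) (fun y =>
   \int[leb]_(c in side a i) (psi (insert_coord i c y) * phi i c) *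
   \int[leb]_(c in side a i) (psi (insert_coord i c y) * phi i c) / N).
  exact: (bmeasM (bmeasM b2 b2) (bmeas_cst _ N^-1)).
have b6 := bmeasD (b4 false) (b4 true).
rewrite (face_sum i) -(RintD mK' fK' (b4 false) (b4 true)).
rewrite -(RintZ mK' fK' A b1) -(RintZ mK' fK' B b5) -(RintZ mK' fK' sg b6).
rewrite -(RintB mK' fK' (bmeasZ A b1) (bmeasZ B b5)).
rewrite -(RintB mK' fK' b3 (bmeasZ sg b6)).
apply: (le_Rint mK' fK' (bmeasB (bmeasZ A b1) (bmeasZ B b5)) (bmeasB b3 (bmeasZ sg b6))).
move=> y yK; rewrite !faceE /N.
have df (c : R) := @is_derive_insert_coord psi i y c ((C1 (insert_coord i c y) I).2 i).1.
have cf' : continuous (fun c => partial i psi (insert_coord i c y)).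
  by move=> c; apply: (continuous_comp (@continuous_insert_coord i y c)); exact: cp.
have cf : continuous (fun c => psi (insert_coord i c y)).
  by move=> c; apply: (continuous_comp (@continuous_insert_coord i y c)); exact: cpsi.
have := H _ _ df cf'.
rewrite -!Rint_open; last 4 first.
- exact: cont_segX2 (cont_segT cf').
- exact: cont_segX2 (cont_segT (@cphi i)).
- exact: cont_segM (cont_segT cf) (cont_segT (@cphi i)).
- exact: cont_segX2 (cont_segT cf).
rewrite -/(side a i) -mulrA -expr2; apply: le_trans.
by rewrite le_eqVlt; apply/orP; left; apply/eqP; congr (_ * _ - _).
Qed.

Lemma integral_surface_sqr psi : continuous psi ->
  \int[surface_measure a]_x (psi x ^+ 2) = \sum_(i < n.+1) \sum_(s : bool)
    \int[lam n]_(y in cuboid (col' i a)) (psi (face a i s y) ^+ 2).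
Proof.
move=> cpsi; have mpsi := continuous_measurable_rV cpsi.
rewrite (integral_surface a0)//.
  by under eq_fun do rewrite expr2; exact: measurable_funM.
have [M PM] := continuous_bounded a cpsi; exists (M ^+ 2) => x ax.
by rewrite normrX lerXn2r// ?nnegrE// ?PM// (le_trans _ (PM x ax)).
Qed.

End fibers.

Section coercivity.
Context {R : realType} {n : nat}.
Variable a : 'rV[R]_n.+1.
Hypothesis a0 : forall i, 0 < a ord0 i.
Notation leb := (@lebesgue_measure R).
Notation lam := (lebesgue_rV R).
Notation K := (cuboid a).
Notation S := (surface_measure a).

Definition energy (psi : 'rV[R]_n.+1 -> R) :=
  \sum_(i < n.+1) \int[lam n.+1]_(x in K) (partial i psi x ^+ 2).

(** Riccati along coordinate 0 with $G(x)=-kx$. For $k=1/(2A^2)$ one has $G'+G^2=-k+k^2x^2\le-k/2$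
    on $[-A,A]$, while the values of $G$ at the ends produce the boundary constant $kA$. *)
Lemma friedrichs : exists (C d : R), 0 < d /\
  forall psi, C1_on setT psi ->
  d * dot a psi psi <= energy psi + C * \int[S]_x (psi x ^+ 2).
Proof.
pose A := a ord0 ord0; have A0 : 0 < A by exact: a0.
pose k := (2 * A ^+ 2)^-1; have k0 : 0 < k by rewrite invr_gt0 mulr_gt0// exprn_gt0.
exists (k * A), (k / 2); split; first by rewrite divr_gt0.
move=> psi C1.
have H : k / 2 * dot a psi psi <= \int[lam n.+1]_(x in K) (partial ord0 psi x ^+ 2) +
    k * A * \sum_(s : bool)
      \int[lam n]_(y in cuboid (col' ord0 a)) (psi (face a ord0 s y) ^+ 2).
  have := @integrate_fibers R n a a0 (fun=> cst 0) (fun i => @cst_continuous _ _ 0)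
    psi ord0 (k / 2) 0 (- (k * A)) C1.
  rewrite !mul0r !subr0 mulNr opprK; apply.
  move=> f f' df cf'; rewrite !mul0r subr0 -/A mulNr opprK.
  have AA : - A < A by rewrite -subr_gt0 opprK addr_gt0.
  have := @riccati R (- A) A f f' (fun x => - k * x) (cst (- k)) (- (k / 2)) AA df cf'.
  move=> /(_ (fun x _ => is_derive_lin (- k) x)) /(_ (@cont_seg_cst R (- A) A (- k))).
  have H : forall x, x \in `[- A, A] -> - k + (- k * x) ^+ 2 <= - (k / 2).
    move=> x; rewrite in_itv/= => /andP[x1 x2].
    have kA : k * A ^+ 2 = 1 / 2 by rewrite /k; field; rewrite lt0r_neq0.
    have xA : x ^+ 2 <= A ^+ 2 by nra.
    have : k * (k * x ^+ 2) <= k * (k * A ^+ 2) by rewrite !ler_pM2l.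
    by rewrite kA; lra.
  by move=> /(_ H); lra.
apply: le_trans H _; apply: lerD.
  rewrite /energy big_ord_recl lerDl sumr_ge0// => i _.
  by apply: Rintegral_ge0 => x _; exact: sqr_ge0.
apply: ler_wpM2l; first by rewrite mulr_ge0 ?ltW.
rewrite integral_surface_sqr//; last exact: C1_continuous.
rewrite [leRHS]big_ord_recl lerDl sumr_ge0// => i _; rewrite sumr_ge0// => s _.
by apply: Rintegral_ge0 => x _; exact: sqr_ge0.
Qed.

Variables (b al be : R).
Hypotheses (ab : forall i, a ord0 i = b) (al0 : 0 < al) (alb : al * b < pi)
  (be0 : 0 < be).
Let sg := be * sinhR (be * b) / coshR (be * b).
Hypothesis sg_lt : sg * sin (al * b) < al * cos (al * b).

Definition prod_cosh (x : 'rV[R]_n.+1) : R := \prod_i coshR (be * x ord0 i).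

Let phi (i : 'I_n.+1) (c : R) : R := coshR (be * c).
Let cphi i : continuous (phi i).
Proof. exact: continuous_derive (fun x => is_derive_comp_lin (is_derive_coshR (be * x))). Qed.

Let b0 : 0 < b. Proof. by rewrite -(ab ord0). Qed.

Let N0 i : \int[leb]_(c in side a i) (phi i c ^+ 2) != 0.
Proof.
have c2 : cont_seg (- b) b (fun c => phi i c ^+ 2) by apply/cont_segX2/cont_segT.
rewrite /side ab Rint_open// lt0r_neq0//.
have : \int[leb]_(x in `[- b, b]) (cst 1 x) <= \int[leb]_(x in `[- b, b]) (phi i x ^+ 2).
  apply: le_Rint_seg => //; first exact: cont_seg_cst.
  by move=> x _ /=; rewrite -(cosh2Bsinh2 (be * x)) /phi lerBlDr lerDl; exact: sqr_ge0.
have L : leb `[- b, b]%classic = (2 * b)%:E.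
  rewrite lebesgue_measure_itv/= lte_fin ifT; last by move: b0; lra.
  by rewrite -EFinD; congr EFin; ring.
apply: lt_le_trans; rewrite Rintegral_cst// mul1r.
have -> : fine (leb `[- b, b]%classic) = 2 * b by rewrite L.
by rewrite mulr_gt0.
Qed.

(** Summing the gap over the [n.+1] directions gives
    $(n+1)\alpha^2\|\psi\|^2-(\alpha^2+\beta^2)\sum_i\langle P_i\psi,\psi\rangle$. Efron-Stein
    bounds the last sum by $n\|\psi\|^2$ plus the rank-one term, which leaves the factor
    $\alpha^2-n\beta^2$. *)
Lemma coercivity psi : C1_on setT psi ->
  (al ^+ 2 - n%:R * be ^+ 2) * dot a psi psi -
  (al ^+ 2 + be ^+ 2) / dot a prod_cosh prod_cosh * dot a psi prod_cosh ^+ 2 <=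
  energy psi - sg * \int[S]_x (psi x ^+ 2).
Proof.
move=> C1; have cpsi := C1_continuous C1.
have mpsi := continuous_measurable_rV cpsi.
have bpsi := continuous_bmeas a cpsi.
rewrite integral_surface_sqr// mulr_sumr -sumrB.
have H i : al ^+ 2 * dot a psi psi - (al ^+ 2 + be ^+ 2) * dot a (proj a phi i psi) psi <=
  \int[lam n.+1]_(x in K) (partial i psi x ^+ 2) -
  sg * \sum_(s : bool) \int[lam n]_(y in cuboid (col' i a)) (psi (face a i s y) ^+ 2).
  apply: integrate_fibers => // f f' df cf'; rewrite ab.
  exact: robin_gap.
have := @ler_sum _ _ (index_enum 'I_n.+1) xpredT _ _ (fun i _ => H i).
apply: le_trans.
rewrite sumrB -!mulr_sumr sumr_const card_ord -[dot a psi psi *+ _]mulr_natr -natr1.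
have := efron_stein_all a0 cphi N0 mpsi bpsi.
rewrite -natr1 -/prod_cosh; set P := dot a psi prod_cosh ^+ 2 / _.
rewrite [_ / _ * _]mulrAC -[_ * _ / _]mulrA -/P.
move: (dot a psi psi) (\sum_i _) => D X H1.
have k0 : 0 <= al ^+ 2 + be ^+ 2 by rewrite addr_ge0 ?sqr_ge0.
have {H1} := ler_wpM2l k0 H1; move: (n%:R) (P) => m {}P.
rewrite -subr_ge0 => H2; rewrite -subr_ge0. apply: le_trans H2 _.
by rewrite le_eqVlt; apply/orP; left; apply/eqP; ring.
Qed.

End coercivity.

(** * Lower bound for the Steklov eigenvalues of a cube *)

Section L2.
Context d (T : measurableType d) (R : realType).
Variables (mu : {measure set T -> \bar R}) (D : set T).
Hypothesis mD : measurable D.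
Implicit Types f g : T -> R.

(* [L2_on] of the definitions is stated for row vectors only. *)
Definition sqint f :=
  measurable_fun D f /\ (\int[mu]_(x in D) (f x ^+ 2)%:E < +oo)%E.

Definition ip f g := \int[mu]_(x in D) (f x * g x).

Lemma sqint_integrable f : sqint f -> mu.-integrable D (EFin \o (fun x => f x ^+ 2)).
Proof.
move=> [mf foo]; apply/integrableP; split.
  by apply/measurable_EFinP; exact: measurable_funX.
apply: le_lt_trans foo; apply: ge0_le_integral => //.
- by apply: measurableT_comp => //; apply/measurable_EFinP; exact: measurable_funX.
- by apply/measurable_EFinP; exact: measurable_funX.
- by move=> x _; rewrite /= lee_fin ger0_norm// sqr_ge0.
Qed.

Lemma sqintM f g : sqint f -> sqint g ->
  mu.-integrable D (EFin \o (fun x => f x * g x)).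
Proof.
move=> sf sg.
apply: (@le_integrable _ _ _ mu D mD _ (EFin \o (fun x => f x ^+ 2 + g x ^+ 2))).
- by apply/measurable_EFinP; apply: measurable_funM; [exact: sf.1|exact: sg.1].
- move=> x _; rewrite /= lee_fin [leRHS]ger0_norm ?addr_ge0 ?sqr_ge0// normrM.
  rewrite -(real_normK (num_real (f x))) -(real_normK (num_real (g x))).
  have := sqr_ge0 (`|f x| - `|g x|); have := normr_ge0 (f x); have := normr_ge0 (g x).
  by nra.
- exact: (integrableD mD (sqint_integrable sf) (sqint_integrable sg)).
Qed.

Lemma sqintZ c f : sqint f -> sqint (fun x => c * f x).
Proof.
move=> sf; split; first by apply: measurable_funM => //; exact: sf.1.
have := integrableZl mD (c ^+ 2) (sqint_integrable sf).
move/integrableP => [_]; apply: le_lt_trans.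
apply: ge0_le_integral => //.
- by move=> x _; rewrite lee_fin sqr_ge0.
- by apply/measurable_EFinP/measurable_funX/measurable_funM => //; exact: sf.1.
- apply: measurableT_comp => //; apply/measurable_EFinP.
  by apply: measurable_funM => //; apply: measurable_funX; exact: sf.1.
- by move=> x _; rewrite /= lee_fin exprMn ler_norm.
Qed.

Lemma sqintD f g : sqint f -> sqint g -> sqint (fun x => f x + g x).
Proof.
move=> sf sg; split; first exact: measurable_funD sf.1 sg.1.
have := integrableD mD (integrableD mD (sqint_integrable sf) (sqint_integrable sg))
  (integrableD mD (sqintM sf sg) (sqintM sf sg)).
move/integrableP => [m]; apply: le_lt_trans; apply: ge0_le_integral => //.
- by move=> x _; rewrite lee_fin sqr_ge0.
- by apply/measurable_EFinP/measurable_funX/measurable_funD; [exact: sf.1|exact: sg.1].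
- exact: measurableT_comp m.
- move=> x _; rewrite /= lee_fin; apply: le_trans (ler_norm _).
  by rewrite le_eqVlt; apply/orP; left; apply/eqP; ring.
Qed.

Lemma sqintB f g : sqint f -> sqint g -> sqint (fun x => f x - g x).
Proof.
move=> sf sg; have := sqintD sf (sqintZ (-1) sg).
by under [X in _ -> sqint X]eq_fun do rewrite -mulN1r.
Qed.

Lemma ipC f g : ip f g = ip g f.
Proof. by apply: eq_Rintegral => x _; rewrite mulrC. Qed.

Lemma ipDl f g h : sqint f -> sqint g -> sqint h ->
  ip (fun x => f x + g x) h = ip f h + ip g h.
Proof.
move=> sf sg sh; rewrite /ip -RintegralD//; [|exact: sqintM..].
by apply: eq_Rintegral => x _; rewrite mulrDl.
Qed.

Lemma ipZl c f g : sqint f -> sqint g -> ip (fun x => c * f x) g = c * ip f g.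
Proof.
move=> sf sg; rewrite /ip -RintegralZl//; last exact: sqintM.
by apply: eq_Rintegral => x _; rewrite mulrA.
Qed.

Lemma ipBl f g h : sqint f -> sqint g -> sqint h ->
  ip (fun x => f x - g x) h = ip f h - ip g h.
Proof.
move=> sf sg sh; rewrite /ip -RintegralB//; [|exact: sqintM..].
by apply: eq_Rintegral => x _; rewrite mulrBl.
Qed.

Lemma ip_ge0 f : 0 <= ip f f.
Proof. by apply: Rintegral_ge0 => x _; rewrite -expr2 sqr_ge0. Qed.

Lemma cauchy_schwarz f g : sqint f -> sqint g ->
  ip f g ^+ 2 <= ip f f * ip g g.
Proof.
move=> sf sg.
have H t : 0 <= ip f f - 2 * t * ip f g + t ^+ 2 * ip g g.
  have st := sqintZ t sg; have sb := sqintB sf st.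
  have := ip_ge0 (fun x => f x - t * g x).
  rewrite ipBl// ipZl// (ipC f) (ipC g) !ipBl// !ipZl// (ipC g f).
  by move=> /le_trans; apply; rewrite le_eqVlt; apply/orP; left; apply/eqP; ring.
have G0 := ip_ge0 g; have F0 := ip_ge0 f.
have [G|G] := eqVneq (ip g g) 0.
  rewrite G in H *; rewrite mulr0; have [->|I0] := eqVneq (ip f g) 0; first by rewrite expr0n.
  (* With [ip g g = 0] the quadratic in [t] is affine, and this [t] would give it the value -1. *)
  have := H ((ip f f + 1) / (2 * ip f g)); rewrite mulr0 addr0.
  rewrite (_ : 2 * _ * _ = ip f f + 1); last by field.
  lra.
have Gp : 0 < ip g g by rewrite lt_def G.
have := H (ip f g / ip g g).
rewrite (_ : _ + _ = ip f f - ip f g ^+ 2 / ip g g); last by field.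
by rewrite subr_ge0 ler_pdivrMr.
Qed.

Lemma ip_norm_le f g : sqint f -> sqint g ->
  `|ip f g| <= Num.sqrt (ip f f) * Num.sqrt (ip g g).
Proof.
move=> sf sg; rewrite -sqrtrM ?ip_ge0// -sqrtr_sqr ler_wsqrtr//.
exact: cauchy_schwarz.
Qed.

Definition sqcvg (f_ : (T -> R)^nat) f :=
  (\int[mu]_(x in D) ((f_ n x - f x) ^+ 2)%:E)%E @[n --> \oo] --> 0%E.

Lemma sqcvg_ip (f_ g_ : (T -> R)^nat) f g :
  (forall n, sqint (f_ n)) -> (forall n, sqint (g_ n)) -> sqint f -> sqint g ->
  sqcvg f_ f -> sqcvg g_ g -> ip (f_ n) (g_ n) @[n --> \oo] --> ip f g.
Proof.
move=> sf_ sg_ sf sg ff gg.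
pose df n x := f_ n x - f x; pose dg n x := g_ n x - g x.
have sdf n : sqint (df n) by exact: sqintB.
have sdg n : sqint (dg n) by exact: sqintB.
have to0 (k_ : (T -> R)^nat) k : sqcvg k_ k ->
    Num.sqrt (ip (fun x => k_ n x - k x) (fun x => k_ n x - k x)) @[n --> \oo] --> (0 : R).
  move=> kk; rewrite -(@sqrtr0 R).
  apply: (@continuous_cvg _ _ _ _ _ _ (@Num.sqrt R)); first exact: sqrt_continuous.
  rewrite (_ : (fun n => _) = fine \o (fun n =>
    \int[mu]_(x in D) ((k_ n x - k x) ^+ 2)%:E)%E); first exact: (fine_cvg kk).
  by apply/funext.
have := to0 _ _ ff; rewrite -/df => X0; have := to0 _ _ gg; rewrite -/dg => Y0.
apply/subr_cvg0.
apply/norm_cvg0P.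
pose B n := Num.sqrt (ip (df n) (df n)) * Num.sqrt (ip (dg n) (dg n)) +
  (Num.sqrt (ip f f) * Num.sqrt (ip (dg n) (dg n)) +
   Num.sqrt (ip (df n) (df n)) * Num.sqrt (ip g g)).
have B0 : B n @[n --> \oo] --> (0 : R).
  rewrite (_ : 0 = 0 * 0 + (Num.sqrt (ip f f) * 0 + 0 * Num.sqrt (ip g g))); last by ring.
  by apply: cvgD; [exact: cvgM|apply: cvgD; apply: cvgM => //; exact: cvg_cst].
apply: (squeeze_cvgr _ (cvg_cst 0) B0).
apply: nearW => n; rewrite normr_ge0/=.
rewrite (_ : ip (f_ n) (g_ n) - ip f g = ip (df n) (dg n) + (ip f (dg n) + ip (df n) g)).
  rewrite (le_trans (ler_normD _ _))// lerD ?ip_norm_le//.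
  by rewrite (le_trans (ler_normD _ _))// lerD ?ip_norm_le.
rewrite /df /dg !ipBl//; last exact: sdg.
rewrite !(ipC _ (fun x => g_ n x - g x)) !ipBl//.
by rewrite !(ipC (g_ n)) !(ipC g); ring.
Qed.

Lemma sqcvg_cst f : sqcvg (fun=> f) f.
Proof.
rewrite /sqcvg; under eq_fun do under eq_integral do rewrite subrr expr0n.
by under eq_fun do rewrite integral0; exact: cvg_cst.
Qed.

Lemma sqcvgDcst (f_ : (T -> R)^nat) f c : sqcvg f_ f ->
  sqcvg (fun n x => f_ n x + c) (fun x => f x + c).
Proof.
rewrite /sqcvg; under [X in _ -> X @ _ --> _]eq_fun => n do
  under eq_integral => x _ do rewrite opprD addrACA subrr addr0.
by [].
Qed.

End L2.

Section continuous_sqr_integral.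
Context {R : realType}.
Notation lam := (lebesgue_rV R).

Definition box (n : nat) (x : 'rV[R]_n) (e : R) : set 'rV[R]_n :=
  [set y | forall i, y ord0 i \in `]x ord0 i - e, x ord0 i + e[].

Lemma measurable_box (n : nat) (x : 'rV[R]_n) e : measurable (box x e).
Proof.
rewrite (_ : box x e = \bigcap_(i in [set: 'I_n])
    ((fun y : 'rV[R]_n => y ord0 i : measurableTypeR R) @^-1`
       `]x ord0 i - e, x ord0 i + e[%classic)); last first.
  by apply/seteqP; split=> y /= xy i => [_|]; have := xy i; [|apply].
apply: fin_bigcap_measurable => // i _; rewrite -[X in measurable X]setTI.
exact: measurable_coord.
Qed.

Lemma lebesgue_box (n : nat) (x : 'rV[R]_n) e : 0 < e ->
  lam n (box x e) = ((2 * e) ^+ n)%:E.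
Proof.
move=> e0; elim: n x => [|n IH] x.
  rewrite expr0 /= diracE; case: (boolP (_ \in _)) => //.
  by move/negP; case; rewrite inE => -[].
pose x' : 'rV[R]_n := \row_j x ord0 (lift ord0 j).
rewrite /= /lebesgue_rVS /pushforward.
rewrite (_ : _ @^-1` _ = (`]x ord0 ord0 - e, x ord0 ord0 + e[%classic :
    set (measurableTypeR R)) `*` box x' e); last first.
  apply/seteqP; split => [[c y] /= cy|[c y] /= [cx yx] i].
    split; first by have := cy ord0; rewrite mxE unlift_none.
    by move=> i; have := cy (lift ord0 i); rewrite !mxE liftK.
  rewrite mxE; case: (unliftP ord0 i) => [j ->|->//].
  by have := yx j; rewrite mxE.
rewrite product_measure1E//; last exact: measurable_box.
rewrite exprS EFinM; congr (_ * _)%E; last exact: IH.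
transitivity (lebesgue_measure `]x ord0 ord0 - e, x ord0 ord0 + e[%classic) => //.
rewrite lebesgue_measure_itv/= lte_fin ifT; last by lra.
by rewrite -EFinD; congr EFin; ring.
Qed.

(** Turns the pointwise nontriviality of an eigenfunction into a positive $L^2$ norm: near a point
    with [u x != 0], continuity keeps $|u|$ above $|u(x)|/2$ on a small cube, whose volume is
    positive. *)
Lemma integral_sqr_eq0 (n : nat) (U : set 'rV[R]_n) (u : 'rV[R]_n -> R) :
  open U -> (forall x, U x -> {for x, continuous u}) ->
  sqint (lam n) U u -> ip (lam n) U u u = 0 -> forall x, U x -> u x = 0.
Proof.
move=> oU cu su u0 x Ux; apply/eqP/negPn/negP => ux.
have mU : measurable U by exact: open_measurable_rV.
have m0 : 0 < `|u x| / 2 by rewrite divr_gt0// normr_gt0.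
have [e e0 [eU eu]] : exists2 e, 0 < e &
    ball x e `<=` U /\ forall y, ball x e y -> `|u x| / 2 <= `|u y|.
  have /nbhs_ballP[e1 /= e10 H1] : nbhs x U by exact: open_nbhs_nbhs.
  have /cvgr_dist_lt/(_ _ m0)/nbhs_ballP[e2 /= e20 H2] := cu x Ux.
  exists (Num.min e1 e2); first by rewrite lt_min e10.
  split=> y xy.
    by apply/H1/(le_ball _ xy); rewrite ge_min lexx.
  have /H2 /= : ball x e2 y by apply: (le_ball _ xy); rewrite ge_min lexx orbT.
  by have := ler_normD (u x - u y) (u y); rewrite subrK; lra.
have bx : box x e `<=` ball x e.
  move=> y xy; split=> // i j; rewrite !ord1 /ball/=; have := xy j; rewrite in_itv/=.
  by move=> /andP[? ?]; rewrite ltr_norml; apply/andP; split; lra.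
have mb := measurable_box x e.
have bU : box x e `<=` U by move=> y /bx/eU.
have : (((`|u x| / 2) ^+ 2)%:E * lam n (box x e) <= \int[lam n]_(y in U) (u y * u y)%:E)%E.
  rewrite -integral_cst//.
  apply: (@le_trans _ _ (\int[lam n]_(y in box x e) (u y * u y)%:E)%E).
    apply: ge0_le_integral => //.
    - by move=> y _ /=; rewrite lee_fin sqr_ge0.
    - apply/measurable_EFinP; apply: measurable_funM;
        exact: measurable_funS mU bU su.1.
    - move=> y yb; rewrite lee_fin -expr2 -(real_normK (num_real (u y))).
      by apply: lerXn2r; rewrite ?nnegrE ?(ltW m0)//; exact/eu/bx.
  apply: ge0_subset_integral => //.
  - by apply/measurable_EFinP; apply: measurable_funM; exact: su.1.
  - by move=> y _; rewrite lee_fin -expr2 sqr_ge0.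
have fin : (\int[lam n]_(y in U) (u y * u y)%:E = (ip (lam n) U u u)%:E)%E.
  rewrite /ip /Rintegral fineK//.
  exact: (integrable_fin_num mU (sqintM mU su su)).
rewrite fin u0 lebesgue_box// -EFinM lee_fin leNgt.
suff -> : 0 < (`|u x| / 2) ^+ 2 * (2 * e) ^+ n by [].
by apply: mulr_gt0; apply: exprn_gt0 => //; exact: mulr_gt0.
Qed.

End continuous_sqr_integral.

Lemma open_cuboid (R : realType) (n : nat) (a : 'rV[R]_n) : open (cuboid a).
Proof.
rewrite openE => x Kx; apply/nbhs_ballP.
have [e e0 H] : exists2 e, 0 < e & forall i, - a ord0 i + e < x ord0 i < a ord0 i - e.
  pose m i := Num.min (a ord0 i - x ord0 i) (x ord0 i + a ord0 i) / 2.
  have m0 i : 0 < m i.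
    by rewrite /m divr_gt0// lt_min; have /andP[? ?] := Kx i; apply/andP; split; lra.
  exists (\big[Num.min/1]_i m i).
    by rewrite lt_bigmin// => i _; exact: m0.
  move=> i; have le : \big[Num.min/1]_i m i <= m i by exact: bigmin_le_cond.
  have h1 : m i <= (a ord0 i - x ord0 i) / 2 by rewrite ler_pM2r ?invr_gt0// ge_min lexx.
  have h2 : m i <= (x ord0 i + a ord0 i) / 2 by rewrite ler_pM2r ?invr_gt0// ge_min lexx orbT.
  by have /andP[? ?] := Kx i; apply/andP; split; lra.
exists e => //= y [_ xy] i; have := xy ord0 i; rewrite /ball/= ltr_norml.
by have /andP[? ?] := H i; move=> /andP[? ?]; apply/andP; split; lra.
Qed.

Lemma cvg_fin_sum (R : realType) (I : Type) (r : seq I) (f_ : I -> nat -> R) (l : I -> R) :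
  (forall i, f_ i k @[k --> \oo] --> l i) ->
  \sum_(i <- r) f_ i k @[k --> \oo] --> \sum_(i <- r) l i.
Proof.
move=> fl; elim: r => [|i r IH].
  by under eq_fun do rewrite big_nil; rewrite big_nil; exact: cvg_cst.
by under eq_fun do rewrite big_cons; rewrite big_cons; exact: cvgD.
Qed.

(** * From form inequalities for $C^1$ functions to eigenvalue bounds *)

Section eigenvalue_bound.
Context {R : realType} {n : nat}.
Variable a : 'rV[R]_n.+1.
Hypothesis a0 : forall i, 0 < a ord0 i.
Notation lam := (lebesgue_rV R n.+1).
Notation K := (cuboid a).
Notation S := (surface_measure a).
Implicit Types psi : 'rV[R]_n.+1 -> R.

Let mK := measurable_cuboid a.
Let fK := cuboid_fin a0.

Lemma bmeas_sqint f : bmeas K f -> sqint lam K f.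
Proof.
move=> bf; split; first exact: bf.1.
have /integrableP[_] := bmeas_integrable mK fK (bmeasX2 bf).
by apply: le_lt_trans; rewrite (eq_integral (fun x => `|(f x ^+ 2)%:E|)%E)// => x _;
  rewrite /= ger0_norm ?sqr_ge0.
Qed.

Lemma continuous_sqintS f : continuous f -> sqint S setT f.
Proof.
move=> cf; have mf := continuous_measurable_rV cf; split=> //.
rewrite (EFin_integral_surface a0 (F := fun x => f x ^+ 2)) ?ltry//.
- exact: measurable_funX.
- by move=> x; exact: sqr_ge0.
- have [M PM] := continuous_bounded a cf; exists (M ^+ 2) => x ax.
  by rewrite normrX lerXn2r// ?nnegrE// ?PM// (le_trans _ (PM x ax)).
Qed.

Lemma C1_sqint psi : C1_on setT psi -> sqint lam K psi.
Proof. by move=> C1; apply/bmeas_sqint/continuous_bmeas/C1_continuous. Qed.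

Lemma C1_sqint_partial psi i : C1_on setT psi -> sqint lam K (partial i psi).
Proof.
by move=> C1; apply/bmeas_sqint/continuous_bmeas/(@C1_continuous_partial _ _ _ i C1).
Qed.

Lemma partialDcst psi i c : partial i (fun x => psi x + c) = partial i psi.
Proof.
apply/funext => x; rewrite /partial /derive.
suff -> : (fun h : R => h^-1 *: (((fun x => psi x + c) \o shift x) (h *: delta_mx ord0 i) -
    (psi x + c))) = (fun h : R => h^-1 *: ((psi \o shift x) (h *: delta_mx ord0 i) - psi x)).
  by [].
by apply/funext => h; congr (_ *: _) => /=; ring.
Qed.

Lemma C1_Dcst psi c : C1_on setT psi -> C1_on setT (fun x => psi x + c).
Proof.
move=> C1 x _; have [cx px] := C1 x I; split.
  by apply: continuousD => //; exact: cst_continuous.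
move=> i; rewrite partialDcst; have [dx cpx] := px i; split=> //.
by apply: derivableD => //; exact: derivable_cst.
Qed.

Lemma partial_cst i (c : R) : partial i (cst c : 'rV[R]_n.+1 -> R) = cst 0.
Proof. by apply/funext => x; rewrite /partial derive_cst. Qed.

Lemma C1_cst (c : R) : C1_on setT (cst c : 'rV[R]_n.+1 -> R).
Proof.
move=> x _; split; first exact: cst_continuous.
by move=> i; rewrite partial_cst; split; [exact: derivable_cst|exact: cst_continuous].
Qed.

Variables (s : R) (u t h : 'rV[R]_n.+1 -> R).
Hypotheses (s0 : s != 0) (uharm : harmonic_on K u)
  (utrace : H1_trace K S u (fun i => partial i u) t)
  (uh : normal_derivative K S u h) (hst : {ae S, forall x, h x = s * t x}).

Let su : sqint lam K u. Proof. by case: utrace. Qed.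
Let sdu i : sqint lam K (partial i u).
Proof. by case: utrace => _ /(_ i). Qed.
Let st : sqint S setT t. Proof. by case: utrace. Qed.

(** Green's formula with [h] replaced by [s * t], equal to it almost everywhere on the boundary.
    Constants as test functions give the mean of [t]; the approximants of [u] give its Dirichlet
    energy. *)
Let green psi : C1_on setT psi ->
  \sum_(i < n.+1) ip lam K (partial i u) (partial i psi) = s * ip S setT t psi.
Proof.
move=> C1; have [sh /(_ _ C1)] := uh.
have sp i := C1_sqint_partial i C1.
have sS := continuous_sqintS (C1_continuous C1).
have -> : \int[S]_x (h x * psi x) = s * ip S setT t psi.
  rewrite -(ipZl measurableT)// /ip /Rintegral; congr fine.
  apply: ae_eq_integral => //.
  - by apply/measurable_EFinP; apply: measurable_funM; [exact: sh.1|exact: sS.1].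
  - apply/measurable_EFinP; apply: measurable_funM; last exact: sS.1.
    by apply: measurable_funM => //; exact: st.1.
  - by apply: filterS hst => x hx _; rewrite hx.
move=> <-; rewrite /Rintegral.
rewrite (eq_integral (fun x =>
  \sum_(i < n.+1) (partial i u x * partial i psi x)%:E)%E); last first.
  by move=> x _; rewrite sumEFin.
rewrite integral_sum//; last by move=> i; exact: sqintM.
rewrite (eq_bigr (fun i => (ip lam K (partial i u) (partial i psi))%:E)).
  by rewrite sumEFin.
move=> i _; rewrite /ip /Rintegral fineK//.
exact: (integrable_fin_num mK (sqintM mK (sdu i) (sp i))).
Qed.

Let t_mean : ip S setT t (cst 1) = 0.
Proof.
have := green (C1_cst 1); rewrite big1 => [/esym/eqP|i _].
  by rewrite mulf_eq0 (negPf s0) => /eqP.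
rewrite partial_cst /ip; under eq_Rintegral do rewrite mulr0.
by rewrite Rintegral_cst// mul0r.
Qed.

(** The form inequality is applied to the approximants shifted by [c] and passed to the limit. The
    shift leaves gradients alone and, [t] having mean zero, raises the squared boundary norm by
    exactly $c^2$ times the total boundary volume. *)
Lemma eigen_inequality (sg d C : R) (Phi : 'rV[R]_n.+1 -> R) (c : R) :
  sqint lam K Phi ->
  (forall psi, C1_on setT psi ->
    d * dot a psi psi - C * dot a psi Phi ^+ 2 <=
    energy a psi - sg * \int[S]_x (psi x ^+ 2)) ->
  d * ip lam K (fun x => u x + c) (fun x => u x + c) -
    C * ip lam K (fun x => u x + c) Phi ^+ 2 <=
  (s - sg) * ip S setT t t - sg * (c ^+ 2 * fine (S setT)).
Proof.
move=> sPhi H; have [_ _ _ [phi [phiC phiu phidu phit]]] := utrace.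
have s1 : sqint S setT (cst 1) by apply: continuous_sqintS; exact: cst_continuous.
have sc : sqint lam K (cst c) by apply: C1_sqint; exact: C1_cst.
have scS : sqint S setT (cst c) by apply: continuous_sqintS; exact: cst_continuous.
have suc : sqint lam K (fun x => u x + c) by exact: sqintD su sc.
have stc : sqint S setT (fun x => t x + c) by exact: sqintD st scS.
have sp k : sqint lam K (phi k) by exact: C1_sqint.
have sdp k i : sqint lam K (partial i (phi k)) by exact: C1_sqint_partial.
have spS k : sqint S setT (phi k) by apply: continuous_sqintS; exact: C1_continuous.
have spc k : sqint lam K (fun x => phi k x + c) by exact: sqintD (sp k) sc.
have spSc k : sqint S setT (fun x => phi k x + c) by exact: sqintD (spS k) scS.
have cu : sqcvg lam K (fun k x => phi k x + c) (fun x => u x + c) by exact: sqcvgDcst.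
have ct : sqcvg S setT (fun k x => phi k x + c) (fun x => t x + c) by exact: sqcvgDcst.
have E1 : energy a (phi k) @[k --> \oo] -->
    \sum_(i < n.+1) ip lam K (partial i u) (partial i u).
  rewrite (_ : (fun k => _) = fun k => \sum_(i < n.+1)
      ip lam K (partial i (phi k)) (partial i (phi k))); last first.
    by apply/funext => k; apply: eq_bigr => i _; apply: eq_Rintegral => x _; rewrite expr2.
  by apply: cvg_fin_sum => i; apply: sqcvg_ip => //; exact: phidu.
(* [u] itself is not an admissible test function; Green's formula tested with the approximants
   converges to both sides. *)
have E2 : \sum_(i < n.+1) ip lam K (partial i u) (partial i u) = s * ip S setT t t.
  have A1 : \sum_(i < n.+1) ip lam K (partial i u) (partial i (phi k)) @[k --> \oo] -->
      \sum_(i < n.+1) ip lam K (partial i u) (partial i u).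
    apply: cvg_fin_sum => i; apply: (sqcvg_ip mK (f_ := fun=> partial i u)) => //.
      exact: sqcvg_cst.
    exact: phidu.
  have A2 : \sum_(i < n.+1) ip lam K (partial i u) (partial i (phi k)) @[k --> \oo] -->
      s * ip S setT t t.
    under eq_fun do rewrite green//.
    apply: cvgM; first exact: cvg_cst.
    by apply: (sqcvg_ip _ (f_ := fun=> t)) => //; exact: sqcvg_cst.
  exact: (cvg_unique _ A1 A2).
have L1 : d * ip lam K (fun x => phi k x + c) (fun x => phi k x + c) -
    C * ip lam K (fun x => phi k x + c) Phi ^+ 2 @[k --> \oo] -->
    d * ip lam K (fun x => u x + c) (fun x => u x + c) -
    C * ip lam K (fun x => u x + c) Phi ^+ 2.
  have c1 := sqcvg_ip mK spc spc suc suc cu cu.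
  have c2 := sqcvg_ip mK spc (fun=> sPhi) suc sPhi cu (sqcvg_cst _ _ _).
  apply: cvgB; first by apply: cvgM => //; exact: cvg_cst.
  by apply: cvgM; [exact: cvg_cst|rewrite expr2; apply: cvgM].
have L2 : energy a (phi k) - sg * ip S setT (fun x => phi k x + c) (fun x => phi k x + c)
    @[k --> \oo] -->
    s * ip S setT t t - sg * ip S setT (fun x => t x + c) (fun x => t x + c).
  rewrite -E2; apply: cvgB => //; apply: cvgM; first exact: cvg_cst.
  exact: sqcvg_ip.
have E3 : ip S setT (fun x => t x + c) (fun x => t x + c) =
    ip S setT t t + c ^+ 2 * fine (S setT).
  rewrite (ipDl measurableT st scS stc) !(ipC _ _ _ (fun x => t x + c)).
  rewrite !(ipDl measurableT st scS)//.
  have -> : ip S setT t (cst c) = 0.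
    rewrite ipC (_ : cst c = fun x => c * cst 1 x); last by apply/funext => x; rewrite /= mulr1.
    by rewrite ipZl// ipC t_mean mulr0.
  rewrite (ipC _ _ (cst c) t) (_ : ip S setT t (cst c) = 0); last first.
    rewrite ipC (_ : cst c = fun x => c * cst 1 x); last by apply/funext => x; rewrite /= mulr1.
    by rewrite ipZl// ipC t_mean mulr0.
  by rewrite /ip /= Rintegral_cst// addr0 add0r expr2.
rewrite (_ : (s - sg) * _ - _ = s * ip S setT t t -
  sg * ip S setT (fun x => t x + c) (fun x => t x + c)); last by rewrite E3; ring.
apply: (ler_cvg_to L1 L2); apply: nearW => k.
have := H _ (C1_Dcst c (phiC k)).
have -> : energy a (fun x => phi k x + c) = energy a (phi k).
  by apply: eq_bigr => i _; rewrite partialDcst.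
by rewrite (_ : \int[S]_x _ = ip S setT (fun x => phi k x + c) (fun x => phi k x + c))//;
  apply: eq_Rintegral => x _; rewrite expr2.
Qed.

Lemma eigen_neq0 : (exists2 x, K x & u x != 0) -> 0 < ip lam K u u.
Proof.
move=> [x Kx ux]; rewrite lt_def ip_ge0 andbT; apply: contraNneq ux => u0.
apply/eqP; apply: (integral_sqr_eq0 (@open_cuboid R _ a) _ su u0) => // y Ky.
by have [[/(_ y Ky)[]]] := uharm.
Qed.

End eigenvalue_bound.

Lemma continuous_prod_coord (R : realType) (n : nat) (I : Type) (r : seq I) (P : pred I)
    (k : I -> 'I_n) (f : I -> R -> R) :
  (forall i, continuous (f i)) ->
  continuous (fun x : 'rV[R]_n => \prod_(i <- r | P i) f i (x ord0 (k i))).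
Proof.
move=> cf; elim: r => [|i r IH] x.
  by under eq_fun do rewrite big_nil; exact: cst_continuous.
under eq_fun do rewrite big_cons; case: (P i) => //; last exact: IH.
apply: continuousM; last exact: IH.
apply: (@continuous_comp _ _ _ (fun x : 'rV[R]_n => x ord0 (k i)) (f i)).
  exact: coord_continuous.
exact: cf.
Qed.

Section steklov_bounds.
Context {R : realType} {n : nat}.
Variable a : 'rV[R]_n.+1.
Hypothesis a0 : forall i, 0 < a ord0 i.
Notation lam := (lebesgue_rV R n.+1).
Notation K := (cuboid a).
Notation S := (surface_measure a).

(** With the Friedrichs constants, an eigenvalue $s<-C$ would give $d\|u\|^2\le(s+C)\|t\|^2\le0$. *)
Lemma steklov_bounded_below : exists B, forall s,
  steklov_eigenvalue K S s -> s != 0 -> B <= s.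
Proof.
have [C [d [d0 H]]] := friedrichs a0.
exists (- C) => s [u [t [h [uharm u0 utr uh hst]]]] s0; rewrite leNgt; apply/negP => sC.
have su := eigen_neq0 uharm utr u0.
have sPhi : sqint lam K (cst 0) by apply: (C1_sqint a0); exact: C1_cst.
have := @eigen_inequality _ _ _ a0 s u t h s0 utr uh hst (- C) d 0 (cst 0) 0 sPhi.
rewrite !mul0r !subr0 expr0n mul0r mulr0 subr0 => /(_ _)/wrap[].
  by move=> psi C1; rewrite !mul0r subr0 mulNr opprK; exact: H.
rewrite (_ : (fun x => u x + 0) = u); last by apply/funext => x; rewrite addr0.
have : (s - - C) * ip S setT t t <= 0 by rewrite mulr_le0_ge0 ?ip_ge0// opprK; lra.
have : 0 < d * ip lam K u u by rewrite mulr_gt0.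
lra.
Qed.

Variables (b al be : R).
Hypotheses (ab : forall i, a ord0 i = b) (al0 : 0 < al) (alb : al * b < pi)
  (be0 : 0 < be) (albe : n%:R * be ^+ 2 < al ^+ 2).
Let sg := be * sinhR (be * b) / coshR (be * b).
Hypothesis sg_lt : sg * sin (al * b) < al * cos (al * b).

Lemma steklov_cube_ge s : steklov_eigenvalue K S s -> s != 0 -> sg <= s.
Proof.
move=> [u [t [h [uharm u0 utr uh hst]]]] s0; rewrite leNgt; apply/negP => ssg.
have su := eigen_neq0 uharm utr u0.
have b0 : 0 < b by rewrite -(ab ord0).
have sg0 : 0 < sg.
  by rewrite /sg divr_gt0 ?coshR_gt0// mulr_gt0// sinhR_gt0 ?mulr_gt0.
have cosh1 x : 1 <= coshR x :> R.
  have := cosh2Bsinh2 x; have := coshR_gt0 x; have := sqr_ge0 (sinhR x); nra.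
have Phi1 x : 1 <= prod_cosh be x :> R.
  rewrite /prod_cosh; elim/big_ind : _ => // p q p1 q1.
  by rewrite (le_trans p1)// ler_peMr// (le_trans _ p1).
have cPhi : continuous (prod_cosh be : 'rV[R]_n.+1 -> R).
  apply: (@continuous_prod_coord R n.+1 _ (index_enum 'I_n.+1) xpredT id
    (fun i z => coshR (be * z))) => i.
  exact: continuous_derive (fun x => is_derive_comp_lin (is_derive_coshR (be * x))).
have bPhi := continuous_bmeas a cPhi; have sPhi := bmeas_sqint a0 bPhi.
have s1 : sqint lam K (cst 1) by apply: (C1_sqint a0); exact: C1_cst.
have mK := measurable_cuboid a.
have vK : 0 < fine (lam K).
  by rewrite lebesgue_cuboid//= prodr_gt0// => i _; rewrite mulr_gt0.
have v0 : 0 < ip lam K (cst 1) (prod_cosh be).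
  apply: lt_le_trans vK _; rewrite -[leLHS]mul1r -Rintegral_cst//.
  apply: (le_Rint mK (cuboid_fin a0)) => //; first exact: bmeas_cst.
    by apply: bmeasM => //; exact: bmeas_cst.
  by move=> x _; rewrite mul1r.
(* Makes [u + c] orthogonal to the product ground state, which is at least 1 everywhere and so pairs
   positively with constants. *)
pose c := - ip lam K u (prod_cosh be) / ip lam K (cst 1) (prod_cosh be).
have su' : sqint lam K u by case: utr.
have Z : ip lam K (fun x => u x + c) (prod_cosh be) = 0.
  have sc : sqint lam K (fun x => c * cst 1 x) by exact: sqintZ.
  rewrite (_ : (fun x => u x + c) = (fun x => u x + c * cst 1 x)); last first.
    by apply/funext => x; rewrite mulr1.
  by rewrite ipDl// ipZl// /c divfK ?subrr// lt0r_neq0.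
have := @eigen_inequality _ _ _ a0 s u t h s0 utr uh hst sg _ _ (prod_cosh be) c sPhi
  (coercivity a0 ab al0 alb sg_lt).
rewrite Z expr0n mulr0 subr0 => H.
have Sp : 0 < fine (S setT).
  rewrite surface_measureT//= mulr_gt0// big_ord_recl ltr_pwDl//.
    by rewrite prodr_gt0// => i _; rewrite mulr_gt0.
  by rewrite sumr_ge0// => i _; rewrite prodr_ge0// => j _; rewrite mulr_ge0// ltW.
have T0 : (s - sg) * ip S setT t t <= 0 by rewrite mulr_le0_ge0 ?ip_ge0// subr_le0 ltW.
have D0 : 0 <= (al ^+ 2 - n%:R * be ^+ 2) * ip lam K (fun x => u x + c) (fun x => u x + c).
  by rewrite mulr_ge0 ?ip_ge0// subr_ge0 ltW.
(* The shifted function might vanish identically, so its norm alone gives no contradiction; the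
   boundary term in $c^2$ excludes this by forcing $c=0$, and then the norm of [u] itself must
   vanish. *)
have c0 : c = 0.
  apply/eqP; rewrite -sqrf_eq0 eq_le sqr_ge0 andbT leNgt; apply/negP => c0.
  have P : 0 < sg * (c ^+ 2 * fine (S setT)).
    by apply: mulr_gt0 => //; exact: mulr_gt0.
  have := le_trans D0 H; rewrite subr_ge0 => Q.
  by have := lt_le_trans P (le_trans Q T0); rewrite ltxx.
move: H; rewrite c0 (_ : (fun x => u x + 0) = u); last by apply/funext => x; rewrite addr0.
rewrite expr0n mul0r mulr0 subr0 => H.
have P : 0 < (al ^+ 2 - n%:R * be ^+ 2) * ip lam K u u by rewrite mulr_gt0// subr_gt0.
by have := lt_le_trans P (le_trans H T0); rewrite ltxx.
Qed.

End steklov_bounds.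

(** * Separated eigenfunctions of a cuboid *)

Section separated_functions.
Context {R : realType} {n : nat}.
Implicit Types (i j : 'I_n.+1) (g f : 'I_n.+1 -> R -> R) (x : 'rV[R]_n.+1).

Definition separated g x : R := \prod_i g i (x ord0 i).

Definition repl g i (k : R -> R) j : R -> R := if j == i then k else g j.

Lemma separated_repl g i k x :
  separated (repl g i k) x = k (x ord0 i) * \prod_(j | j != i) g j (x ord0 j).
Proof.
rewrite /separated (bigD1 i)//= /repl eqxx; congr (_ * _).
by apply: eq_bigr => j /negPf ->.
Qed.

Lemma continuous_separated g : (forall i, continuous (g i)) -> continuous (separated g).
Proof. exact: (@continuous_prod_coord R n.+1 _ (index_enum 'I_n.+1) xpredT id g). Qed.

Lemma separated_derive g i (k : R -> R) x :
  (forall z : R, is_derive z 1 (g i) (k z)) ->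
  is_derive x (delta_mx ord0 i) (separated g) (separated (repl g i k) x).
Proof.
move=> dg; rewrite separated_repl; set P := \prod_(j | j != i) _.
have [dgi <-] := dg (x ord0 i).
have E : (fun h : R => h^-1 *: ((separated g \o shift x) (h *: delta_mx ord0 i) -
      separated g x)) =
    (fun h : R => (h^-1 *: ((g i \o shift (x ord0 i)) (h *: 1) - g i (x ord0 i))) * P).
  apply/funext => h; rewrite /= /separated (bigD1 i)//= [in X in _ - X](bigD1 i)//= -/P.
  rewrite (eq_bigr (fun j => g j (x ord0 j))) => [|j ji]; last first.
    by rewrite !mxE eqxx/= (negPf ji) mulr0 add0r.
  rewrite -/P !mxE !eqxx /= -mulrBl.
  by rewrite [h *: 1]/GRing.scale/= mulr1 /GRing.scale/= mulrA.
have C : (fun h : R => h^-1 *: ((separated g \o shift x) (h *: delta_mx ord0 i) -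
      separated g x)) h @[h --> 0^'] --> 'D_1 (g i) (x ord0 i) * P.
  by rewrite E; apply: cvgMl; exact: dgi.
split; first by apply/cvg_ex; eexists; exact: C.
exact: cvg_lim C.
Qed.

Lemma partial_separated g i (k : R -> R) :
  (forall z : R, is_derive z 1 (g i) (k z)) ->
  partial i (separated g) = separated (repl g i k).
Proof.
move=> dg; apply/funext => x; rewrite /partial.
by have [_ ->] := separated_derive x dg.
Qed.

Lemma separated_C1 D g (g' : 'I_n.+1 -> R -> R) :
  (forall i (z : R), is_derive z 1 (g i) (g' i z)) -> (forall i, continuous (g' i)) ->
  C1_on D (separated g).
Proof.
move=> dg cg' x _.
have cg i : continuous (g i) by exact: continuous_derive (dg i).
split; first exact: continuous_separated.
move=> i; split; first by have [] := separated_derive x (dg i).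
rewrite (partial_separated (dg i)); apply: continuous_separated => j.
by rewrite /repl; case: eqP.
Qed.

End separated_functions.

Section separated_eigenfunction.
Context {R : realType} {n : nat}.
Variable a : 'rV[R]_n.+1.
Hypothesis a0 : forall i, 0 < a ord0 i.
Variables (f f' : 'I_n.+1 -> R -> R) (l : 'I_n.+1 -> R) (s : R).
Hypotheses (df : forall i (z : R), is_derive z 1 (f i) (f' i z))
  (df' : forall i (z : R), is_derive z 1 (f' i) (l i * f i z))
  (fa : forall i, f' i (a ord0 i) = s * f i (a ord0 i))
  (fNa : forall i, f' i (- a ord0 i) = - (s * f i (- a ord0 i)))
  (l0 : \sum_i l i = 0).
Notation lam := (lebesgue_rV R).
Notation leb := (@lebesgue_measure R).
Notation K := (cuboid a).
Notation S := (surface_measure a).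
Notation w := (separated f).

Let cf i : continuous (f i). Proof. exact: continuous_derive (df i). Qed.
Let cf' i : continuous (f' i). Proof. exact: continuous_derive (df' i). Qed.

Let dwi i : 'I_n.+1 -> R -> R := repl f i (f' i).

Let pw i : partial i w = separated (dwi i).
Proof. exact: partial_separated (df i). Qed.

Let wC1 D : C1_on D w. Proof. exact: separated_C1 df cf'. Qed.

Let dwiC1 i D : C1_on D (separated (dwi i)).
Proof.
apply: (@separated_C1 _ _ D _ (repl f' i (fun z => l i * f i z))) => j.
  by move=> z; rewrite /dwi /repl; case: eqP.
rewrite /repl; case: eqP => // _ z.
by apply: continuousM; [exact: cst_continuous|exact: cf].
Qed.

Let ppw i x : partial i (separated (dwi i)) x = l i * w x.
Proof.
have d (z : R) : is_derive z 1 (dwi i i) (l i * f i z) by rewrite /dwi /repl eqxx.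
rewrite (partial_separated d) separated_repl /separated [in RHS](bigD1 i)//= mulrA; congr (_ * _).
by apply: eq_bigr => j ji; rewrite /dwi /repl (negPf ji).
Qed.

Lemma separated_harmonic : harmonic_on K w.
Proof.
split.
  by split; [exact: wC1|move=> i; rewrite pw; exact: dwiC1].
move=> x Kx; under eq_bigr do rewrite pw ppw.
by rewrite -mulr_suml l0 mul0r.
Qed.

Let mM (u v : 'rV[R]_n.+1 -> R) : continuous u -> continuous v ->
  continuous (fun x => u x * v x).
Proof. by move=> cu cv x; apply: continuousM; [exact: cu|exact: cv]. Qed.

(** Integration by parts along the fibres in direction [i] alone. The boundary condition enters face
    by face, while the interior term with [l i] cancels only in the sum over [i]. *)
Let green i phi : C1_on setT phi ->
  \int[lam n.+1]_(x in K) (partial i w x * partial i phi x) =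
  \sum_(t : bool) \int[lam n]_(y in cuboid (col' i a))
    (s * w (face a i t y) * phi (face a i t y)) -
  l i * \int[lam n.+1]_(x in K) (w x * phi x).
Proof.
move=> C1.
have cphi := C1_continuous C1; have cp := @C1_continuous_partial _ _ _ i C1.
have cw : continuous w by exact: continuous_separated.
have cdw : continuous (partial i w) by rewrite pw; exact: C1_continuous (dwiC1 i (D:=setT)).
have mK := measurable_cuboid a; have fK := cuboid_fin a0.
have mK' := measurable_cuboid (col' i a).
have fK' := cuboid_fin (col'_gt0 a0 i).
have c1 := mM cdw cp; have c2 := mM cw cphi.
have m1 := continuous_measurable_rV c1; have m2 := continuous_measurable_rV c2.
rewrite (fubini_cuboid a0 i m1 (continuous_bmeas a c1)).
rewrite (fubini_cuboid a0 i m2 (continuous_bmeas a c2)).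
have cswp : continuous (fun x => s * w x * phi x).
  by apply: mM => //; apply: mM => //; exact: cst_continuous.
have bf t := bmeas_face a0 i t cswp.
have b2 := bmeas_Rint_insert a0 i m2 (continuous_bmeas a c2).
rewrite (face_sum i) -(RintD mK' fK' (bf false) (bf true)) -(RintZ mK' fK' (l i) b2).
rewrite -(RintB mK' fK' (bmeasD (bf false) (bf true)) (bmeasZ (l i) b2)).
apply: eq_Rintegral => y _; rewrite !faceE.
have ins u : continuous u -> continuous (fun c => u (insert_coord i c y : 'rV[R]_n.+1) : R).
  by move=> cu c; apply: (continuous_comp (@continuous_insert_coord R n i y c)); exact: cu.
have cs u p q : continuous u -> cont_seg p q (fun c => u (insert_coord i c y : 'rV[R]_n.+1) : R).
  by move=> cu; apply: cont_segT; exact: ins.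
have aa : - a ord0 i < a ord0 i by have := a0 i; lra.
have := @FTC_seg R (- a ord0 i) (a ord0 i)
  (fun c => partial i w (insert_coord i c y) * phi (insert_coord i c y))
  (fun c => partial i w (insert_coord i c y) * partial i phi (insert_coord i c y) +
     l i * (w (insert_coord i c y) * phi (insert_coord i c y))) aa.
have cl : cont_seg (- a ord0 i) (a ord0 i)
    (fun c => l i * (w (insert_coord i c y) * phi (insert_coord i c y))).
  by apply: cont_segM; [exact: cont_seg_cst|exact: (cs _ _ _ c2)].
rewrite Rint_segD ?Rint_segZ//; [|exact: (cs _ _ _ c2)|exact: (cs _ _ _ c1)].
rewrite -!Rint_open; [|exact: (cs _ _ _ c2)|exact: (cs _ _ _ c1)].
rewrite -/(side a i) => H.
have {H} : \int[leb]_(c in side a i) (partial i w (insert_coord i c y) *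
      partial i phi (insert_coord i c y)) +
    l i * \int[leb]_(c in side a i) (w (insert_coord i c y) * phi (insert_coord i c y)) =
    partial i w (insert_coord i (a ord0 i) y) * phi (insert_coord i (a ord0 i) y) -
    partial i w (insert_coord i (- a ord0 i) y) * phi (insert_coord i (- a ord0 i) y).
  apply: H; last first.
    by apply: cont_segD => //; exact: (cs _ _ _ c1).
  move=> c _.
  have d1 := @is_derive_insert_coord R n phi i y c ((C1 (insert_coord i c y) I).2 i).1.
  have d2 := @is_derive_insert_coord R n (separated (dwi i)) i y c
    ((dwiC1 i (D:=setT) (x:=insert_coord i c y) I).2 i).1.
  rewrite ppw in d2; rewrite pw.
  by apply: is_derive_eq; rewrite /GRing.scale/=; ring.
move/(canRL (addrK _)) => ->; congr (_ - _).
have E c : partial i w (insert_coord i c y) = f' i c * \prod_(j | j != i) f j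
    (insert_coord i c y ord0 j).
  by rewrite pw separated_repl insert_coord_at.
have E' c : w (insert_coord i c y) = f i c * \prod_(j | j != i) f j
    (insert_coord i c y ord0 j).
  by rewrite /separated (bigD1 i)//= insert_coord_at.
by rewrite !E !E' fa fNa; ring.
Qed.

(** The product is $C^1$ on the whole space, so it serves as its own approximating sequence and its
    own trace, with [s * w] as normal derivative. *)
Lemma separated_steklov : (exists2 x, K x & w x != 0) -> steklov_eigenvalue K S s.
Proof.
move=> w0; exists w, w, (fun x => s * w x).
have cw : continuous w by exact: continuous_separated.
have csw : continuous (fun x => s * w x) by apply: mM => //; exact: cst_continuous.
have wT : C1_on setT w by exact: wC1.
split.
- exact: separated_harmonic.
- exact: w0.
- split.
  + exact: C1_sqint.
  + by move=> i; exact: C1_sqint_partial.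
  + exact: continuous_sqintS.
  + exists (fun=> w); split.
    * by [].
    * exact: sqcvg_cst.
    * by move=> i; exact: sqcvg_cst.
    * exact: sqcvg_cst.
- split; first exact: continuous_sqintS.
  move=> phi C1; have cphi := C1_continuous C1.
  have cswp : continuous (fun x => s * w x * phi x) by exact: mM.
  rewrite (integral_surface a0 (F := fun x => s * w x * phi x)); last 2 first.
  + exact: continuous_measurable_rV.
  + exact: continuous_bounded.
  rewrite (Rint_sum (measurable_cuboid a) (cuboid_fin a0)); last first.
    move=> i; apply: continuous_bmeas; apply: mM.
      by apply: C1_continuous_partial.
    exact: C1_continuous_partial.
  under eq_bigr do rewrite green//.
  by rewrite sumrB -mulr_suml l0 mul0r subr0.
- by apply: aeW.
Qed.

End separated_eigenfunction.

(** * The transcendental eigenvalue equations and their roots *)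

Section monotone_by_derivative.
Context {R : realType}.

Lemma derive_ltr (p q : R) (F F' : R -> R) : p < q ->
  (forall x : R, x \in `[p, q] -> is_derive x 1 F (F' x)) ->
  (forall x, x \in `]p, q[ -> 0 < F' x) -> F p < F q.
Proof.
move=> pq dF F'0.
have cF : cont_seg p q F by exact: derive_cont_seg dF.
have wF := cont_seg_within cF.
have dF' (x : R) : x \in `]p, q[ -> is_derive x 1 F (F' x).
  by move=> xpq; apply: dF; exact: subset_itv_oo_cc xpq.
have [c cpq E] := MVT pq dF' wF.
by rewrite -subr_gt0 E mulr_gt0 ?F'0// subr_gt0.
Qed.

Lemma sin_lt_id (x : R) : 0 < x -> x < pi / 2 -> sin x < x.
Proof.
move=> x0 xpi; rewrite -subr_gt0.
have -> : 0 = 0 - sin 0 :> R by rewrite sin0 subr0.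
apply: (@derive_ltr 0 x (fun z => z - sin z) (fun z => 1 - cos z)) => //.
move=> z; rewrite in_itv/= => /andP[z0 zx].
by rewrite subr_gt0 -cos0 ltr_cos// in_itv/= ?lexx ?pi_ge0// (ltW z0)/=; have := pi_ge0 R; lra.
Qed.

Lemma xcos_lt_sin (x : R) : 0 < x -> x < pi / 2 -> x * cos x < sin x.
Proof.
move=> x0 xpi; rewrite -subr_gt0.
have -> : 0 = sin 0 - 0 * cos 0 :> R by rewrite sin0 mul0r subr0.
apply: (@derive_ltr 0 x (fun z => sin z - z * cos z) (fun z => z * sin z)) => //.
  by move=> z _ /=; apply: is_derive_eq; rewrite /GRing.scale/=; ring.
move=> z; rewrite in_itv/= => /andP[z0 zx].
by rewrite mulr_gt0// sin_gt0_pihalf// z0 (lt_trans zx).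
Qed.

(** $x\cot x$ decreases, with denominators cleared. By the subtraction formula the claim reads
    $(y-x)\cos y\,\sin x<x\sin(y-x)$, the product of $\sin x<x$ and $(y-x)\cos
    y<(y-x)\cos(y-x)<\sin(y-x)$. *)
Lemma xcot_decr (x y : R) : 0 < x -> x < y -> y < pi / 2 ->
  y * cos y * sin x < x * cos x * sin y.
Proof.
move=> x0 xy ypi; have pi0 := pi_ge0 R.
have d0 : 0 < y - x by rewrite subr_gt0.
have dpi : y - x < pi / 2 by lra.
have cy : 0 < cos y by apply: cos_gt0_pihalf; apply/andP; split; lra.
have cyd : cos y < cos (y - x).
  by rewrite ltr_cos// ?in_itv/=; [lra|apply/andP; split; lra..].
have h1 := xcos_lt_sin d0 dpi.
have h2 : sin x < x by apply: sin_lt_id => //; lra.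
have h3 : (y - x) * cos y < sin (y - x).
  by apply: lt_trans h1; rewrite ltr_pM2l.
have sx : 0 < sin x by apply: sin_gt0_pihalf; apply/andP; split; lra.
have dc : 0 < (y - x) * cos y by rewrite mulr_gt0.
have : (y - x) * cos y * sin x < sin (y - x) * x.
  by apply: ltr_pM => //; exact: ltW.
rewrite sinB; lra.
Qed.

End monotone_by_derivative.

Section robin_cosh.
Context {R : realType}.
Implicit Types (x y b s : R).

Lemma sinhRB x y : sinhR (y - x) = sinhR y * coshR x - coshR y * sinhR x.
Proof.
rewrite /sinhR /coshR opprB !expRD !expRN.
have := lt0r_neq0 (expR_gt0 x); have := lt0r_neq0 (expR_gt0 y) => ? ?.
by field; apply/andP.
Qed.

Definition tanhR x : R := sinhR x / coshR x.

Lemma tanhR_ltr x y : x < y -> tanhR x < tanhR y.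
Proof.
move=> xy; rewrite /tanhR ltr_pdivrMr ?coshR_gt0// mulrAC ltr_pdivlMr ?coshR_gt0//.
have : 0 < sinhR (y - x) by rewrite sinhR_gt0 ?subr_gt0.
by rewrite sinhRB; lra.
Qed.

Lemma tanhR_gt0 x : 0 < x -> 0 < tanhR x.
Proof. by move=> x0; rewrite divr_gt0 ?coshR_gt0 ?sinhR_gt0. Qed.

Lemma tanhR_lt1 x : tanhR x < 1.
Proof. by rewrite ltr_pdivrMr ?coshR_gt0// mul1r sinhR_lt_coshR. Qed.

Lemma tanhR_ge_half x : 1 <= x -> 1 / 2 <= tanhR x.
Proof.
move=> x1; rewrite /tanhR ler_pdivlMr ?coshR_gt0// /sinhR /coshR.
have : 1 + 1 <= expR x by apply: le_trans (expR_ge1Dx x); lra.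
have := expR_gt0 x; have : expR x * expR (- x) = 1 by rewrite -expRD subrr expR0.
move: (expR x) (expR (- x)) => X Y XY X0 X2; nra.
Qed.

Lemma continuous_tanhR : continuous tanhR.
Proof.
move=> x; apply: (@continuousM _ _ sinhR (fun y => (coshR y)^-1)).
  exact: continuous_sinhR.
by apply: continuousV; [exact/lt0r_neq0/coshR_gt0|exact: continuous_coshR].
Qed.

(* Equals [be tanh (be b)] on [be >= 0]; the identity on the negative axis makes
   it a homeomorphism of the whole line. *)
Definition robin b (be : R) := if be <= 0 then be else be * tanhR (be * b).

Lemma robinE b be : 0 < be -> robin b be = be * tanhR (be * b).
Proof. by rewrite /robin leNgt => ->. Qed.

Lemma robin_gt0 b be : 0 < b -> 0 < be -> 0 < robin b be.
Proof. by move=> b0 be0; rewrite robinE// mulr_gt0// tanhR_gt0// mulr_gt0. Qed.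

Lemma robin_lt b be : 0 < be -> robin b be < be.
Proof. by move=> be0; rewrite robinE// gtr_pMr// tanhR_lt1. Qed.

Lemma robin_ltr b x y : 0 < b -> x < y -> robin b x < robin b y.
Proof.
move=> b0 xy; have [y0|y0] := leP y 0.
  by rewrite /robin y0 ifT// (le_trans (ltW xy)).
have [x0|x0] := leP x 0.
  by rewrite {1}/robin x0 (le_lt_trans x0)// robin_gt0.
rewrite !robinE//; apply: ltr_pM => //; first exact/ltW.
  by apply/ltW/tanhR_gt0; rewrite mulr_gt0.
by apply: tanhR_ltr; rewrite ltr_pM2r.
Qed.

Lemma robin_surj b s : 0 < b -> exists be, robin b be = s.
Proof.
move=> b0; have [s0|s0] := leP s 0; first by exists s; rewrite /robin s0.
pose g be := be * tanhR (be * b).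
have cg : continuous g.
  move=> z; apply: (@continuousM _ _ id (fun be => tanhR (be * b))); first exact: cvg_id.
  have cl : continuous (fun y : R => y * b).
    by move=> y; apply: continuousM; [exact: cvg_id|exact: cst_continuous].
  by apply: (continuous_comp (cl z)); exact: continuous_tanhR.
(* Here $Mb\ge1$ makes the hyperbolic tangent at least $1/2$, and $M\ge2s$, so the value at [M]
   reaches [s]. *)
pose M := b^-1 + 2 * s.
have M0 : 0 < M by rewrite addr_gt0 ?invr_gt0// mulr_gt0.
have gM : s <= g M.
  have : 1 / 2 <= tanhR (M * b).
    by apply: tanhR_ge_half; rewrite mulrDl mulVf ?lt0r_neq0// lerDl ?mulr_ge0 ?mulr_ge0// ltW.
  have bi : 0 < b^-1 by rewrite invr_gt0.
  have sM : 2 * s <= M by rewrite /M lerDr ltW.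
  by rewrite /g; move: (tanhR _) => t t2; nra.
have [||c] := @IVT R g 0 M s (ltW M0).
- exact: continuous_subspaceT.
- by rewrite {1 3}/g mul0r ge_min (ltW s0)/= le_max gM orbT.
rewrite in_itv/= => /andP[c0 cM] gc; exists c; rewrite robinE//.
by rewrite lt_def c0 andbT; apply: contraTneq s0 => c00; rewrite -gc /g c00 mul0r ltxx.
Qed.

(** For [0 < b] the map [robin b] is an increasing bijection of the line, so this choice is its
    inverse and the default 0 of [xget] does not intervene; at $s>0$ it is the $\beta>0$ with
    $\beta\tanh(\beta b)=s$. *)
Definition robin_inv b s : R := xget 0 [set be | robin b be = s].

Lemma robin_invK b s : 0 < b -> robin b (robin_inv b s) = s.
Proof.
move=> b0; have [be H] := robin_surj s b0.
by rewrite /robin_inv; apply: (@xgetPex _ 0 [set be | robin b be = s]); exists be.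
Qed.

Lemma robin_inj b x y : 0 < b -> robin b x = robin b y -> x = y.
Proof.
by move=> b0 e; have [/(robin_ltr b0)|/(robin_ltr b0)|//] := ltgtP x y; rewrite e ltxx.
Qed.

Lemma robinK b be : 0 < b -> robin_inv b (robin b be) = be.
Proof. by move=> b0; apply: (robin_inj b0); rewrite robin_invK. Qed.

Lemma robin_inv_ltr b s t : 0 < b -> s < t -> robin_inv b s < robin_inv b t.
Proof.
move=> b0 st; rewrite ltNge; apply/negP; rewrite le_eqVlt => /predU1P[e|/(robin_ltr b0)].
  by move: st; rewrite -(robin_invK s b0) -(robin_invK t b0) e ltxx.
by rewrite !robin_invK// => ts; have := lt_trans st ts; rewrite ltxx.
Qed.

Lemma robin_inv0 b : 0 < b -> robin_inv b 0 = 0.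
Proof. by move=> b0; rewrite -[X in robin_inv b X](_ : robin b 0 = 0) ?robinK// /robin lexx. Qed.

Lemma robin_inv_gt0 b s : 0 < b -> 0 < s -> 0 < robin_inv b s.
Proof. by move=> b0 s0; rewrite -(robin_inv0 b0) robin_inv_ltr. Qed.

Lemma robin_inv_gt b s : 0 < b -> 0 < s -> s < robin_inv b s.
Proof.
by move=> b0 s0; rewrite -{1}(robin_invK s b0) robin_lt// robin_inv_gt0.
Qed.

(** An increasing function mapping a segment onto a segment is continuous. As [robin b] is a
    bijection of the whole line, this covers every point, in particular $s=0$, an end value in the
    search for the root. *)
Lemma continuous_robin_inv b : 0 < b -> continuous (robin_inv b).
Proof.
move=> b0 s; pose p := s - 1; pose q := s + 1.
have pq : p < q by rewrite /p /q; lra.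
apply: (@within_continuous_continuous _ _ _ p q) => //; last first.
  by rewrite in_itv/= /p /q; apply/andP; split; lra.
apply: segment_inc_surj_continuous.
  move=> x y _ _; apply/idP/idP; last first.
    by rewrite le_eqVlt => /predU1P[->//|/(robin_inv_ltr b0)/ltW].
  by rewrite leNgt => h; rewrite leNgt; apply: contra h; exact: robin_inv_ltr.
move=> be /=; rewrite in_itv/= => /andP[pbe beq].
exists (robin b be); last exact: robinK.
have mono u v : u <= v -> robin b u <= robin b v.
  by rewrite le_eqVlt => /predU1P[->//|/(robin_ltr b0)/ltW].
by rewrite /= in_itv/= -{1}(robin_invK p b0) -{1}(robin_invK q b0) !mono.
Qed.

End robin_cosh.

Section steklov_root.
Context {R : realType} {n : nat}.
Variables (a : 'I_n.+1 -> R) (i0 : 'I_n.+1).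
Hypotheses (a0 : forall i, 0 < a i) (n0 : (0 < n)%N).

Definition root_sum s : R := \sum_(j | j != i0) robin_inv (a j) s ^+ 2.

(** With $A=a_{i_0}$, substituting $s=\alpha\cot(\alpha A)$ leaves one equation in $\alpha$, solved
    by intermediate values. At $\alpha A=\pi/4$ one has $s=\alpha$, and a single $\beta_j>s$ already
    exceeds $\alpha$; there is such a [j] because [0 < n]. At $\alpha A=\pi/2$ one has $s=0$ and
    every $\beta_j$ vanishes. *)
Lemma steklov_root : exists s al : R, [/\ 0 < s, 0 < al, al * a i0 < pi / 2,
  al * cos (al * a i0) = s * sin (al * a i0) & root_sum s = al ^+ 2].
Proof.
pose A := a i0; have A0 : 0 < A by exact: a0.
have pi0 : 0 < pi :> R by exact: pi_gt0.
pose q := pi / 2 / A; pose p := q / 2.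
have q0 : 0 < q by rewrite !divr_gt0.
have p0 : 0 < p by rewrite divr_gt0.
have pq : p < q by rewrite /p; lra.
have qA : q * A = pi / 2 by rewrite /q divfK// lt0r_neq0.
have pA : p * A = pi / 4 by rewrite /p mulrAC qA; field.
have sin0 x : x \in `[p, q] -> 0 < sin (x * A).
  rewrite in_itv/= => /andP[px xq]; apply: sin_gt0_pi.
  rewrite mulr_gt0 ?(lt_le_trans p0 px)//=.
  have : x * A <= q * A by rewrite ler_pM2r.
  by rewrite qA; lra.
pose sf (x : R) := x * cos (x * A) / sin (x * A).
have clin : continuous (fun x : R => x * A).
  by move=> x; apply: continuousM; [exact: cvg_id|exact: cst_continuous].
have csf : cont_seg p q sf.
  move=> x px; apply: continuousM.
    apply: continuousM; first exact: cvg_id.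
    by apply: (continuous_comp (clin x)); exact: continuous_cos.
  apply: continuousV; first exact/lt0r_neq0/sin0.
  by apply: (continuous_comp (clin x)); exact: continuous_sin.
have croot : continuous root_sum.
  rewrite /root_sum; elim: (index_enum _) => [|j r IH] z.
    by under eq_fun do rewrite big_nil; exact: cst_continuous.
  under eq_fun do rewrite big_cons; case: (j != i0) => /=; last exact: IH.
  apply: (@continuousD _ _ _ (fun s => robin_inv (a j) s ^+ 2)); last exact: IH.
  by apply: (@continuousM _ _ (robin_inv (a j)) (robin_inv (a j)));
    exact: continuous_robin_inv.
pose L (x : R) := root_sum (sf x) - x ^+ 2.
have cL : cont_seg p q L.
  apply: cont_segB; last by apply/cont_segX2/cont_segT => x; exact: cvg_id.
  by move=> x px; apply: (continuous_comp (csf x px)); exact: croot.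
have cos4 : cos (p * A) = sin (p * A).
  have e : pi / 4 = pi / 2 - pi / 4 :> R by lra.
  by rewrite pA {1}e cosB cos_pihalf sin_pihalf mul0r add0r mul1r.
have Lp : 0 < L p.
  have sp : sf p = p by rewrite /sf cos4 mulfK// lt0r_neq0// sin0// in_itv/= lexx ltW.
  rewrite /L sp subr_gt0 /root_sum.
  have [j ji] : exists j, j != i0.
    have : (1 < #|'I_n.+1|)%N by rewrite card_ord.
    rewrite (cardD1 i0) inE add1n ltnS => /card_gt0P[j].
    by rewrite !inE andbT => ji; exists j.
  rewrite (bigD1 j)//= ltr_wpDr//; first by rewrite sumr_ge0// => k _; exact: sqr_ge0.
  by rewrite ltrXn2r// ?nnegrE ?ltW ?robin_inv_gt0 ?robin_inv_gt.
have Lq : L q < 0.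
  have sq : sf q = 0 by rewrite /sf qA cos_pihalf mulr0 mul0r.
  rewrite /L sq /root_sum big1 ?sub0r ?oppr_lt0 ?exprn_gt0// => j _.
  by rewrite robin_inv0// expr0n.
have wL := cont_seg_within cL.
have L0 : Num.min (L p) (L q) <= 0 <= Num.max (L p) (L q).
  by rewrite ge_min (ltW Lq) orbT le_max (ltW Lp).
have [al] := IVT (ltW pq) wL L0.
rewrite in_itv/= => /andP[pal alq] Lal.
have al0 : 0 < al by exact: lt_le_trans pal.
have alq' : al < q.
  by rewrite lt_neqAle alq andbT; apply: contraTneq Lq => <-; rewrite Lal ltxx.
have alA : al * A < pi / 2 by rewrite -qA ltr_pM2r.
have s0 : 0 < sin (al * A) by apply: sin0; rewrite in_itv/= pal.
have c0 : 0 < cos (al * A).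
  by apply: cos_gt0_pihalf; rewrite alA andbT; have := mulr_gt0 al0 A0; lra.
exists (sf al), al; split => //.
- by rewrite /sf divr_gt0// mulr_gt0.
- by rewrite /sf divfK// lt0r_neq0.
- by apply/eqP; rewrite -subr_eq0; apply/eqP.
Qed.

End steklov_root.

(** * Comparison of the eigenvalue equations *)

Section comparison.
Context {R : realType}.

Lemma sinhR_div_le (x y : R) : 0 < x -> x <= y -> sinhR x / x <= sinhR y / y.
Proof.
move=> x0; rewrite le_eqVlt => /predU1P[->//|xy]; apply/ltW.
have d (z : R) : z \in `[x, y] ->
    is_derive z 1 (fun z => sinhR z / z) ((z * coshR z - sinhR z) / z ^+ 2).
  rewrite in_itv/= => /andP[xz zy]; have z0 : z != 0 by rewrite lt0r_neq0// (lt_le_trans x0).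
  have dV := @is_deriveV R id z 1 1 z0 (is_derive_id z 1).
  have := is_derive_sinhR z => ?.
  by apply: is_derive_eq; rewrite /GRing.scale/=; field.
apply: (derive_ltr xy d) => z; rewrite in_itv/= => /andP[xz zy].
have z0 := lt_trans x0 xz.
rewrite divr_gt0 ?exprn_gt0// subr_gt0 -subr_gt0.
have d0 (w : R) : w \in `[0, z] ->
    is_derive w 1 (fun z => z * coshR z - sinhR z) (w * sinhR w).
  move=> _; have := is_derive_sinhR w; have := is_derive_coshR w => ? ?.
  by apply: is_derive_eq; rewrite /GRing.scale/=; ring.
have := derive_ltr z0 d0; rewrite mul0r sinhR0 subr0; apply.
by move=> w; rewrite in_itv/= => /andP[w0 _]; rewrite mulr_gt0// sinhR_gt0.
Qed.

(** Equals $-2$ times the derivative of $\ln(y\tanh y)$ with respect to $\tanh^{-2}y$, written with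
    positive monotone factors so that its growth can be read off. Along the curve $\beta\tanh(\beta
    x)=\sigma$ with $y=\beta x$, one has $\sigma x=y\tanh y$ and $\beta^2=\sigma^2\tanh^{-2}y$. *)
Definition slope (y : R) : R := tanhR y ^+ 2 + tanhR y * (sinhR y * (sinhR y / y)).

Lemma slope_ltr (x y : R) : 0 < x -> x < y -> slope x < slope y.
Proof.
move=> x0 xy; have y0 := lt_trans x0 xy.
have tx := tanhR_gt0 x0; have txy := tanhR_ltr xy.
have sx := sinhR_gt0 x0; have sxy : sinhR x <= sinhR y.
  by rewrite /sinhR ler_pM2r// lerB// ler_expR; lra.
have q := sinhR_div_le x0 (ltW xy).
have qx : 0 < sinhR x / x by rewrite divr_gt0.
rewrite /slope ltr_leD//; first by rewrite ltrXn2r ?nnegrE ?(ltW tx)// ltW// (lt_trans tx).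
apply: ler_pM; [exact: ltW|by rewrite mulr_ge0// ltW|exact: ltW|].
by apply: ler_pM => //; exact: ltW.
Qed.

(* The half-length [x] on which [be tanh (be x) = sg] is a log-convex function of
   [be ^ 2]; with [y = be x] this is its tangent line inequality. *)
Lemma log_tangent (y0 y : R) : 0 < y0 -> 0 < y ->
  ln y0 + ln (tanhR y0) + slope y0 / 2 * (tanhR y0)^-1 ^+ 2 <=
  ln y + ln (tanhR y) + slope y0 / 2 * (tanhR y)^-1 ^+ 2.
Proof.
move=> y00 y0'.
pose g (z : R) := ln z + ln (tanhR z) + slope y0 / 2 * (tanhR z)^-1 ^+ 2.
(* Its sign is that of [slope z - slope y0], so [g] attains its minimum at [y0]. *)
pose g' (z : R) := coshR z / sinhR z ^+ 3 * (slope z - slope y0).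
have dg (z : R) : 0 < z -> is_derive z 1 g (g' z).
  move=> z0; have c0 := lt0r_neq0 (coshR_gt0 z); have s0 := lt0r_neq0 (sinhR_gt0 z0).
  have t0 := lt0r_neq0 (tanhR_gt0 z0); have zn0 := lt0r_neq0 z0.
  have dcV := @is_deriveV R coshR z _ 1 c0 (is_derive_coshR z).
  have dt : is_derive z 1 tanhR ((coshR z ^+ 2)^-1).
    have := is_derive_sinhR z => ?.
    apply: is_derive_eq; rewrite /GRing.scale/= -[RHS]mul1r -(cosh2Bsinh2 z).
    by field.
  have dtV := @is_deriveV R tanhR z _ 1 t0 dt.
  have dln := is_derive1_ln z0.
  have dlnt := @is_derive1_comp R (@ln R) tanhR z _ _ (is_derive1_ln (tanhR_gt0 z0)) dt.
  apply: is_derive_eq; rewrite /g' /GRing.scale/=.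
  move: (slope y0) => k; rewrite /slope /tanhR.
  by field; rewrite c0 s0 zn0.
have [lt|lt|->//] := ltgtP y0 y.
- have d1 (z : R) : z \in `[y0, y] -> is_derive z 1 g (g' z).
    by rewrite in_itv/= => /andP[h _]; apply: dg; exact: lt_le_trans h.
  apply/ltW/(derive_ltr lt d1) => z; rewrite in_itv/= => /andP[h _]; have z0 := lt_trans y00 h.
  by rewrite mulr_gt0 ?subr_gt0 ?slope_ltr// divr_gt0 ?exprn_gt0 ?coshR_gt0 ?sinhR_gt0.
- have d1 (z : R) : z \in `[y, y0] -> is_derive z 1 (fun z => - g z) (- g' z).
    rewrite in_itv/= => /andP[h _]; have dgz := dg z (lt_le_trans y0' h).
    exact: (@is_deriveN _ _ _ g z 1 _ dgz).
  rewrite -lerN2; apply/ltW/(derive_ltr lt d1) => z; rewrite in_itv/= => /andP[h h'].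
  have z0 := lt_trans y0' h.
  rewrite -mulrN mulr_gt0 ?opprB ?subr_gt0 ?slope_ltr//.
  by rewrite divr_gt0 ?exprn_gt0 ?coshR_gt0 ?sinhR_gt0.
Qed.

End comparison.

Section root_comparison.
Context {R : realType} {n : nat}.
Variables (a : 'I_n.+1 -> R) (i0 : 'I_n.+1) (b : R).
Hypotheses (a0 : forall i, 0 < a i) (b0 : 0 < b) (ba : b <= a i0)
  (prod_lt : \prod_(j | j != i0) a j < b ^+ n).
Variables (s al sg alc : R).
Hypotheses (s0 : 0 < s) (al0 : 0 < al) (alA : al * a i0 < pi / 2)
  (al_eq : al * cos (al * a i0) = s * sin (al * a i0))
  (al_sum : root_sum a i0 s = al ^+ 2).
Hypotheses (sg0 : 0 < sg) (alc0 : 0 < alc) (alcb : alc * b < pi / 2)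
  (alc_eq : alc * cos (alc * b) = sg * sin (alc * b))
  (alc_sum : n%:R * robin_inv b sg ^+ 2 = alc ^+ 2).

(** Otherwise $\alpha a_{i_0}>\alpha_c b$ for $\alpha_c$ = [alc], and since $x\cot x$ decreases, the
    two root equations give $s\,a_{i_0}<\sigma b$ for $\sigma$ = [sg], against $\sigma\le s$ and
    $b\le a_{i_0}$. *)
Let al_le : sg <= s -> al <= alc.
Proof.
move=> sgs; rewrite leNgt; apply/negP => lt.
have x0 : 0 < alc * b by rewrite mulr_gt0.
have xy : alc * b < al * a i0.
  by apply: lt_le_trans (_ : al * b <= _); rewrite ?ltr_pM2r// ler_pM2l.
have := xcot_decr x0 xy alA.
have sx : 0 < sin (alc * b) by apply: sin_gt0_pihalf; rewrite x0.
have sy : 0 < sin (al * a i0) by apply: sin_gt0_pihalf; rewrite (lt_trans x0 xy).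
have -> : al * a i0 * cos (al * a i0) * sin (alc * b) =
    s * a i0 * (sin (al * a i0) * sin (alc * b)).
  transitivity (al * cos (al * a i0) * (a i0 * sin (alc * b))); first by ring.
  by rewrite al_eq; ring.
have -> : alc * b * cos (alc * b) * sin (al * a i0) =
    sg * b * (sin (al * a i0) * sin (alc * b)).
  transitivity (alc * cos (alc * b) * (b * sin (al * a i0))); first by ring.
  by rewrite alc_eq; ring.
rewrite ltr_pM2r ?mulr_gt0// ltNge => /negP; apply.
by rewrite ler_pM// ltW.
Qed.

(** Expresses a half-length and its $\beta^2$, at the fixed level [sg], through the single parameter
    [y] of the tangent inequality. *)
Let half_length (x : R) : 0 < x ->
  let y := robin_inv x sg * x in
  [/\ 0 < y, ln y + ln (tanhR y) = ln sg + ln x &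
      (tanhR y)^-1 ^+ 2 = robin_inv x sg ^+ 2 / sg ^+ 2].
Proof.
move=> x0 y; have be0 := robin_inv_gt0 x0 sg0.
have y0 : 0 < y by rewrite mulr_gt0.
have t0 := tanhR_gt0 y0.
have E : robin_inv x sg * tanhR y = sg by rewrite -robinE// robin_invK.
split=> //.
  rewrite -lnM ?posrE// -lnM ?posrE//; congr ln.
  by rewrite /y mulrAC E.
by rewrite -{2}E; field; rewrite !lt0r_neq0.
Qed.

Let sum_neq (c : R) : \sum_(j | j != i0) c = n%:R * c.
Proof. by rewrite sumr_const cardC1 card_ord mulr_natl. Qed.

Lemma root_lt : s < sg.
Proof.
rewrite ltNge; apply/negP => sgs; have alle := al_le sgs.
have [yb0 lb tb] := half_length b0.
(* The tangent coefficient taken with respect to $\beta^2$ instead of $\tanh^{-2}y$, hence the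
   division by [sg ^+ 2]. *)
pose k := slope (robin_inv b sg * b) / 2 / sg ^+ 2.
have k0 : 0 < k.
  have ty := tanhR_gt0 yb0; have sy := sinhR_gt0 yb0.
  rewrite /k !divr_gt0 ?exprn_gt0// /slope addr_gt0 ?exprn_gt0//.
  by do 2 apply: mulr_gt0 => //; rewrite divr_gt0.
have ineq j : ln b + k * robin_inv b sg ^+ 2 <= ln (a j) + k * robin_inv (a j) sg ^+ 2.
  have [yj0 lj tj] := half_length (a0 j).
  have := log_tangent yb0 yj0; rewrite lb lj tb tj /k.
  set S := slope _; rewrite -!addrA lerD2l.
  have E w : S / 2 * (w / sg ^+ 2) = S / 2 / sg ^+ 2 * w by ring.
  by rewrite !E.
(* Lowering the level from [s] to [sg] lowers each $\beta_j$; at level [s] the sum is [al ^+ 2], at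
   most [alc ^+ 2]. *)
have sum_le : \sum_(j | j != i0) robin_inv (a j) sg ^+ 2 <= n%:R * robin_inv b sg ^+ 2.
  rewrite alc_sum; apply: (@le_trans _ _ (al ^+ 2)); last first.
    by apply: lerXn2r; rewrite ?nnegrE ?(ltW al0) ?(ltW alc0).
  rewrite -al_sum /root_sum; apply: ler_sum => j _.
  have rj := robin_inv_gt0 (a0 j) sg0.
  have rs : robin_inv (a j) sg <= robin_inv (a j) s.
    move: sgs; rewrite le_eqVlt => /predU1P[->//|h].
    exact/ltW/robin_inv_ltr.
  by apply: lerXn2r; rewrite ?nnegrE ?(ltW rj) ?(le_trans (ltW rj) rs).
have ln_sum : \sum_(j | j != i0) ln (a j) = ln (\prod_(j | j != i0) a j).
  suff [] : 0 < \prod_(j | j != i0) a j /\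
    \sum_(j | j != i0) ln (a j) = ln (\prod_(j | j != i0) a j) by [].
  apply: (big_rec2 (fun x y : R => 0 < x /\ y = ln x)) => [|j x y _ [x0 ->]].
    by rewrite ln1.
  by rewrite mulr_gt0// lnM ?posrE.
have P0 : 0 < \prod_(j | j != i0) a j by rewrite prodr_gt0.
have lt : ln (\prod_(j | j != i0) a j) < n%:R * ln b.
  by rewrite mulr_natl -lnXn// ltr_ln ?posrE// exprn_gt0.
have := ler_sum (index_enum _) (fun j (_ : j != i0) => ineq j).
rewrite !big_split/= -!mulr_sumr !sum_neq ln_sum => H.
have := ler_wpM2l (ltW k0) sum_le; lra.
Qed.

End root_comparison.

(** * From the volume constraints to the inequality between eigenvalues *)

Section isoperimetric_constraints.
Context {R : realType} {n : nat}.
Variables (a : 'I_n.+1 -> R) (i0 : 'I_n.+1) (b : R).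
Hypotheses (n0 : (0 < n)%N) (a0 : forall i, 0 < a i) (b0 : 0 < b)
  (amax : forall i, a i <= a i0) (not_cube : ~ (forall i, a i = b)).
Let P i := \prod_(j | j != i) a j.

Let P0 i : 0 < P i. Proof. by rewrite prodr_gt0. Qed.

Let prodE i : \prod_j a j = a i * P i. Proof. by rewrite (bigD1 i). Qed.

Let card_neq i : #|[pred j : 'I_n.+1 | j != i]| = n.
Proof. by rewrite cardC1 card_ord. Qed.

(** Since [a i * P i] does not depend on [i], the longest side has the smallest [P]. If [a i0 < b],
    every [P i] is below [b ^+ n] and the sum is too small; if [b ^+ n <= P i0], every [P i] equals
    [b ^+ n], so all sides agree and the cuboid is the cube. *)
Lemma surface_constraint : \sum_i P i = n.+1%:R * b ^+ n ->
  b <= a i0 /\ P i0 < b ^+ n.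
Proof.
move=> H.
have Pmin i : P i0 <= P i.
  rewrite -(ler_pM2l (a0 i0)) -prodE (prodE i) ler_pM2r//.
have sumc (c : R) : \sum_(i < n.+1) c = n.+1%:R * c.
  by rewrite sumr_const card_ord mulr_natl.
have Plt : a i0 < b -> forall i, P i < b ^+ n.
  move=> lt i; rewrite /P -[in ltRHS](card_neq i) -prodr_const; apply: ltr_prod.
    have /card_gt0P[j] : (0 < #|[pred j : 'I_n.+1 | j != i]|)%N by rewrite card_neq.
    by rewrite inE => ji; apply/hasP; exists j => //; exact: mem_index_enum.
  by move=> j _; rewrite (ltW (a0 j)) (le_lt_trans (amax j)).
split.
  rewrite leNgt; apply/negP => /Plt Pl.
  have : \sum_i P i < \sum_(i < n.+1) b ^+ n.
    by apply: ltr_sum => //; apply/hasP; exists i0 => //; exact: mem_index_enum.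
  by rewrite H sumc ltxx.
rewrite ltNge; apply/negP => ge.
have Pge i : 0 <= P i - b ^+ n by rewrite subr_ge0 (le_trans ge).
have /psumr_eq0P Z : \sum_(i | true) (P i - b ^+ n) = 0 by rewrite sumrB H sumc subrr.
have PE i : P i = b ^+ n by apply/eqP; rewrite -subr_eq0 Z.
have aE i : a i = a i0.
  apply: (mulIf (lt0r_neq0 (P0 i))); rewrite -prodE (prodE i0).
  by rewrite !PE.
apply: not_cube => i; rewrite aE.
have : a i0 ^+ n = b ^+ n.
  rewrite -(PE i0) /P -[in LHS](card_neq i0) -prodr_const.
  by apply: eq_bigr => j _; rewrite aE.
by move/eqP; rewrite eqrXn2 ?ltW// => /eqP.
Qed.

(** The longest half-length is at least [b], or the product would be too small. If [b ^+ n <= P i0],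
    it is also at most [b], so no half-length exceeds [b], and the product then forces all of them
    to equal [b]. *)
Lemma volume_constraint : \prod_i a i = b ^+ n.+1 ->
  b <= a i0 /\ P i0 < b ^+ n.
Proof.
move=> H.
have ba : b <= a i0.
  rewrite leNgt; apply/negP => lt.
  have : \prod_i a i < \prod_(i < n.+1) b.
    apply: ltr_prod; first by apply/hasP; exists i0 => //; exact: mem_index_enum.
    by move=> j _; rewrite (ltW (a0 j)) (le_lt_trans (amax j)).
  by rewrite prodr_const card_ord H ltxx.
split=> //; rewrite ltNge; apply/negP => ge.
have ab : a i0 = b.
  apply/eqP; rewrite eq_le ba andbT -(ler_pM2r (P0 i0)) -prodE H exprS.
  by rewrite ler_pM2l.
apply: not_cube => i; apply/eqP; rewrite eq_le -{1}ab amax/= leNgt; apply/negP => lt.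
have : a i * P i < b * b ^+ n.
  apply: (@lt_le_trans _ _ (b * P i)); first by rewrite ltr_pM2r.
  rewrite ler_pM2l// /P -[in leRHS](card_neq i) -prodr_const; apply: ler_prod => j _.
  by rewrite (ltW (a0 j)) -ab amax.
by rewrite -prodE H exprS ltxx.
Qed.

End isoperimetric_constraints.

Section sigma1_bounds.
Context {R : realType} {n : nat}.
Hypothesis n0 : (0 < n)%N.
Implicit Types (a : 'rV[R]_n.+1) (b s al : R).

Let entries a (i : 'I_n.+1) : R := a ord0 i.

Lemma root_eigenvalue a (i0 : 'I_n.+1) s al : (forall i, 0 < a ord0 i) ->
  0 < s -> 0 < al -> al * a ord0 i0 < pi / 2 ->
  al * cos (al * a ord0 i0) = s * sin (al * a ord0 i0) ->
  root_sum (entries a) i0 s = al ^+ 2 ->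
  steklov_eigenvalue (cuboid a) (surface_measure a) s.
Proof.
move=> a0 s0 al0 alA al_eq al_sum.
pose be i := robin_inv (a ord0 i) s.
have be0 i : 0 < be i by exact: robin_inv_gt0.
have beE i : be i * sinhR (be i * a ord0 i) = s * coshR (be i * a ord0 i).
  have := robin_invK s (a0 i); rewrite -/(be i) robinE// => {1}<-.
  by rewrite -mulrA /tanhR divfK// lt0r_neq0// coshR_gt0.
pose f (i : 'I_n.+1) (z : R) := if i == i0 then sin (al * z) else coshR (be i * z).
pose f' (i : 'I_n.+1) (z : R) :=
  if i == i0 then al * cos (al * z) else be i * sinhR (be i * z).
pose l (i : 'I_n.+1) : R := if i == i0 then - al ^+ 2 else be i ^+ 2.
apply: (@separated_steklov _ _ a a0 f f' l s).
- move=> i z; rewrite /f /f'; case: eqP => _.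
    exact: is_derive_comp_lin (is_derive_sin _).
  exact: is_derive_comp_lin (is_derive_coshR _).
- move=> i z; rewrite /f /f' /l; case: eqP => _.
    have := is_derive_comp_lin (is_derive_cos (al * z)) => ?.
    by apply: is_derive_eq; rewrite /GRing.scale/=; ring.
  have := is_derive_comp_lin (is_derive_sinhR (be i * z)) => ?.
  by apply: is_derive_eq; rewrite /GRing.scale/=; ring.
- by move=> i; rewrite /f /f'; case: eqP => [->|].
- move=> i; rewrite /f /f' !mulrN cosN sinN sinhRN coshRN; case: eqP => [->|_].
    by rewrite al_eq mulrN opprK.
  by rewrite mulrN beE.
- rewrite (bigD1 i0)//= /l eqxx (eq_bigr (fun i => be i ^+ 2)) => [|i /negPf -> //].
  by rewrite -al_sum addNr.
(* The sine factor vanishes at the origin, so the point of nonvanishing is moved halfway along axis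
   [i0]. *)
- pose x : 'rV[R]_n.+1 := \row_i (if i == i0 then a ord0 i0 / 2 else 0).
  exists x.
    by move=> i; rewrite mxE; case: eqP => [->|_]; have := a0 i0; have := a0 i; lra.
  rewrite /separated; apply/prodf_neq0 => i _; rewrite mxE /f.
  case: (i =P i0) => _; last by rewrite lt0r_neq0// coshR_gt0.
  apply/lt0r_neq0/sin_gt0_pihalf; rewrite mulr_gt0 ?divr_gt0//=.
  by apply: lt_trans alA; rewrite ltr_pM2l// ltr_pdivrMr// ltr_pMr// ltr1n.
Qed.

Lemma sigma1_le_root a (i0 : 'I_n.+1) s al : (forall i, 0 < a ord0 i) ->
  0 < s -> 0 < al -> al * a ord0 i0 < pi / 2 ->
  al * cos (al * a ord0 i0) = s * sin (al * a ord0 i0) ->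
  root_sum (entries a) i0 s = al ^+ 2 ->
  sigma1 a <= s.
Proof.
move=> a0 s0 al0 alA al_eq al_sum; apply: ge_inf.
  have [B HB] := steklov_bounded_below a0.
  by exists B => t [/HB].
by split; [exact: root_eigenvalue al_sum|rewrite lt0r_neq0].
Qed.

Lemma sigma1_cube_ge_root b s al : 0 < b ->
  0 < s -> 0 < al -> al * b < pi / 2 ->
  al * cos (al * b) = s * sin (al * b) ->
  root_sum (fun _ : 'I_n.+1 => b) ord0 s = al ^+ 2 ->
  s <= sigma1 (const_mx b : 'rV[R]_n.+1).
Proof.
move=> b0 s0 al0 alb al_eq al_sum.
have a0 (i : 'I_n.+1) : 0 < (const_mx b : 'rV[R]_n.+1) ord0 i by rewrite mxE.
apply: lb_le_inf.
  (* A lower bound passes to [inf] only for a nonempty set; the root itself is a member. *)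
  exists s; split; last by rewrite lt0r_neq0.
  apply: (@root_eigenvalue _ ord0 s al) => //; rewrite ?mxE//.
  by rewrite -al_sum; apply: eq_bigr => j _; rewrite /entries mxE.
move=> t [teig t0]; rewrite leNgt; apply/negP => ts.
(* A positive level strictly between [t] and [s]. Keeping [al], the lower level makes both
   $n\beta^2<\alpha^2$ and the Robin condition strict, so the cube bound applies and gives
   [u <= t]. *)
pose u := (Num.max t 0 + s) / 2.
have m1 : t <= Num.max t 0 by rewrite le_max lexx.
have m2 : 0 <= Num.max t 0 by rewrite le_max lexx orbT.
have tu : t < u by rewrite /u; lra.
have u0 : 0 < u by rewrite /u; lra.
have us : u < s.
  have : Num.max t 0 < s by rewrite gt_max ts.
  by rewrite /u; lra.
have be0 := robin_inv_gt0 b0 u0; have be_lt := robin_inv_ltr b0 us.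
have E : robin_inv b u * sinhR (robin_inv b u * b) / coshR (robin_inv b u * b) = u.
  by rewrite -mulrA -/(tanhR _) -robinE// robin_invK.
have pi0 := pi_gt0 R; have alb' : al * b < pi by lra.
have ab (i : 'I_n.+1) : (const_mx b : 'rV[R]_n.+1) ord0 i = b by rewrite mxE.
have K1 : n%:R * robin_inv b u ^+ 2 < al ^+ 2.
  have <- : n%:R * robin_inv b s ^+ 2 = al ^+ 2.
    by rewrite -al_sum /root_sum sumr_const cardC1 card_ord mulr_natl.
  rewrite ltr_pM2l ?ltr0n//.
  by rewrite ltrXn2r ?nnegrE ?(ltW be0) ?(ltW (lt_trans be0 be_lt)).
have K2 : robin_inv b u * sinhR (robin_inv b u * b) / coshR (robin_inv b u * b) *
    sin (al * b) < al * cos (al * b).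
  by rewrite E al_eq ltr_pM2r// sin_gt0_pihalf// mulr_gt0.
have := steklov_cube_ge a0 ab al0 alb' be0 K1 K2 teig t0.
by rewrite E leNgt tu.
Qed.

Lemma sigma1_lt_cube a b (i0 : 'I_n.+1) : (forall i, 0 < a ord0 i) -> 0 < b ->
  b <= a ord0 i0 -> \prod_(j | j != i0) a ord0 j < b ^+ n ->
  sigma1 a < sigma1 (const_mx b : 'rV[R]_n.+1).
Proof.
move=> a0 b0 ba Pb.
have [s [al [s0 al0 alA al_eq al_sum]]] := @steklov_root R n (entries a) i0 a0 n0.
have [sg [alc [sg0 alc0 alcb alc_eq alc_sum]]] :=
  @steklov_root R n (fun=> b) ord0 (fun=> b0) n0.
apply: le_lt_trans (sigma1_le_root a0 s0 al0 alA al_eq al_sum) _.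
apply: lt_le_trans (sigma1_cube_ge_root b0 sg0 alc0 alcb alc_eq alc_sum).
apply: (@root_lt R n (entries a) i0 b a0 b0 ba Pb s al sg alc) => //.
by rewrite -alc_sum /root_sum sumr_const cardC1 card_ord mulr_natl.
Qed.

Lemma cuboid_inj a a' : (forall i, 0 < a ord0 i) -> (forall i, 0 < a' ord0 i) ->
  cuboid a = cuboid a' -> a = a'.
Proof.
have H (c c' : 'rV[R]_n.+1) : (forall i, 0 < c ord0 i) -> (forall i, 0 < c' ord0 i) ->
    cuboid c `<=` cuboid c' -> forall i, c ord0 i <= c' ord0 i.
  move=> c0 c'0 sub i; rewrite leNgt; apply/negP => lt.
  (* A centre of a face of [cuboid c']: excluded from that open set, but interior to [cuboid c] when
     [c' ord0 i < c ord0 i]. *)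
  pose x : 'rV[R]_n.+1 := \row_j (if j == i then c' ord0 i else 0).
  have /sub/(_ i) : cuboid c x.
    by move=> j; rewrite mxE; case: eqP => [->|_]; have := c0 j; have := c'0 i; lra.
  by rewrite mxE eqxx ltxx andbF.
move=> a0 a0' e; apply/rowP => i; apply/eqP; rewrite eq_le !H// e; exact: subset_refl.
Qed.

Lemma prod_lift a (i : 'I_n.+1) : (forall j, 0 < a ord0 j) ->
  \prod_(j < n) a ord0 (lift i j) = \prod_(j | j != i) a ord0 j.
Proof.
move=> a0; apply: (mulfI (lt0r_neq0 (a0 i))).
transitivity (\prod_j a ord0 j); last by rewrite (bigD1 i).
by rewrite (bigD1_ord i).
Qed.

Lemma isoperimetric a b (not_cube : ~ (forall i, a ord0 i = b)) :
  (forall i, 0 < a ord0 i) -> 0 < b ->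
  surface_measure (const_mx b : 'rV[R]_n.+1) setT = surface_measure a setT \/
  lebesgue_rV R n.+1 (cuboid (const_mx b)) = lebesgue_rV R n.+1 (cuboid a) ->
  sigma1 a < sigma1 (const_mx b : 'rV[R]_n.+1).
Proof.
move=> a0 b0 H.
have c0 (i : 'I_n.+1) : 0 < (const_mx b : 'rV[R]_n.+1) ord0 i by rewrite mxE.
pose i0 := [arg max_(i > ord0) a ord0 i]%O.
(* Taking the sine along the longest side is what makes both constraints yield [b <= a ord0 i0]. *)
have amax i : a ord0 i <= a ord0 i0.
  by rewrite /i0; case: arg_maxP => // k _; apply.
suff [ba Pb] : b <= a ord0 i0 /\ \prod_(j | j != i0) a ord0 j < b ^+ n.
  exact: sigma1_lt_cube ba Pb.
case: H => [|].
  rewrite !surface_measureT// => -[] /(mulfI _) H.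
  apply: (surface_constraint n0 a0 b0 amax not_cube).
  have {}H : \sum_(i < n.+1) \prod_(j < n) (2 * (const_mx b : 'rV[R]_n.+1) ord0 (lift i j)) =
      \sum_(i < n.+1) \prod_(j < n) (2 * a ord0 (lift i j)) by apply: H.
  apply: (@mulfI _ (2 ^+ n)); first by rewrite expf_neq0.
  rewrite mulr_sumr; transitivity (\sum_(i < n.+1) \prod_(j < n) (2 * a ord0 (lift i j))).
    apply: eq_bigr => i _; rewrite big_split/= prodr_const card_ord; congr (_ * _).
    by rewrite prod_lift.
  rewrite -H; under eq_bigr do under eq_bigr do rewrite mxE.
  under eq_bigr do rewrite prodr_const card_ord exprMn.
  by rewrite sumr_const card_ord -[LHS]mulr_natl mulrCA.
rewrite !lebesgue_cuboid// => -[] H.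
apply: (volume_constraint a0 b0 amax not_cube).
apply: (@mulfI _ (2 ^+ n.+1)); first by rewrite expf_neq0.
move: H; under eq_bigr do rewrite mxE.
rewrite prodr_const card_ord exprMn => ->.
by rewrite big_split/= prodr_const card_ord.
Qed.

End sigma1_bounds.

Theorem theorem1p6 (R : realType) (d : nat) (a : 'rV[R]_d) (b c : R)
    (hd : (2 <= d)%N)
    (ha : forall i : 'I_d, 0 < a ord0 i) (hb : 0 < b) (hc : 0 < c)
    (hstar : surface_measure (const_mx b : 'rV[R]_d) setT =
             surface_measure a setT)
    (hsharp : lebesgue_rV R d (cuboid (const_mx c : 'rV[R]_d)) =
              lebesgue_rV R d (cuboid a)) :
  (sigma1 a <= sigma1 (const_mx b : 'rV[R]_d) /\
   (sigma1 (const_mx b : 'rV[R]_d) = sigma1 a <->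
    cuboid (const_mx b : 'rV[R]_d) = cuboid a)) /\
  (sigma1 a <= sigma1 (const_mx c : 'rV[R]_d) /\
   (sigma1 (const_mx c : 'rV[R]_d) = sigma1 a <->
    cuboid (const_mx c : 'rV[R]_d) = cuboid a)).
Proof.
case: d hd a ha hstar hsharp => // n n0 a a0 hstar hsharp.
(* Both assertions have this shape. Unless the cuboid is the cube, the inequality is strict, which
   settles the equality case in one direction; the other uses that an open cuboid determines its
   half-lengths. *)
have cube e : 0 < e ->
    surface_measure (const_mx e : 'rV[R]_n.+1) setT = surface_measure a setT \/
    lebesgue_rV R n.+1 (cuboid (const_mx e)) = lebesgue_rV R n.+1 (cuboid a) ->
    sigma1 a <= sigma1 (const_mx e : 'rV[R]_n.+1) /\
    (sigma1 (const_mx e : 'rV[R]_n.+1) = sigma1 a <->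
     cuboid (const_mx e : 'rV[R]_n.+1) = cuboid a).
  move=> e0 H; have [ae|nae] := pselect (forall i, a ord0 i = e).
    by have -> : a = const_mx e by apply/rowP => i; rewrite mxE.
  have lt := isoperimetric n0 nae a0 e0 H; split; first exact: ltW.
  split=> [E|E]; first by rewrite E ltxx in lt.
  have c0 (i : 'I_n.+1) : 0 < (const_mx e : 'rV[R]_n.+1) ord0 i by rewrite mxE.
  by case: nae => i; rewrite -(cuboid_inj c0 a0 E) mxE.
by split; [apply: cube => //; left|apply: cube => //; right].
Qed.
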